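(* Let $R_q\subset J_q(T)$ ($q\ge1$) be a transitive involutive system of infinitesimal Lie equations, and let $c\in A(R^0_q)$ be the class of an $R_q$-connection. Consider $$\mathrm{Cart}(R_q)=\{c'\in A(R^0_q)\ |\ c' \text{ is } R_q\text{-invariant},\ \tfrac12\{c',c'\}=0 \text{ in } F_2\},$$ which contains $c$. Then the space of infinitesimal deformations of $\mathrm{Cart}(R_q)$ at $c$, i.e. the space of solutions $C\in F_1$ of the linearized conditions $$L(\xi_q)C=0\ \ \forall \xi_q\in R_q,\qquad \{c,C\}:=\frac{d}{dt}\Big|_{t=0}\tfrac12\{c+tC,c+tC\}=0\ \text{ in } F_2,$$ is exactly the space of cocycles $Z_1(R_q)=\{C\in\Upsilon_1\ |\ {\cal D}_2C=0\}$.
   Context: $X$ is a smooth manifold of dimension $n$, $T=T(X)$; a vector bundle and its (local) sections are denoted by the same letter. $J_q(T)$ is the bundle of $q$-jets of vector fields; a section $\xi_q$ has components $\xi^k_\mu$, $|\mu|\le q$, and lies over $\xi=(\xi^k)\in T$; $j_q(\xi)$ has components $\partial_\mu\xi^k$. When the same letter occurs with different orders, the lower order section is the projection of the higher order one. $S_qT^*\otimes T=\ker(J_q(T)\to J_{q-1}(T))$, $J^0_q(T)=\ker(J_q(T)\to T)$. Spencer operator: $D:J_{q+1}(T)\to T^*\otimes J_q(T)$, $(D\xi_{q+1})^k_{\mu,i}=\partial_i\xi^k_\mu-\xi^k_{\mu+1_i}$, extended to $\wedge^rT^*\otimes J_{q+1}(T)\to\wedge^{r+1}T^*\otimes J_q(T)$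 by $D(\alpha\otimes\xi_{q+1})=d\alpha\otimes\xi_q+(-1)^r\alpha\wedge D\xi_{q+1}$. Spencer map: $\delta:\wedge^rT^*\otimes S_{q+1}T^*\otimes T\to\wedge^{r+1}T^*\otimes S_qT^*\otimes T$, $(\delta\omega)^k_\mu=dx^i\wedge\omega^k_{\mu+1_i}$. Algebraic bracket: the bilinear bundle map $\{\ ,\ \}:J_{q+1}(T)\times J_{q+1}(T)\to J_q(T)$ determined by $\{j_{q+1}(\xi),j_{q+1}(\eta)\}=j_q([\xi,\eta])$. Differential bracket on $J_q(T)$: $[\xi_q,\eta_q]=\{\xi_{q+1},\eta_{q+1}\}+i(\xi)D\eta_{q+1}-i(\eta)D\xi_{q+1}$ (independent of the lifts). Systems: $R_q\subset J_q(T)$ a vector subbundle; $R^0_q=R_q\cap J_q^0(T)$; $R_{q+r}=J_r(R_q)\cap J_{q+r}(T)$, $g_{q+r}=R_{q+r}\cap(S_{q+r}T^*\otimes T)$. $R_q$ is a system of infinitesimal Lie equations if $[R_q,R_q]\subset R_q$; transitive if $R_q\to T$ is surjective; involutive if all $R_{q+r}$ are vector bundles with $R_{q+r+1}\to R_{q+r}$ surjective for all $r\ge0$ and all $\delta$-sequences $\wedge^{s-1}T^*\otimes g_{q+r+1}\to\wedge^sT^*\otimes g_{q+r}\to\wedge^{s+1}T^*\otimes g_{q+r-1}$ (with $g_{q-1}=S_{q-1}T^*\otimes T$) are exact for $0\le s\le n$, $r\ge0$. Janet bundles: $F_r=\wedge^rT^*\otimes J_q(T)\big/\big(\wedge^rT^*\otimes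 R_q+\delta(\wedge^{r-1}T^*\otimes S_{q+1}T^*\otimes T)\big)=\wedge^rT^*\otimes J^0_q(T)\big/\big(\wedge^rT^*\otimes R^0_q+\delta(\wedge^{r-1}T^*\otimes S_{q+1}T^*\otimes T)\big)$. ${\cal D}_r:F_{r-1}\to F_r$: represent a section by $A_q\in\wedge^{r-1}T^*\otimes J_q(T)$, lift it suitably to $A_{q+1}\in\wedge^{r-1}T^*\otimes J_{q+1}(T)$, take the class of $DA_{q+1}$. Formal Lie derivative: on $J_q(T)$, $L(\xi_{q+1})\eta_q=\{\xi_{q+1},\eta_{q+1}\}+i(\xi)D\eta_{q+1}$; on $T$, $L(\xi_1)\eta=\{\xi_1,j_1(\eta)\}$; on $T^*$, $(L(\xi_1)\alpha)_i=\alpha_r\xi^r_i+\xi^r\partial_r\alpha_i$; extended to tensor products by the Leibniz rule. For $\xi_q\in R_q$ with any lift $\xi_{q+1}\in R_{q+1}$, $L(\xi_{q+1})$ induces $L(\xi_q)$ on $F_r$; $\Upsilon_r=\{\eta\in F_r: L(\xi_q)\eta=0\ \forall\xi_q\in R_q\}$. $A(R^0_q)$ is the affine bundle of elements of $T^*\otimes J_q(T)/(T^*\otimes R^0_q+\delta(S_{q+1}T^*\otimes T))$ whose projection to $T^*\otimes T$ is $id_T$; it is modelled on $F_1$. For $\xi_q\in R_q$ and $c\in A(R_q^0)$ represented by $\chi_q$, $L(\xi_q)c\in F_1$ is the class of $L(\xi_{q+1})\chi_q$ for any lift $\xi_{q+1}\in J_{q+1}(T)$; $c$ is $R_q$-invariant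 (resp. $R^0_q$-invariant) if $L(\xi_q)c=0$ for all $\xi_q$ in $R_q$ (resp. $R^0_q$). An $R_q$-connection is a section $\chi_q\in T^*\otimes R_q$ over $id_T$. For an $R_q^0$-invariant $c$ represented by $\chi_q$ with projection $\chi_1\in T^*\otimes J_1(T)$ and any lift $\chi_{q+1}\in T^*\otimes J_{q+1}(T)$, $\frac12\{c,c\}\in F_2$ is the (well defined) class of $$(\eta,\zeta)\mapsto\{\chi_{q+1}(\eta),\chi_{q+1}(\zeta)\}-\chi_q(\{\chi_1(\eta),\chi_1(\zeta)\}).$$ *)

(* Defs.v *)
From mathcomp Require Import all_boot all_order all_fingroup all_algebra.
From mathcomp Require Import all_classical all_reals all_analysis.
Set Implicit Arguments.
Unset Strict Implicit.
Unset Printing Implicit Defensive.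
Import Order.TTheory GRing.Theory Num.Theory.
Import numFieldNormedType.Exports.
Local Open Scope classical_set_scope.
Local Open Scope ring_scope.

(* Everything below is written in the charts of an atlas.  A local section    *)
(* over an open set is a total function of which only the values on that open *)
(* set are ever constrained or used.                                          *)

Section Calculus.
Variables (R : realType) (n : nat).
Implicit Types (f : 'rV[R]_n -> R) (V : set 'rV[R]_n).

Definition partial (i : 'I_n) f : 'rV[R]_n -> R := fun y => 'D_('e_i) f y.

Definition partials (s : seq 'I_n) f : 'rV[R]_n -> R := foldr partial f s.

Definition smooth V f : Prop :=
  forall s y, V y -> {for y, continuous (partials s f)} /\
                     forall i, derivable (partials s f) y 'e_i.

Definition mindex : Type := {ffun 'I_n -> nat}.
Implicit Types (m : mindex).
Definition mdeg m : nat := (\sum_i m i)%N.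
Definition mzero : mindex := [ffun=> 0%N].
Definition madd m m' : mindex := [ffun i => (m i + m' i)%N].
Definition msub m m' : mindex := [ffun i => (m i - m' i)%N].
Definition munit (i : 'I_n) : mindex := [ffun j => (j == i : nat)].
Definition mbin m m' : nat := (\prod_i 'C(m i, m' i))%N.
Definition mfact m : nat := (\prod_i (m i)`!)%N.
Definition mbox N : Type := {ffun 'I_n -> 'I_N.+1}.
Definition mval N (b : mbox N) : mindex := [ffun i => b i : nat].

Definition mpartial m f : 'rV[R]_n -> R :=
  foldr (fun i => iter (m i) (partial i)) f (enum 'I_n).

End Calculus.

Arguments mzero {n}.

Section CalculusFacts.
Variables (R : realType) (n : nat).
Implicit Types (f g : 'rV[R]_n -> R) (V : set 'rV[R]_n) (i j : 'I_n).

Lemma smooth_partial V f i : smooth V f -> smooth V (partial i f).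
Proof.
move=> sf s y Vy.
have -> : partials s (partial i f) = partials (rcons s i) f.
  by rewrite /partials foldr_rcons.
exact: sf.
Qed.

Lemma smooth_partials V f s : smooth V f -> smooth V (partials s f).
Proof. by move=> sf; elim: s => //= i s IH; apply: smooth_partial. Qed.

Lemma smooth_derivable V f y i : smooth V f -> V y -> derivable f y 'e_i.
Proof. by move=> sf Vy; have [_] := sf [::] y Vy; apply. Qed.

Lemma smooth_continuous V f y : smooth V f -> V y -> {for y, continuous f}.
Proof. by move=> sf Vy; have [] := sf [::] y Vy. Qed.

Lemma eq_partial V f g i y : open V -> V y -> (forall z, V z -> f z = g z) ->
  partial i f y = partial i g y.
Proof.
move=> oV Vy fg; apply: near_eq_derive.
by have := open_nbhs_nbhs (conj oV Vy); apply: filterS.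
Qed.

Lemma is_derive_line f (a v : 'rV[R]_n) (t : R) : derivable f (a + t *: v) v ->
  is_derive t 1 (fun u => f (a + u *: v)) ('D_v f (a + t *: v)).
Proof.
move=> df.
have E : (fun h : R => h^-1 *: (((fun u => f (a + u *: v)) \o shift t) (h *: 1)
     - f (a + t *: v))) =
   (fun h : R => h^-1 *: ((f \o shift (a + t *: v)) (h *: v) - f (a + t *: v))).
  apply/funext => h /=; congr (_ *: (f _ - _)).
  by rewrite [_%:A]mulr1 scalerDl addrCA.
by apply: DeriveDef; rewrite /derivable /derive E.
Qed.

Lemma second_difference V f i j (y : 'rV[R]_n) (h : R) :
  smooth V f -> 0 < h ->
  (forall s t : R, 0 <= s <= h -> 0 <= t <= h ->
     V (y + s *: 'e_i + t *: 'e_j)) ->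
  exists s t : R, [/\ 0 <= s <= h, 0 <= t <= h &
    f (y + h *: 'e_i + h *: 'e_j) - f (y + h *: 'e_i) - f (y + h *: 'e_j) + f y
    = h * h * partial j (partial i f) (y + s *: 'e_i + t *: 'e_j)].
Proof.
move=> sf h0 Vb.
have hh : 0 <= h <= h by rewrite lexx ltW.
have h00 : 0 <= (0 : R) <= h by rewrite lexx ltW.
have Vb0 s : 0 <= s <= h -> V (y + s *: 'e_i).
  by move=> hs; have := Vb s 0 hs h00; rewrite scale0r addr0.
have swap (s t : R) : y + s *: 'e_i + t *: 'e_j = y + t *: 'e_j + s *: 'e_i :> 'rV[R]_n.
  by rewrite addrAC.
pose phi (u : R) := f (y + h *: 'e_j + u *: 'e_i) - f (y + u *: 'e_i).
pose dphi (u : R) :=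
  partial i f (y + h *: 'e_j + u *: 'e_i) - partial i f (y + u *: 'e_i).
have dphiP u : 0 <= u <= h -> is_derive u 1 phi (dphi u).
  move=> hu.
  have d1 : derivable f (y + h *: 'e_j + u *: 'e_i) 'e_i.
    by apply: (smooth_derivable sf); rewrite -swap; apply: Vb.
  have d2 : derivable f (y + u *: 'e_i) 'e_i.
    by apply: (smooth_derivable sf); apply: Vb0.
  exact: (@is_deriveB _ _ _ _ _ _ _ _ _ (is_derive_line d1) (is_derive_line d2)).
have [||c hc ec] := @MVT _ phi dphi 0 h h0.
- by move=> x /[!in_itv]/= /andP[x0 xh]; apply: dphiP; rewrite !ltW.
- apply: derivable_within_continuous => x /[!in_itv]/= hx.
  by case: (dphiP x hx).
move: hc; rewrite in_itv /= => /andP[c0 ch].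
have hc : 0 <= c <= h by rewrite !ltW.
pose psi (u : R) := partial i f (y + c *: 'e_i + u *: 'e_j).
pose dpsi (u : R) := partial j (partial i f) (y + c *: 'e_i + u *: 'e_j).
have dpsiP u : 0 <= u <= h -> is_derive u 1 psi (dpsi u).
  move=> hu; apply: is_derive_line.
  by apply: (smooth_derivable (smooth_partial i sf)); apply: Vb.
have [||d hd ed] := @MVT _ psi dpsi 0 h h0.
- by move=> x /[!in_itv]/= /andP[x0 xh]; apply: dpsiP; rewrite !ltW.
- apply: derivable_within_continuous => x /[!in_itv]/= hx.
  by case: (dpsiP x hx).
move: hd; rewrite in_itv /= => /andP[d0 dh].
exists c, d; split; rewrite ?hc ?ltW//.
move: ec ed; rewrite /phi /dphi /psi /dpsi !scale0r !addr0 !subr0 => ec ed.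
rewrite -!(swap c) ed in ec.
rewrite -mulrA [h * _]mulrC [h * partial _ _ _]mulrC -ec -swap.
by rewrite opprB [RHS]addrA [LHS]addrAC.
Qed.

Lemma partialC V f i j y : open V -> smooth V f -> V y ->
  partial i (partial j f) y = partial j (partial i f) y.
Proof.
move=> oV sf Vy.
suff H k l (e : R) : 0 < e -> exists2 d : R, 0 < d & forall h, 0 < h < d ->
  `| (f (y + h *: 'e_k + h *: 'e_l) - f (y + h *: 'e_k) - f (y + h *: 'e_l) + f y)
     / (h * h) - partial l (partial k f) y| < e.
  apply/eqP; rewrite -subr_eq0 -normr_eq0; apply/negPn/negP => ne0.
  set N := `|_| in ne0.
  have N0 : 0 < N / 2 by rewrite divr_gt0 // lt_neqAle eq_sym ne0 normr_ge0.
  have [d1 d10 h1] := H i j _ N0; have [d2 d20 h2] := H j i _ N0.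
  pose d := Order.min d1 d2.
  have d0 : 0 < d by rewrite lt_min d10.
  have hd0 : 0 < d / 2 by rewrite divr_gt0.
  have hdd : d / 2 < d by rewrite ltr_pdivrMr // ltr_pMr // ltr1n.
  have hd1 : 0 < d / 2 < d1 by rewrite hd0 (lt_le_trans hdd) // ge_min lexx.
  have hd2 : 0 < d / 2 < d2 by rewrite hd0 (lt_le_trans hdd) // ge_min lexx orbT.
  have := h1 _ hd1; have := h2 _ hd2; set h := d / 2.
  rewrite [y + h *: 'e_j + h *: 'e_i]addrAC.
  rewrite [_ - f (y + h *: 'e_j) - f (y + h *: 'e_i)]addrAC.
  set D := (_ / _) => l2 l1.
  have : N < N.
    rewrite [ltRHS]splitr; apply: le_lt_trans (ltrD l1 l2).
    rewrite [leRHS]addrC -[leLHS]/`|_ - _| -(subrKA D).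
    by rewrite (le_trans (ler_normD _ _)) // lerD // distrC.
  by rewrite ltxx.
move=> e0.
have cP : {for y, continuous (partial l (partial k f))}.
  exact: (smooth_continuous (smooth_partial l (smooth_partial k sf)) Vy).
have nP : \forall z \near y, V z /\ `|partial l (partial k f) z - partial l (partial k f) y| < e.
  near=> z; split.
    by near: z; exact: open_nbhs_nbhs.
  near: z; move/cvgrPdist_lt: cP => /(_ e e0); apply: filterS => z.
  by rewrite distrC.
have [d d0 hd] : exists2 d : R, 0 < d & forall s t : R, `|s| < d -> `|t| < d ->
   let z : 'rV[R]_n := y + s *: 'e_k + t *: 'e_l in
   V z /\ `|partial l (partial k f) z - partial l (partial k f) y| < e.
  move/nbhs_ballP: nP => [r r0 br].
  exists (r / 2); first by rewrite divr_gt0.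
  move=> s t hs ht; apply: br; rewrite -ball_normE /ball_ /=.
  rewrite -addrA opprD addrA subrr add0r normrN.
  have ne (m : 'I_n) : `|'e_m : 'rV[R]_n| <= 1.
    rewrite [leLHS]/Num.norm /= mx_normrE; apply/bigmax_leP; split => // a _.
    by rewrite mxE; case: (_ && _); rewrite ?normr1 ?normr0.
  rewrite (le_lt_trans (ler_normD _ _)) // !normrZ [r]splitr ltrD //.
    by rewrite (le_lt_trans _ hs) // ler_piMr.
  by rewrite (le_lt_trans _ ht) // ler_piMr.
exists d => // h /andP[h0 hd'].
have hb (s : R) : 0 <= s <= h -> `|s| < d.
  by move=> /andP[s0 sh]; rewrite ger0_norm // (le_lt_trans sh).
have [s [t [hs ht ->]]] : exists s t : R, [/\ 0 <= s <= h, 0 <= t <= h &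
    f (y + h *: 'e_k + h *: 'e_l) - f (y + h *: 'e_k) - f (y + h *: 'e_l) + f y
    = h * h * partial l (partial k f) (y + s *: 'e_k + t *: 'e_l)].
  apply: (second_difference sf h0) => s t hs ht.
  by have [] := hd s t (hb _ hs) (hb _ ht).
rewrite mulrAC divff ?mul1r; last by rewrite mulf_neq0 // gt_eqF.
by have [] := hd s t (hb _ hs) (hb _ ht).
Unshelve. all: by end_near. Qed.

Lemma partials_mid V f t1 t2 i y : open V -> smooth V f -> V y ->
  partials (t1 ++ i :: t2) f y = partials (i :: t1 ++ t2) f y.
Proof.
move=> oV sf; elim: t1 y => [//|j t1 IH] y Vy /=.
rewrite (eq_partial j oV Vy IH) /=.
by rewrite (partialC i j oV (smooth_partials _ sf) Vy).
Qed.

Lemma partials_perm V f s t y : open V -> smooth V f -> V y ->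
  perm_eq s t -> partials s f y = partials t f y.
Proof.
move=> oV sf; elim: s t y => [|i s IH] t y Vy.
  by rewrite perm_sym => /perm_nilP ->.
move=> st; have it : i \in t by rewrite -(perm_mem st) mem_head.
case/splitPr: it st => t1 t2 st.
rewrite (partials_mid t1 t2 i oV sf Vy) /=.
apply: (eq_partial i oV Vy) => z Vz; apply: IH => //.
rewrite -(perm_cons i); apply: (perm_trans st).
by rewrite perm_sym -cat1s perm_catCA.
Qed.

Lemma mpartialE (m : mindex n) f :
  mpartial m f = partials (flatten [seq nseq (m i) i | i <- enum 'I_n]) f.
Proof.
rewrite /mpartial; elim: (enum _) => //= i s IH.
rewrite IH /partials foldr_cat.
by elim: (m i) => //= k ->.
Qed.

Lemma smooth_mpartial V f (m : mindex n) : smooth V f -> smooth V (mpartial m f).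
Proof. by move=> sf; rewrite mpartialE; apply: smooth_partials. Qed.

Lemma count_mseq (m : mindex n) j :
  count_mem j (flatten [seq nseq (m i) i | i <- enum 'I_n]) = m j.
Proof.
rewrite count_flatten -map_comp sumnE big_map big_enum /=.
rewrite (bigD1 j) //= big1 ?addn0 => [|i ij]; rewrite count_nseq /=.
  by rewrite eqxx mul1n.
by rewrite (negbTE ij).
Qed.

Lemma mpartialS V f (m : mindex n) i y : open V -> smooth V f -> V y ->
  mpartial (madd m (munit i)) f y = partial i (mpartial m f) y.
Proof.
move=> oV sf Vy; rewrite !mpartialE.
rewrite -[RHS]/(partials (i :: _) f y); apply: (partials_perm oV sf Vy).
rewrite perm_sym; apply/allP => j _ /=; rewrite !count_mseq !ffunE.
by rewrite addnC [in j == i]eq_sym eqxx.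
Qed.

Lemma mpartial_partial V f (m : mindex n) i y : open V -> smooth V f -> V y ->
  mpartial m (partial i f) y = mpartial (madd m (munit i)) f y.
Proof.
move=> oV sf Vy; rewrite (mpartialS m i oV sf Vy) !mpartialE.
rewrite -[RHS]/(partials (i :: _) f y) -[in RHS](cats0 (flatten _)).
by rewrite -(partials_mid _ _ i oV sf Vy) /partials foldr_cat.
Qed.

Lemma mpartial0 f : mpartial mzero f = f.
Proof.
rewrite mpartialE; suff -> : flatten [seq nseq ((mzero : mindex n) i) i | i <- enum 'I_n] = [::] by [].
by elim: (enum _) => //= i s ->; rewrite ffunE.
Qed.

Lemma is_derive_bigsum (I : Type) (r : seq I) (F : I -> 'rV[R]_n -> R)
    (dF : I -> R) (y v : 'rV[R]_n) :
  (forall b, is_derive y v (F b) (dF b)) ->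
  is_derive y v (fun z => \sum_(b <- r) F b z) (\sum_(b <- r) dF b).
Proof.
move=> dFP; elim: r => [|b r IH].
  rewrite big_nil (_ : (fun _ => _) = cst 0); first exact: is_derive_cst.
  by apply/funext => z; rewrite big_nil.
rewrite big_cons (_ : (fun _ => _) = F b + (fun z => \sum_(b <- r) F b z)).
  exact: is_deriveD.
by apply/funext => z; rewrite big_cons.
Qed.

Lemma smooth_coind V (K : set ('rV[R]_n -> R)) : open V ->
  (forall h y, K h -> V y ->
     {for y, continuous h} /\ forall i, derivable h y 'e_i) ->
  (forall h i, K h -> exists2 h', K h' & forall y, V y -> partial i h y = h' y) ->
  forall h, K h -> smooth V h.
Proof.
move=> oV K1 K2 h Kh s.
have [h' Kh' hh'] : exists2 h', K h' & forall y, V y -> partials s h y = h' y.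
  elim: s => [|i s [h1 Kh1 hh1]]; first by exists h.
  have [h2 Kh2 hh2] := K2 h1 i Kh1; exists h2 => // y Vy /=.
  by rewrite (eq_partial i oV Vy hh1) hh2.
move=> y Vy; have [c d] := K1 h' y Kh' Vy.
have nE : \forall z \near y, h' z = partials s h z.
  have := open_nbhs_nbhs (conj oV Vy); apply: filterS => z Vz.
  by rewrite hh'.
split => [|i]; last exact: near_eq_derivable nE (d i).
rewrite /prop_for /continuous_at (hh' _ Vy).
exact: (cvg_trans (near_eq_cvg nE) c).
Qed.

Lemma continuous_bigsum (I : Type) (r : seq I) (F : I -> 'rV[R]_n -> R)
    (y : 'rV[R]_n) : (forall b, {for y, continuous (F b)}) ->
  {for y, continuous (fun z => \sum_(b <- r) F b z)}.
Proof.
move=> FP; elim: r => [|b r IH].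
  rewrite (_ : (fun _ => _) = cst 0); first exact: cst_continuous.
  by apply/funext => z; rewrite big_nil.
rewrite (_ : (fun _ => _) = F b + (fun z => \sum_(b <- r) F b z)).
  exact: continuousD.
by apply/funext => z; rewrite big_cons.
Qed.

Lemma smoothM V f g : open V -> smooth V f -> smooth V g ->
  smooth V (fun z => f z * g z).
Proof.
move=> oV sf sg.
pose K : set ('rV[R]_n -> R) := [set h | exists (I : finType) (F G : I -> 'rV[R]_n -> R),
  (forall b, smooth V (F b) /\ smooth V (G b)) /\
  h = (fun z => \sum_b F b z * G b z)].
have dK (I : finType) (F G : I -> 'rV[R]_n -> R) i y : V y ->
    (forall b, smooth V (F b) /\ smooth V (G b)) ->
    is_derive y 'e_i (fun z => \sum_b F b z * G b z)
      (\sum_b (F b y * partial i (G b) y + G b y * partial i (F b) y)).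
  move=> Vy sFG.
  apply: (@is_derive_bigsum _ (index_enum I) (fun b z => F b z * G b z)) => b.
  have [s1 s2] := sFG b.
  have d1 := derivableP (smooth_derivable (i:=i) s1 Vy).
  have d2 := derivableP (smooth_derivable (i:=i) s2 Vy).
  exact: (is_deriveM d1 d2).
apply: (@smooth_coind V K oV); last first.
- exists unit, (fun=> f), (fun=> g); split => //.
  by apply/funext => z; rewrite (big_pred1 tt) // => -[].
- move=> h i [I [F [G [sFG ->]]]].
  exists (fun z => \sum_(p : I * bool)
    (if p.2 then F p.1 else G p.1) z * (if p.2 then partial i (G p.1) else partial i (F p.1)) z).
    exists (I * bool)%type, (fun p => if p.2 then F p.1 else G p.1),
      (fun p => if p.2 then partial i (G p.1) else partial i (F p.1)); split; [|reflexivity].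
    move=> [b c] /=; have [s1 s2] := sFG b.
    case: c; split; [exact: s1|exact: smooth_partial|exact: s2|exact: smooth_partial].
  move=> y Vy; rewrite /partial (@derive_val _ _ _ _ _ _ _ (dK I F G i y Vy sFG)).
  rewrite -(pair_bigA _ (fun b (c : bool) => (if c then F b else G b) y *
    (if c then partial i (G b) else partial i (F b)) y)) /=.
  by apply: eq_bigr => b _; rewrite big_bool.
- move=> h y [I [F [G [sFG ->]]]] Vy; split => [|i].
    apply: (@continuous_bigsum _ (index_enum I) (fun b z => F b z * G b z)) => b.
    have [s1 s2] := sFG b.
    apply: (@continuousM _ _ (F b) (G b)); exact: smooth_continuous Vy.
  by case: (dK I F G i y Vy sFG).
Qed.

Lemma mbinS (m b : mindex n) i : mbin (madd m (munit i)) b =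
  (mbin m b + (if 0 < b i then mbin m (msub b (munit i)) else 0))%N.
Proof.
have D (h : 'I_n -> nat) :
    (\prod_j h j = h i * \prod_(j < n | j != i) h j)%N by rewrite (bigD1 i).
rewrite /mbin 3!D.
have E : (\prod_(j < n | j != i) 'C(madd m (munit i) j, b j) =
          \prod_(j < n | j != i) 'C(m j, b j))%N.
  by apply: eq_bigr => j ji; rewrite !ffunE (negbTE ji) addn0.
have E' : (\prod_(j < n | j != i) 'C(m j, msub b (munit i) j) =
          \prod_(j < n | j != i) 'C(m j, b j))%N.
  by apply: eq_bigr => j ji; rewrite !ffunE (negbTE ji) subn0.
rewrite E E' !ffunE eqxx addn1 subn1.
by case: (b i) => [|k] /=; rewrite ?bin0 ?addn0 // binS mulnDl.
Qed.

Lemma mbin_gt0 (m b : mindex n) : (0 < mbin m b)%N = [forall i, b i <= m i]%N.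
Proof.
apply/idP/forallP => [|H].
  rewrite /mbin => H i; move: H; rewrite (bigD1 i) //= muln_gt0 bin_gt0.
  by case/andP.
by rewrite /mbin prodn_cond_gt0 // => i _; rewrite bin_gt0.
Qed.

Lemma mdeg_ge (m : mindex n) i : (m i <= mdeg m)%N.
Proof. by rewrite /mdeg (bigD1 i) //= leq_addr. Qed.

Lemma mdeg_add (m m' : mindex n) : mdeg (madd m m') = (mdeg m + mdeg m')%N.
Proof. by rewrite /mdeg -big_split; apply: eq_bigr => i _; rewrite ffunE. Qed.

Lemma mdeg_unit i : mdeg (munit i : mindex n) = 1%N.
Proof.
rewrite /mdeg (bigD1 i) //= ffunE eqxx big1 // => j ji.
by rewrite ffunE (negbTE ji).
Qed.

Lemma mdeg0 (m : mindex n) : mdeg m = 0%N -> m = mzero.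
Proof.
move=> m0; apply/ffunP => i; rewrite ffunE.
by apply/eqP; rewrite -leqn0 -m0 mdeg_ge.
Qed.

Lemma leibniz V f g (m : mindex n) N y : open V -> smooth V f -> smooth V g ->
  V y -> (forall i, m i <= N)%N ->
  mpartial m (fun z => f z * g z) y =
  \sum_(b : mbox n N) (mbin m (mval b))%:R *
     (mpartial (mval b) f y * mpartial (msub m (mval b)) g y).
Proof.
move=> oV sf sg; have [k mk] := ubnP (mdeg m).
elim: k m mk y => // k IH m mk y Vy mN.
have [/mdeg0 m0|] := eqVneq (mdeg m) 0%N.
  rewrite m0 mpartial0 (bigD1 ([ffun=> ord0] : mbox n N)) //= big1 ?addr0.
    have -> : mval ([ffun=> ord0] : mbox n N) = mzero.
      by apply/ffunP => i; rewrite !ffunE.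
    have -> : msub mzero mzero = mzero :> mindex n.
      by apply/ffunP => i; rewrite !ffunE.
    rewrite !mpartial0 (_ : mbin _ _ = 1%N) ?mul1r // /mbin big1 // => i _.
    by rewrite !ffunE bin0.
  move=> b; apply: contraNeq => nz; apply/eqP/ffunP => i; rewrite ffunE.
  have : (0 < mbin mzero (mval b))%N.
    by rewrite lt0n; apply: contraNneq nz => ->; rewrite mul0r.
  rewrite mbin_gt0 => /forallP/(_ i); rewrite !ffunE leqn0 => /eqP bi.
  exact/val_inj.
rewrite -lt0n => m_gt0.
have [i mi] : exists i, (0 < m i)%N.
  apply/existsP; apply: contraTT m_gt0; rewrite negb_exists => /forallP H.
  by rewrite /mdeg big1 // => i _; have := H i; case: (m i).
pose m' := msub m (munit i).
have em : m = madd m' (munit i).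
  apply/ffunP => j; rewrite !ffunE; case: eqP => [->|]; last by rewrite subn0 addn0.
  by rewrite subnK.
have m'k : (mdeg m' < k)%N.
  by move: mk; rewrite em mdeg_add mdeg_unit addn1 ltnS.
have m'N j : (m' j <= N)%N by rewrite ffunE (leq_trans (leq_subr _ _)).
have m'iN : (m' i < N)%N by have := mN i; rewrite em !ffunE eqxx addn1.
rewrite em (@mpartialS V) //; last exact: smoothM.
rewrite (eq_partial i oV Vy (fun z Vz => IH m' m'k z Vz m'N)).
pose F (b : mindex n) := mpartial b f; pose G (b : mindex n) := mpartial b g.
have sF b : smooth V (F b) by apply: smooth_mpartial.
have sG b : smooth V (G b) by apply: smooth_mpartial.
rewrite /partial (@derive_val _ _ _ _ _ _ _ (is_derive_bigsum _ (dF := fun b =>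
  (mbin m' (mval b))%:R * (F (mval b) y * partial i (G (msub m' (mval b))) y +
     G (msub m' (mval b)) y * partial i (F (mval b)) y)) _)); last first.
  move=> b.
  have d1 := derivableP (smooth_derivable (i:=i) (sF (mval b)) Vy).
  have d2 := derivableP (smooth_derivable (i:=i) (sG (msub m' (mval b))) Vy).
  exact: (@is_deriveZ _ _ _ _ (mbin m' (mval b))%:R _ _ _ (is_deriveM d1 d2)).
under eq_bigr do rewrite mulrDr.
rewrite big_split /=.
under [RHS]eq_bigr do rewrite mbinS natrD mulrDl.
rewrite [RHS]big_split /=; congr (_ + _).
  apply: eq_bigr => b _; have [->|] := eqVneq (mbin m' (mval b)) 0%N.
    by rewrite !mul0r.
  rewrite -lt0n mbin_gt0 => /forallP bm; congr (_ * (_ * _)).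
  rewrite -(mpartialS _ _ oV sg Vy); congr (mpartial _ g y).
  by apply/ffunP => j; have := bm j; rewrite !ffunE => bj; rewrite addnBAC.
pose up (b : mbox n N) : mbox n N := [ffun j => inord (b j + (j == i))].
pose dn (b : mbox n N) : mbox n N := [ffun j => inord (b j - (j == i))].
rewrite [RHS](bigID (fun b : mbox n N => 0 < b i)%N) /= [X in _ = _ + X]big1 ?addr0; last first.
  by move=> b /negbTE bi; rewrite ffunE bi mul0r.
have upE (b : mbox n N) : (b i < N)%N -> mval (up b) = madd (mval b) (munit i).
  move=> bi; apply/ffunP => j; rewrite !ffunE inordK //.
  by case: eqP => [->|_]; rewrite ?addn1 ?addn0.
have dnE (b : mbox n N) j : dn b j = (b j - (j == i))%N :> nat.
  by rewrite ffunE inordK // ltnS (leq_trans (leq_subr _ _)) // -ltnS.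
rewrite [RHS](reindex_onto up dn) /=; last first.
  move=> b bi; apply/ffunP => j; apply/val_inj; rewrite ffunE dnE subnK.
    by rewrite inord_val.
  by case: eqP => // ->.
rewrite [LHS](bigID (fun b : mbox n N => b i < N)%N) /= [X in _ + X = _]big1 ?addr0; last first.
  move=> b bi; suff -> : mbin m' (mval b) = 0%N by rewrite mul0r.
  apply/eqP; rewrite -leqn0 leqNgt mbin_gt0; apply/forallP => /(_ i).
  by rewrite ffunE => /leq_ltn_trans /(_ m'iN); rewrite (negbTE bi).
apply: eq_big => [b|b bi].
  apply/idP/idP => [bi|/andP[]].
    have := congr1 (fun c : mindex n => c i) (upE b bi); rewrite !ffunE eqxx addn1.
    move=> ->; apply/eqP/ffunP => j; apply/val_inj; rewrite !ffunE /=.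
    rewrite (inordK (m := b j + _)) ?addnK ?inord_val //.
    by case: eqP => [->|_]; rewrite ?addn1 ?addn0.
  rewrite ffunE => ub0 /eqP dub.
  rewrite ltn_neqAle -ltnS ltn_ord andbT; apply/eqP => bN.
  have := congr1 (fun c : mbox n N => val (c i)) dub; rewrite !ffunE eqxx /= bN.
  move: ub0; rewrite eqxx bN addn1.
  rewrite /inord /insubd insubF ?ltnn //=.
rewrite (upE b bi) -[X in (X > 0)%N]/((madd (mval b) (munit i)) i).
have -> : ((madd (mval b) (munit i)) i > 0)%N by rewrite !ffunE eqxx addn1.
have -> : msub (madd (mval b) (munit i)) (munit i) = mval b.
  by apply/ffunP => j; rewrite !ffunE addnK.
have -> : msub (madd m' (munit i)) (madd (mval b) (munit i)) = msub m' (mval b).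
  by apply/ffunP => j; rewrite !ffunE subnDr.
by rewrite mulrC [G _ _ * _]mulrC -(mpartialS _ _ oV sf Vy) mulrC.
Qed.

Lemma partials_bigsum V (I : Type) (r : seq I) (F : I -> 'rV[R]_n -> R) s y :
  open V -> (forall b, smooth V (F b)) -> V y ->
  partials s (fun z => \sum_(b <- r) F b z) y = \sum_(b <- r) partials s (F b) y.
Proof.
move=> oV sF; elim: s y => [//|i s IH] y Vy /=.
rewrite (eq_partial i oV Vy IH) /partial.
apply: (@derive_val _ _ _ _ _ _ _ (is_derive_bigsum (F := fun b => partials s (F b)) _ _)) => b.
exact/derivableP/(smooth_derivable (i := i) (smooth_partials s (sF b)) Vy).
Qed.

Lemma mpartialB V f g (m : mindex n) y : open V -> smooth V f -> smooth V g ->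
  V y -> mpartial m (fun z => f z - g z) y = mpartial m f y - mpartial m g y.
Proof.
move=> oV sf sg; rewrite !mpartialE; move: (flatten _) => s.
elim: s y => [//|i s IH] y Vy /=.
rewrite (eq_partial i oV Vy IH) /partial.
rewrite -[fun z => _]/(partials s f - partials s g) deriveB //.
  exact: (smooth_derivable (smooth_partials s sf) Vy).
exact: (smooth_derivable (smooth_partials s sg) Vy).
Qed.

Lemma smoothB V f g : open V -> smooth V f -> smooth V g ->
  smooth V (fun z => f z - g z).
Proof.
move=> oV sf sg.
pose K : set ('rV[R]_n -> R) := [set h | exists f' g', [/\ smooth V f', smooth V g' &
  h = f' - g']].
apply: (@smooth_coind V K oV); last by exists f, g.
  move=> h y [f' [g' [s1 s2 ->]]] Vy; split => [|i].
    by apply: continuousB; apply: smooth_continuous Vy.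
  by apply: derivableB; apply: smooth_derivable Vy.
move=> h i [f' [g' [s1 s2 ->]]]; exists (partial i f' - partial i g').
  by exists (partial i f'), (partial i g'); split => //; exact: smooth_partial.
by move=> y Vy; rewrite /partial deriveB //; exact: smooth_derivable Vy.
Qed.

End CalculusFacts.

Section Jets.
Variables (R : realType) (n : nat).
Local Notation pt := 'rV[R]_n.

(* An element of J_q(T) at a point is stored as the full family (xi^k_m) with *)
(* zero entries for |m| > q, so that one type serves all orders.              *)
Definition jet : Type := 'I_n -> mindex n -> R.
Definition is_jet (q : nat) (xi : jet) : Prop :=
  forall k m, (q < mdeg m)%N -> xi k m = 0.
Definition jproj (q : nat) (xi : jet) : jet :=
  fun k m => if (mdeg m <= q)%N then xi k m else 0.
(* S_q T^* (x) T *)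
Definition is_symbol (q : nat) (xi : jet) : Prop :=
  forall k m, mdeg m != q -> xi k m = 0.
(* J^0_q(T) *)
Definition is_jet0 (q : nat) (xi : jet) : Prop :=
  is_jet q xi /\ forall k, xi k mzero = 0.

Definition vfield : Type := pt -> 'I_n -> R.
Definition jprol (q : nat) (v : vfield) : pt -> jet :=
  fun y k m => if (mdeg m <= q)%N then mpartial m (v^~ k) y else 0.
Definition lie_bracket (v w : vfield) : vfield := fun y k =>
  \sum_l (v y l * partial l (w^~ k) y - w y l * partial l (v^~ k) y).

(* Leibniz expansion of j_q([xi, eta]); terms with b not <= m have a zero     *)
(* binomial.  Lemma alg_bracketP below is the characteristic property.        *)
Definition alg_bracket (q : nat) (xi eta : jet) : jet := fun k m =>
  if (mdeg m <= q)%N then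
    \sum_(b : mbox n q) (mbin m (mval b))%:R *
      \sum_l (xi l (mval b) * eta k (madd (msub m (mval b)) (munit l))
            - eta l (mval b) * xi k (madd (msub m (mval b)) (munit l)))
  else 0.

(* (D eta_{q+1})_i for a section eta of J_{q+1}(T) *)
Definition spencer_jet (q : nat) (eta : pt -> jet) (i : 'I_n) : pt -> jet :=
  fun y k m => if (mdeg m <= q)%N then
    partial i (fun z => eta z k m) y - eta y k (madd m (munit i)) else 0.
Definition spencer_contract (q : nat) (xi eta : pt -> jet) : pt -> jet :=
  fun y => \sum_i xi y i mzero *: spencer_jet q eta i y.

(* [xi_q, eta_q] and L(xi_{q+1}) eta_q, computed from lifts of order q+1 *)
Definition diff_bracket (q : nat) (xi eta : pt -> jet) : pt -> jet := fun y =>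
  alg_bracket q (xi y) (eta y)
  + spencer_contract q xi eta y - spencer_contract q eta xi y.
Definition lie_jet (q : nat) (xi eta : pt -> jet) : pt -> jet := fun y =>
  alg_bracket q (xi y) (eta y) + spencer_contract q xi eta y.

(* Elements of wedge^r T^* (x) J(T) at a point, by their values on the        *)
(* coordinate vectors (d_(s 0), ..., d_(s (r-1))).                            *)
Definition jform (r : nat) : Type := ('I_r -> 'I_n) -> jet.
Definition alternating r (A : jform r) : Prop :=
  forall (s : 'I_r -> 'I_n) (a b : 'I_r), a != b ->
    A (s \o tperm a b) = - A s.
Definition jform_in r (E : set jet) : set (jform r) :=
  [set A | alternating A /\ forall s, E (A s)].
Definition fproj (q r : nat) (A : jform r) : jform r := fun s => jproj q (A s).

(* dx^i /\ _ evaluated on coordinate vectors *)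
Definition delta r (A : jform r) : jform r.+1 := fun s k m =>
  \sum_(a < r.+1) (-1) ^+ a * A (s \o lift a) k (madd m (munit (s a))).

(* D(alpha (x) xi) = d alpha (x) xi + (-1)^r alpha /\ D xi in components *)
Definition spencer (q r : nat) (A : pt -> jform r) : pt -> jform r.+1 :=
  fun y s => \sum_(a < r.+1)
    (-1) ^+ a *: spencer_jet q (fun z => A z (s \o lift a)) (s a) y.

(* Leibniz rule with L(xi_1) dx^l = xi^l_j dx^j.  Here A is a lift of order   *)
(* q+1 of the form being differentiated.                                      *)
Definition lie_form (q r : nat) (xi : pt -> jet) (A : pt -> jform r) :
    pt -> jform r := fun y s =>
  lie_jet q xi (fun z => A z s) y
  + \sum_(a < r) \sum_l xi y l (munit (s a)) *:
      jproj q (A y (fun b => if b == a then l else s b)).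

Definition jet_section (q : nat) (V : set pt) (xi : pt -> jet) : Prop :=
  (forall k m, smooth V (fun y => xi y k m)) /\
  (forall y, V y -> is_jet q (xi y)).
Definition jform_section (q r : nat) (V : set pt) (A : pt -> jform r) : Prop :=
  (forall s, jet_section q V (fun y => A y s)) /\
  (forall y, V y -> alternating (A y)).

End Jets.
Arguments jform_in {R n} r E.

Lemma alg_bracketP (R : realType) (n q : nat) (V : set 'rV[R]_n)
    (v w : vfield R n) (y : 'rV[R]_n) : open V -> V y ->
  (forall k, smooth V (v^~ k)) -> (forall k, smooth V (w^~ k)) ->
  alg_bracket q (jprol q.+1 v y) (jprol q.+1 w y) = jprol q (lie_bracket v w) y.
Proof.
move=> oV Vy sv sw; apply/funext => k; apply/funext => m.
rewrite /alg_bracket [RHS]/jprol; case: leqP => // mq.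
have sT (v' w' : vfield R n) l : (forall k, smooth V (v'^~ k)) ->
    (forall k, smooth V (w'^~ k)) -> smooth V (fun z => v' z l * partial l (w'^~ k) z).
  by move=> s1 s2; apply: smoothM => //; exact: smooth_partial.
rewrite [in RHS]mpartialE /lie_bracket (partials_bigsum _ _ oV _ Vy); last first.
  by move=> l; apply: smoothB => //; exact: sT.
under [RHS]eq_bigr => l _ do rewrite -mpartialE (mpartialB _ oV (sT _ _ l sv sw) (sT _ _ l sw sv) Vy).
have mN i : (m i <= q)%N := leq_trans (mdeg_ge m i) mq.
have L (v' w' : vfield R n) l : (forall k, smooth V (v'^~ k)) ->
    (forall k, smooth V (w'^~ k)) ->
    mpartial m (fun z => v' z l * partial l (w'^~ k) z) y =
    \sum_(b : mbox n q) (mbin m (mval b))%:R * (jprol q.+1 v' y l (mval b) *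
       jprol q.+1 w' y k (madd (msub m (mval b)) (munit l))).
  move=> s1 s2; rewrite (leibniz oV (s1 l) (smooth_partial l (s2 k)) Vy mN).
  apply: eq_bigr => b _; have [->|] := eqVneq (mbin m (mval b)) 0%N.
    by rewrite !mul0r.
  rewrite -lt0n mbin_gt0 => /forallP bm.
  have bq : (mdeg (mval b) <= q)%N.
    by apply: leq_trans mq; apply: leq_sum => i _; exact: bm.
  have mbq : (mdeg (msub m (mval b)) <= q)%N.
    by apply: leq_trans mq; apply: leq_sum => i _; rewrite ffunE leq_subr.
  rewrite (mpartial_partial _ _ oV (s2 k) Vy) /jprol.
  by rewrite (leqW bq) mdeg_add mdeg_unit addn1 ltnS mbq.
under [RHS]eq_bigr => l _ do rewrite !L // -sumrB.
rewrite exchange_big; apply: eq_bigr => b _; rewrite mulr_sumr.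
by apply: eq_bigr => l _; rewrite -mulrBr.
Qed.

Section LocalSystems.
Variables (R : realType) (n : nat).
Local Notation pt := 'rV[R]_n.
Local Notation jet := (jet R n).
Local Notation jform := (jform R n).
Implicit Types (W V : set pt) (E : pt -> set jet).

Definition vector_subbundle (q : nat) W E : Prop :=
  forall y, W y -> exists V (d : nat) (e : 'I_d -> pt -> jet),
    [/\ open V, V y, forall i, jet_section q V (e i) &
    forall z, V z ->
      (forall a : 'I_d -> R, \sum_i a i *: e i z = 0 -> forall i, a i = 0) /\
      E z = [set \sum_i a i *: e i z | a in [set: 'I_d -> R]]].

(* R_{q+r} = J_r(R_q) /\ J_{q+r}(T) *)
Definition prolongation (q r : nat) E : pt -> set jet := fun y =>
  [set xi | is_jet (q + r) xi /\ exists V (eta : pt -> jet),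
    [/\ open V, V y, jet_section q V eta, forall z, V z -> E z (eta z) &
    forall k m m', (mdeg m <= q)%N -> (mdeg m' <= r)%N ->
      mpartial m' (fun z => eta z k m) y = xi k (madd m m')]].
Definition symbol (q r : nat) E : pt -> set jet := fun y =>
  [set xi | prolongation q r E y xi /\ is_symbol (q + r) xi].

Definition local_lie_equations (q : nat) W E : Prop :=
  forall V (xi eta : pt -> jet), open V -> V `<=` W ->
    jet_section q.+1 V xi -> jet_section q.+1 V eta ->
    (forall y, V y -> E y (jproj q (xi y)) /\ E y (jproj q (eta y))) ->
    forall y, V y -> E y (diff_bracket q xi eta y).

Definition local_transitive W E : Prop :=
  forall y, W y -> forall v : 'I_n -> R,
    exists2 xi, E y xi & forall k, xi k mzero = v k.

(* image of delta in degree s; wedge^{-1} = 0 *)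
Definition delta_image (s : nat) (G : set jet) : set (jform s) :=
  match s return set (jform s) with
  | 0 => [set w | w = 0]
  | s'.+1 => [set w | exists2 t, jform_in s' G t & w = delta t]
  end.
Arguments delta_image : clear implicits.
Definition delta_exact (q r s : nat) E (y : pt) : Prop :=
  forall w : jform s, jform_in s (symbol q r E y) w ->
    (delta w = 0 <-> delta_image s (symbol q r.+1 E y) w).

Definition local_involutive (q : nat) W E : Prop :=
  [/\ forall r, vector_subbundle (q + r) W (prolongation q r E),
      forall r y, W y -> forall xi, prolongation q r E y xi ->
        exists2 xi', prolongation q r.+1 E y xi' & jproj (q + r) xi' = xi &
      forall r s y, (s <= n)%N -> W y -> delta_exact q r s E y].

(* wedge^{r+1} T^* (x) E + delta(wedge^r T^* (x) S_{q+1} T^* (x) T), the      *)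
(* subspace by which F_{r+1} is a quotient                                    *)
Definition janet_den (q r : nat) (E : set jet) : set (jform r.+1) :=
  [set A | exists B S, [/\ jform_in r.+1 E B,
     jform_in r [set xi | is_symbol q.+1 xi] S & A = B + delta S]].
Arguments janet_den : clear implicits.

Definition coset r (N : set (jform r)) (A : jform r) : set (jform r) :=
  [set A' | N (A' - A)].

(* (eta, zeta) |-> {chi_{q+1}(eta), chi_{q+1}(zeta)}                          *)
(*                 - chi_q({chi_1(eta), chi_1(zeta)})                         *)
Definition half_bracket (q : nat) (chi : jform 1) : jform 2 := fun s =>
  let eta : 'I_1 -> 'I_n := fun=> s ord0 in
  let zeta : 'I_1 -> 'I_n := fun=> s ord_max in
  alg_bracket q (chi eta) (chi zeta)
  - \sum_l alg_bracket 0 (jproj 1 (chi eta)) (jproj 1 (chi zeta)) l mzero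
      *: jproj q (chi (fun=> l)).

End LocalSystems.
Arguments janet_den {R n} q r E.
Arguments delta_image {R n} s G.

Record manifold (R : realType) (n : nat) := Manifold {
  carrier :> topologicalType;
  manifold_hausdorff : hausdorff_space carrier;
  manifold_second_countable : @second_countable carrier;
  chart_index : Type;
  dom : chart_index -> set carrier;
  chart : chart_index -> carrier -> 'rV[R]_n;
  ichart : chart_index -> 'rV[R]_n -> carrier;
  dom_open : forall a, open (dom a);
  dom_cover : forall x, exists a, dom a x;
  chart_open : forall a, open (chart a @` dom a);
  chartK : forall a x, dom a x -> ichart a (chart a x) = x;
  chart_continuous : forall a x, dom a x -> {for x, continuous (chart a)};
  ichart_continuous : forall a y, (chart a @` dom a) y ->
    {for y, continuous (ichart a)};
  transition_smooth : forall a b i,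
    smooth (chart a @` (dom a `&` dom b))
      (fun y => chart b (ichart a y) 0 i)
}.

Section ChangeOfChart.
Variables (R : realType) (n : nat).
Local Notation pt := 'rV[R]_n.

Definition taylor (q : nat) (y : pt) (xi : jet R n) : vfield R n := fun z k =>
  \sum_(b : mbox n q | (mdeg (mval b) <= q)%N)
    xi k (mval b) * (\prod_i (z 0 i - y 0 i) ^+ b i) / (mfact (mval b))%:R.
(* t is the change of coordinates, u its inverse *)
Definition push (t u : pt -> pt) (v : vfield R n) : vfield R n := fun z k =>
  \sum_l partial l (fun y => t y 0 k) (u z) * v (u z) l.
(* the jet at t y of the image under t of any field with jet xi at y *)
Definition jet_trans (q : nat) (t u : pt -> pt) (y : pt) (xi : jet R n) :
    jet R n := jprol q (push t u (taylor q y xi)) (t y).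
Definition jform_trans (q r : nat) (t u : pt -> pt) (y : pt)
    (A : jform R n r) : jform R n r := fun s =>
  \sum_(p : {ffun 'I_r -> 'I_n})
    (\prod_a partial (s a) (fun z => u z 0 (p a)) (t y)) *:
      jet_trans q t u y (A p).

End ChangeOfChart.

Section OnManifold.
Variables (R : realType) (n : nat) (X : manifold R n).
Local Notation pt := 'rV[R]_n.
Local Notation jet := (jet R n).
Local Notation jform := (jform R n).
Local Notation I := (chart_index X).
Implicit Types (U : set X) (a b : I).

Definition transition a b : pt -> pt := fun y => chart b (ichart a y).
(* the part of U covered by the chart a, in coordinates *)
Definition chart_image a U : set pt := chart a @` (U `&` dom a).

(* Systems R_q, sections chi of T^* (x) J_q(T), and sections of quotient      *)
(* bundles (whose values are cosets), each given by its local expressions.    *)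
Definition system : Type := I -> pt -> set jet.
Definition form_family r : Type := I -> pt -> jform r.
Definition class_family r : Type := I -> pt -> set (jform r).

Definition is_system (q : nat) (S : system) : Prop :=
  (forall a, vector_subbundle q (chart_image a setT) (S a)) /\
  (forall a b x, dom a x -> dom b x -> forall xi, S a (chart a x) xi ->
     S b (chart b x)
       (jet_trans q (transition a b) (transition b a) (chart a x) xi)).

Definition infinitesimal_lie_equations (q : nat) (S : system) : Prop :=
  forall a, local_lie_equations q (chart_image a setT) (S a).
Definition transitive_system (S : system) : Prop :=
  forall a, local_transitive (chart_image a setT) (S a).
Definition involutive_system (q : nat) (S : system) : Prop :=
  forall a, local_involutive q (chart_image a setT) (S a).

(* A class corresponds to a class in another chart as soon as one of its      *)
(* representatives does.                                                      *)
Definition class_compatible (q r : nat) U (c : class_family r) : Prop :=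
  forall a b x, U x -> dom a x -> dom b x ->
    exists2 A, c a (chart a x) A & c b (chart b x)
      (jform_trans q (transition a b) (transition b a) (chart a x) A).

Definition over_id (chi : jform 1) : Prop :=
  forall s k, chi s k mzero = (k == s ord0)%:R.

Definition den_janet (q r : nat) (S : system) a y : set (jform r.+1) :=
  janet_den q r (S a y).
Arguments den_janet : clear implicits.
Definition den_affine (q : nat) (S : system) a y : set (jform 1) :=
  janet_den q 0 (S a y `&` [set xi | is_jet0 q xi]).
Arguments den_affine : clear implicits.

(* local sections of F_{r+1} over U *)
Definition janet_section (q r : nat) (S : system) U
    (C : class_family r.+1) : Prop :=
  class_compatible q U C /\
  forall a y, chart_image a U y -> exists V (A : pt -> jform r.+1),
    [/\ open V, V y, V `<=` chart_image a U, jform_section q V A &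
    forall z, V z -> C a z = coset (den_janet q r S a z) (A z)].

(* local sections of A(R^0_q) over U *)
Definition affine_section (q : nat) (S : system) U
    (c : class_family 1) : Prop :=
  class_compatible q U c /\
  forall a y, chart_image a U y -> exists V (chi : pt -> jform 1),
    [/\ open V, V y, V `<=` chart_image a U, jform_section q V chi &
    forall z, V z -> over_id (chi z) /\
                     c a z = coset (den_affine q S a z) (chi z)].

Definition connection (q : nat) (S : system) U (chi : form_family 1) : Prop :=
  (forall a b x, U x -> dom a x -> dom b x -> chi b (chart b x) =
     jform_trans q (transition a b) (transition b a) (chart a x)
       (chi a (chart a x))) /\
  (forall a, jform_section q (chart_image a U) (chi a)) /\
  (forall a y, chart_image a U y ->
     over_id (chi a y) /\ jform_in 1 (S a y) (chi a y)).

Definition affine_class (q : nat) (S : system) (chi : form_family 1) :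
    class_family 1 := fun a y => coset (den_affine q S a y) (chi a y).

(* A is a section of order q+1 over V lifting a representative of C *)
Definition lifts_class (q r : nat) (C : class_family r) a (V : set pt)
    (A : pt -> jform r) : Prop :=
  jform_section q.+1 V A /\ forall y, V y -> C a y (fproj q (A y)).

(* L(xi_q) C = 0 in F_{r+1} for all local sections xi_q of R_q inside U, the  *)
(* section xi being a lift of xi_q in R_{q+1}                                 *)
Definition janet_invariant (q r : nat) (S : system) U
    (C : class_family r.+1) : Prop :=
  forall a V (xi : pt -> jet) (A : pt -> jform r.+1),
    open V -> V `<=` chart_image a U -> jet_section q.+1 V xi ->
    (forall y, V y -> prolongation q 1 (S a) y (xi y)) ->
    lifts_class q C a V A ->
    forall y, V y -> den_janet q r S a y (lie_form q xi A y).

(* Same for a section of A(R^0_q), with any lift xi of xi_q in J_{q+1}(T) *)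
Definition affine_invariant (q : nat) (S : system) U
    (c : class_family 1) : Prop :=
  forall a V (xi : pt -> jet) (chi : pt -> jform 1),
    open V -> V `<=` chart_image a U -> jet_section q.+1 V xi ->
    (forall y, V y -> S a y (jproj q (xi y))) ->
    lifts_class q c a V chi ->
    forall y, V y -> den_janet q 0 S a y (lie_form q xi chi y).

(* 1/2 {c, c} = 0 in F_2 *)
Definition half_bracket_zero (q : nat) (S : system) U
    (c : class_family 1) : Prop :=
  forall a y, chart_image a U y ->
  forall chi : jform 1, (forall s, is_jet q.+1 (chi s)) ->
    c a y (fproj q chi) -> den_janet q 1 S a y (half_bracket q chi).

Definition Cart (q : nat) (S : system) U : set (class_family 1) :=
  [set c | [/\ affine_section q S U c, affine_invariant q S U c &
               half_bracket_zero q S U c]].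

(* {c, C} = 0 in F_2.  The class c + t C is represented by chi_q + t A_q with *)
(* A_q a representative of C in T^* (x) J^0_q(T).                             *)
Definition linear_bracket_zero (q : nat) (S : system) U
    (c C : class_family 1) : Prop :=
  forall a y, chart_image a U y ->
  forall chi A : jform 1,
    (forall s, is_jet q.+1 (chi s)) -> (forall s, is_jet0 q.+1 (A s)) ->
    c a y (fproj q chi) -> C a y (fproj q A) ->
    den_janet q 1 S a y
      (fun s k m => 'D_1 (fun t : R => half_bracket q (chi + t *: A) s k m) 0).

Definition infinitesimal_deformations (q : nat) (S : system) U
    (c : class_family 1) : set (class_family 1) :=
  [set C | [/\ janet_section q S U C, janet_invariant q S U C &
               linear_bracket_zero q S U c C]].

Definition Upsilon (q r : nat) (S : system) U : set (class_family r.+1) :=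
  [set C | janet_section q S U C /\ janet_invariant q S U C].

(* D_{r+2} C = 0, where D_{r+2} : F_{r+1} -> F_{r+2} *)
Definition janet_operator_zero (q r : nat) (S : system) U
    (C : class_family r.+1) : Prop :=
  forall a V (A : pt -> jform r.+1), open V -> V `<=` chart_image a U ->
    lifts_class q C a V A ->
    forall y, V y -> den_janet q r.+1 S a y (spencer q A y).

Arguments Upsilon : clear implicits.
Definition cocycles (q r : nat) (S : system) U : set (class_family r.+1) :=
  [set C | Upsilon q r S U C /\ janet_operator_zero q S U C].

End OnManifold.
Arguments Upsilon {R n X} q r S U.
Arguments cocycles {R n X} q r S U.

(* Main.v *)
Require Import Defs.
From mathcomp Require Import all_boot all_order all_fingroup all_algebra.
From mathcomp Require Import all_classical all_reals all_analysis.
From mathcomp Require Import ring.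
Set Implicit Arguments.
Unset Strict Implicit.
Unset Printing Implicit Defensive.
Import Order.TTheory GRing.Theory Num.Theory.
Import numFieldNormedType.Exports.
Local Open Scope classical_set_scope.
Local Open Scope ring_scope.
(* In an R_q-connection every value chi(d_i) lies in R_q, so it lifts to an   *)
(* element K_i of R_{q+1}. Antisymmetrizing L(K_i) A(d_j) in i and j gives    *)
(* {c, C} + D A up to R_q-valued terms when A represents C; if C is invariant *)
(* each L(K_i) A vanishes in F_1, hence {c, C} = - D_2 C in F_2, and the two  *)
(* linearized conditions coincide with those defining the cocycles. That      *)
(* brackets and D of sections of R_{q+1} stay in R_q, and that the result     *)
(* does not depend on representatives, reduce to two facts: the formal        *)
(* derivatives are derivations of the algebraic bracket, and a section of     *)
(* R_q, or of T^* (x) R_q + delta (S_{q+1} T^* (x) T), which vanishes at a    *)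
(* point has its derivatives there in the fibre. The second subbundle has     *)
(* constant rank because g_{q+1} does.                                        *)

(** Invariance of C is the same condition on both sides, so the matter is to compare {c, C} = 0 with
    D_2 C = 0. Let K_i in R_{q+1} lie over d_i and let A_j represent C(d_j). Then (L(K_i) A)_j =
    {K_i, A_j} + (D A_j)_i + sum_l K^l_{i,j} A_l. Exchanging i and j and subtracting, the outer
    terms give {c, C}(d_i, d_j) up to the torsion of A contracted with the K_l, which is R_q-valued,
    and the middle terms give D A. This is [linear_bracket_spencer]. [linear_bracket_zero_operator]
    and [operator_zero_linear_bracket] pass between the two kinds of representatives: jets at one
    point for the bracket, local sections for the operator.

    The containments used are D R_{q+1} in T^* (x) R_q ([spencer_prolongation]) and {R_{q+1},
    R_{q+1}} in R_q ([prolongation_bracket]), both consequences of [subbundle_partial]; its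
    counterpart for the denominator of F_1 is [janet_den_partial]. Changing a representative by
    delta S is governed by [alg_bracket_formal_deriv], from which [half_bracket_den] and
    [linear_bracket_den] follow.

    For c itself, a representative is, up to delta S, a lift of R_q-valued jets to R_{q+1}
    ([affine_class_rep]). The half bracket of such a lift is R_q-valued. For invariance,
    [lie_family_connection] splits a local lift of c into a section of R_{q+1}, a constant delta S
    and a remainder whose q-jet part vanishes at the point; the Lie derivative of each piece lies in
    the denominator. *)

Local Notation mzero := Defs.mzero.

(** * Limits of linear spans *)

Section LinearLimits.
Variable R : realType.

Lemma cvg_big_add (T : Type) (F : set_system T) {FF : Filter F} (I : Type)
    (r : seq I) (f : I -> T -> R) (l : I -> R) :
  (forall i, f i @ F --> l i) ->
  (fun t => \sum_(i <- r) f i t) @ F --> \sum_(i <- r) l i.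
Proof.
move=> fl; elim: r => [|i r IH].
  by rewrite big_nil; under eq_fun do rewrite big_nil; exact: cvg_cst.
by rewrite big_cons; under eq_fun do rewrite big_cons; apply: cvgD.
Qed.

Lemma cvg_big_mul (T : Type) (F : set_system T) {FF : Filter F} (I : Type)
    (r : seq I) (f : I -> T -> R) (l : I -> R) :
  (forall i, f i @ F --> l i) ->
  (fun t => \prod_(i <- r) f i t) @ F --> \prod_(i <- r) l i.
Proof.
move=> fl; elim: r => [|i r IH].
  by rewrite big_nil; under eq_fun do rewrite big_nil; exact: cvg_cst.
by rewrite big_cons; under eq_fun do rewrite big_cons; apply: cvgM.
Qed.

(** Multiply by a right inverse N of the limit matrix: the determinant of [M t *m N] tends to 1,
    hence is eventually nonzero. *)
Lemma near_row_free (T : Type) (F : set_system T) {FF : Filter F} m p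
    (M : T -> 'M[R]_(m, p)) (M0 : 'M[R]_(m, p)) :
  (forall i j, (fun t => M t i j) @ F --> M0 i j) -> row_free M0 ->
  \forall t \near F, row_free (M t).
Proof.
move=> cM /row_freeP[N MN1].
have cdet : (fun t => \det (M t *m N)) @ F --> (1 : R).
  rewrite -(det1 R m) -MN1; apply: cvg_big_add => s; apply: cvgM.
    exact: cvg_cst.
  apply: cvg_big_mul => i.
  rewrite mxE; under eq_fun do rewrite mxE.
  by apply: cvg_big_add => j; apply: cvgM; [exact: cM|exact: cvg_cst].
have : \forall t \near F, \det (M t *m N) != 0.
  exact: (cvgr_neq0 _ cdet (oner_neq0 R)).
apply: filterS => t dt.
have u : M t *m N \in unitmx by rewrite unitmxE unitfE.
by apply/row_freeP; exists (N *m invmx (M t *m N)); rewrite mulmxA mulmxV.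
Qed.


(** If x0 were outside the span of the independent f0, the matrix with rows f0 and x0 would have
    full row rank; by [near_row_free] so would the matrices at nearby t, although there x is a
    combination of the f. *)
Lemma span_limit (T : Type) (F : set_system T) {FF : ProperFilter F}
    (I J : finType) (f : T -> I -> J -> R) (f0 : I -> J -> R)
    (x : T -> J -> R) (x0 : J -> R) :
  (forall i j, (fun t => f t i j) @ F --> f0 i j) ->
  (forall j, (fun t => x t j) @ F --> x0 j) ->
  (forall a : I -> R, (forall j, \sum_i a i * f0 i j = 0) -> forall i, a i = 0) ->
  (\forall t \near F, exists a : I -> R, forall j, x t j = \sum_i a i * f t i j) ->
  exists a : I -> R, forall j, x0 j = \sum_i a i * f0 i j.
Proof.
move=> cf cx indep0 xspan.
pose mx (g : I -> J -> R) (w : J -> R) : 'M[R]_(#|I| + 1, #|J|) :=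
  col_mx (\matrix_(i, j) g (enum_val i) (enum_val j)) (\row_j w (enum_val j)).
have mulE (u : 'rV[R]_(#|I| + 1)) g w j : (u *m mx g w) 0 (enum_rank j) =
    \sum_i u 0 (lshift 1 (enum_rank i)) * g i j + u 0 (rshift #|I| ord0) * w j.
  rewrite mxE big_split_ord /= big_ord1; congr (_ + _); last first.
    by rewrite col_mxEd mxE enum_rankK.
  rewrite (reindex_onto enum_rank enum_val) => [|i _]; last exact: enum_valK.
  apply: eq_big => [i|i _]; first by rewrite enum_rankK eqxx.
  by rewrite col_mxEu mxE !enum_rankK.
apply: contrapT => nospan.
have free0 : row_free (mx f0 x0).
  apply: inj_row_free => u u0.
  have E j : \sum_i u 0 (lshift 1 (enum_rank i)) * f0 i j
     + u 0 (rshift #|I| ord0) * x0 j = 0 by rewrite -mulE u0 mxE.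
  have [b0|b0] := eqVneq (u 0 (rshift #|I| ord0)) 0.
    have a0 : forall i, u 0 (lshift 1 (enum_rank i)) = 0.
      by apply: indep0 => j; rewrite -[RHS](E j) b0 mul0r addr0.
    apply/rowP => i; rewrite mxE -(splitK i); case: (fintype.split i) => k /=.
      by rewrite -[k]enum_valK a0.
    by rewrite ord1.
  case: nospan; exists (fun i => - (u 0 (lshift 1 (enum_rank i)) /
    u 0 (rshift #|I| ord0))) => j.
  have /eqP := E j; rewrite addrC addr_eq0 => /eqP Ej.
  apply: (mulfI b0); rewrite Ej mulr_sumr -sumrN; apply: eq_bigr => i _.
  by rewrite mulNr mulrN mulrA mulrCA divff // mulr1.
have : \forall t \near F, False; last by move/filter_ex => [].
have nf : \forall t \near F, row_free (mx (f t) (x t)).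
  apply: near_row_free free0 => i j; rewrite -(splitK i).
  case: (fintype.split i) => k /=.
    by rewrite col_mxEu mxE; under eq_fun do rewrite col_mxEu mxE; exact: cf.
  by rewrite col_mxEd mxE; under eq_fun do rewrite col_mxEd mxE; exact: cx.
near=> t.
have rf : row_free (mx (f t) (x t)) by near: t.
have [a xa] : exists a : I -> R, forall j, x t j = \sum_i a i * f t i j by near: t.
pose u : 'rV[R]_(#|I| + 1) := row_mx (\row_i a (enum_val i)) (- 1).
have uR : u 0 (rshift #|I| ord0) = - 1 by rewrite /u row_mxEr !mxE.
have uL i : u 0 (lshift 1 (enum_rank i)) = a i.
  by rewrite /u row_mxEl mxE enum_rankK.
clearbody u.
have u0 : u *m mx (f t) (x t) = 0.
  apply/rowP => j; rewrite -[j]enum_valK mulE uR mulN1r xa [RHS]mxE.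
  by apply/eqP; rewrite subr_eq0; apply/eqP/eq_bigr => i _; rewrite uL.
have /row_free_inj/(_ u 0) := rf; rewrite u0 mul0mx => /(_ erefl).
move=> e; move: uR; rewrite e mxE => /eqP.
by rewrite eq_sym oppr_eq0 oner_eq0.
Unshelve. all: by end_near. Qed.

End LinearLimits.

(** * Closure properties and partial derivatives of smooth functions *)

Section SmoothFunctions.
Variables (R : realType) (n : nat).
Implicit Types (f g : 'rV[R]_n -> R) (V : set 'rV[R]_n).

Lemma smooth_cst V (c : R) : open V -> smooth V (fun=> c).
Proof.
move=> oV; pose K : set ('rV[R]_n -> R) := [set h | exists c : R, h = cst c].
apply: (@smooth_coind _ _ V K oV); last by exists c.
  by move=> h y [d ->] Vy; split => [|i]; [exact: cst_continuous|exact: derivable_cst].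
move=> h i [d ->]; exists (cst 0); first by exists 0.
by move=> y Vy; rewrite /partial derive_cst.
Qed.

Lemma smoothN V f : open V -> smooth V f -> smooth V (fun z => - f z).
Proof.
move=> oV sf; have := smoothB oV (smooth_cst 0 oV) sf.
by under eq_fun do rewrite sub0r.
Qed.

Lemma smoothD V f g : open V -> smooth V f -> smooth V g ->
  smooth V (fun z => f z + g z).
Proof.
move=> oV sf sg; have := smoothB oV sf (smoothN oV sg).
by under eq_fun do rewrite opprK.
Qed.

Lemma smoothZ V (c : R) f : open V -> smooth V f -> smooth V (fun z => c * f z).
Proof. by move=> oV; apply: smoothM => //; exact: smooth_cst. Qed.

Lemma smooth_sum V (I : Type) (r : seq I) (F : I -> 'rV[R]_n -> R) : open V ->
  (forall i, smooth V (F i)) -> smooth V (fun z => \sum_(i <- r) F i z).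
Proof.
move=> oV sF; elim: r => [|i r IH].
  by under eq_fun do rewrite big_nil; exact: smooth_cst.
by under eq_fun do rewrite big_cons; exact: smoothD.
Qed.

Lemma is_derive_coord (i : 'I_n) (c : R) (y v : 'rV[R]_n) :
  is_derive y v (fun z : 'rV[R]_n => z 0 i - c) (v 0 i).
Proof.
have E : (fun h : R => h^-1 *: (((fun z : 'rV[R]_n => z 0 i - c) \o shift y) (h *: v)
     - (y 0 i - c))) @ 0^' --> v 0 i.
  apply: cvg_near_cst; near=> h.
  have h0 : h != 0 by near: h; exact: nbhs_dnbhs_neq.
  rewrite /= !mxE opprB addrA subrK [_ + y 0 i]addrC addrAC subrr add0r.
  by rewrite /GRing.scale/= mulrA mulVf // mul1r.
apply: DeriveDef; first by apply/cvg_ex; exists (v 0 i).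
exact: cvg_lim E.
Unshelve. all: by end_near. Qed.

Lemma smooth_coord V (i : 'I_n) (c : R) : open V ->
  smooth V (fun z => z 0 i - c).
Proof.
move=> oV; pose K : set ('rV[R]_n -> R) := [set h | (exists c : R, h = cst c) \/
  h = fun z : 'rV[R]_n => z 0 i - c].
apply: (@smooth_coind _ _ V K oV); last by right.
  move=> h y [[d ->]|->] Vy.
    by split => [|j]; [exact: cst_continuous|exact: derivable_cst].
  split => [|j]; last by case: (is_derive_coord i c y 'e_j).
  by apply: continuousB; [exact: coord_continuous|exact: cst_continuous].
move=> h j [[d ->]|->].
  by exists (cst 0); [left; exists 0|move=> y Vy; rewrite /partial derive_cst].
exists (cst (('e_j : 'rV[R]_n) 0 i)); first by left; exists (('e_j : 'rV[R]_n) 0 i).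
by move=> y Vy; rewrite /partial (@derive_val _ _ _ _ _ _ _ (is_derive_coord i c y 'e_j)).
Qed.

Lemma partialD V f g i y : smooth V f -> smooth V g -> V y ->
  partial i (fun z => f z + g z) y = partial i f y + partial i g y.
Proof.
move=> sf sg Vy; rewrite /partial -[fun z => _]/(f + g) deriveD //.
  exact: smooth_derivable sf Vy.
exact: smooth_derivable sg Vy.
Qed.

Lemma partialB V f g i y : smooth V f -> smooth V g -> V y ->
  partial i (fun z => f z - g z) y = partial i f y - partial i g y.
Proof.
move=> sf sg Vy; rewrite /partial -[fun z => _]/(f - g) deriveB //.
  exact: smooth_derivable sf Vy.
exact: smooth_derivable sg Vy.
Qed.

Lemma partial_cst (c : R) i (y : 'rV[R]_n) : partial i (fun=> c) y = 0.
Proof. by rewrite /partial derive_cst. Qed.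

Lemma partialM V f g i y : smooth V f -> smooth V g -> V y ->
  partial i (fun z => f z * g z) y = f y * partial i g y + g y * partial i f y.
Proof.
move=> sf sg Vy.
have d1 := derivableP (smooth_derivable (i := i) sf Vy).
have d2 := derivableP (smooth_derivable (i := i) sg Vy).
by rewrite /partial (@derive_val _ _ _ _ _ _ _ (is_deriveM d1 d2)).
Qed.

Lemma partialZ V (c : R) f i y : smooth V f -> V y ->
  partial i (fun z => c * f z) y = c * partial i f y.
Proof.
move=> sf Vy; have d1 := derivableP (smooth_derivable (i := i) sf Vy).
by rewrite /partial (@derive_val _ _ _ _ _ _ _ (is_deriveZ c d1)).
Qed.

Lemma partial_sum V (I : Type) (r : seq I) (F : I -> 'rV[R]_n -> R) i y :
  (forall b, smooth V (F b)) -> V y ->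
  partial i (fun z => \sum_(b <- r) F b z) y = \sum_(b <- r) partial i (F b) y.
Proof.
move=> sF Vy; apply: (@derive_val _ _ _ _ _ _ _ (is_derive_bigsum _ _)) => b.
exact/derivableP/(smooth_derivable (i := i) (sF b) Vy).
Qed.

Lemma smoothS V V' f : V' `<=` V -> smooth V f -> smooth V' f.
Proof. by move=> sub sf s y /sub; exact: sf. Qed.

End SmoothFunctions.

(** * Leibniz sums over multi-indices *)

Section BinomialConvolution.
Variables (R : pzRingType) (n : nat).
Implicit Types (m a : mindex n) (F : mindex n -> mindex n -> R).

Lemma madd0 m : madd m mzero = m.
Proof. by apply/ffunP => i; rewrite !ffunE addn0. Qed.

Lemma add0m m : madd mzero m = m.
Proof. by apply/ffunP => i; rewrite !ffunE add0n. Qed.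

Lemma maddAC m a (b : mindex n) : madd (madd m a) b = madd (madd m b) a.
Proof. by apply/ffunP => i; rewrite !ffunE addnAC. Qed.

Lemma msub0 m : msub m mzero = m.
Proof. by apply/ffunP => i; rewrite !ffunE subn0. Qed.

Lemma mbin0 m : mbin m mzero = 1%N.
Proof. by rewrite /mbin big1 // => i _; rewrite ffunE bin0. Qed.

Lemma mdeg_mzero : mdeg (mzero : mindex n) = 0%N.
Proof. by rewrite /mdeg big1 // => i _; rewrite ffunE. Qed.

Lemma mdeg_maddU m i : mdeg (madd m (munit i)) = (mdeg m).+1.
Proof. by rewrite mdeg_add mdeg_unit addn1. Qed.

Lemma mdeg_le m a : (0 < mbin m a)%N -> (mdeg a <= mdeg m)%N.
Proof. by rewrite mbin_gt0 => /forallP am; apply: leq_sum => i _; exact: am. Qed.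

Lemma mdeg_msub m a : (0 < mbin m a)%N -> mdeg (msub m a) = (mdeg m - mdeg a)%N.
Proof.
rewrite mbin_gt0 => /forallP am; apply/eqP.
rewrite -(eqn_add2r (mdeg a)) subnK; last by apply: leq_sum => i _; exact: am.
by rewrite -mdeg_add; apply/eqP; congr mdeg; apply/ffunP => i; rewrite !ffunE subnK.
Qed.

(** The sum in the Leibniz formula. F receives b and m - b separately, so that a derivative can fall
    on either factor; terms with b not below m have binomial zero, and N only bounds the range of
    b. *)
Definition binomial_conv N m F : R :=
  \sum_(b : mbox n N) (mbin m (mval b))%:R * F (mval b) (msub m (mval b)).

Lemma eq_binomial_conv N m F F' :
  (forall a, (0 < mbin m a)%N -> F a (msub m a) = F' a (msub m a)) ->
  binomial_conv N m F = binomial_conv N m F'.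
Proof.
move=> FF'; apply: eq_bigr => b _.
have [->|] := eqVneq (mbin m (mval b)) 0%N; first by rewrite !mul0r.
by rewrite -lt0n => /FF' ->.
Qed.

Lemma binomial_convD N m F F' : binomial_conv N m (fun a b => F a b + F' a b) =
  binomial_conv N m F + binomial_conv N m F'.
Proof. by rewrite /binomial_conv -big_split; apply: eq_bigr => b _; rewrite mulrDr. Qed.

Lemma binomial_conv0 N m F :
  (forall a, (0 < mbin m a)%N -> a != mzero -> F a (msub m a) = 0) ->
  binomial_conv N m F = F mzero m.
Proof.
move=> F0; rewrite /binomial_conv (bigD1 [ffun=> ord0]) //=.
have -> : mval ([ffun=> ord0] : mbox n N) = mzero.
  by apply/ffunP => i; rewrite !ffunE.
rewrite mbin0 mul1r msub0 big1 ?addr0 // => b b0.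
have [->|] := eqVneq (mbin m (mval b)) 0%N; first by rewrite mul0r.
rewrite -lt0n => /F0 ->; rewrite ?mulr0 //; apply: contraNneq b0 => b0.
apply/eqP/ffunP => i; apply/val_inj; rewrite ffunE /=.
by move/ffunP/(_ i): b0; rewrite !ffunE.
Qed.

Lemma binomial_conv_widen N N' m F : (forall i, m i <= N)%N ->
  (forall i, m i <= N')%N -> binomial_conv N m F = binomial_conv N' m F.
Proof.
wlog NN' : N N' / (N <= N')%N.
  move=> H mN mN'; case/orP: (leq_total N N') => /H; first exact.
  by move=> /(_ mN' mN) ->.
move=> mN mN'.
pose up (b : mbox n N) : mbox n N' := [ffun j => inord (b j)].
pose dn (b : mbox n N') : mbox n N := [ffun j => inord (b j)].
have upE (b : mbox n N) : mval (up b) = mval b.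
  apply/ffunP => j; rewrite !ffunE inordK //.
  by apply: leq_trans (ltn_ord (b j)) _; rewrite ltnS.
have dn_up (b : mbox n N) : dn (up b) = b.
  apply/ffunP => j; apply/val_inj; move/ffunP/(_ j): (upE b); rewrite !ffunE.
  by move=> ->; rewrite inord_val.
rewrite /binomial_conv [RHS](bigID (fun b => up (dn b) == b)) /= [X in _ + X]big1; last first.
  move=> b udb; suff -> : mbin m (mval b) = 0%N by rewrite mul0r.
  apply/eqP; rewrite -leqn0 leqNgt mbin_gt0; apply/forallP => bm.
  move/negP: udb; apply; apply/eqP/ffunP => j; apply/val_inj.
  have bN : (b j < N.+1)%N.
    by rewrite ltnS (leq_trans _ (mN j)) //; have := bm j; rewrite ffunE.
  by rewrite !ffunE (inordK bN) inord_val.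
rewrite addr0 [RHS](reindex_onto up dn) => [|b /eqP //].
by apply: eq_big => [b|b _]; rewrite ?dn_up ?eqxx // upE.
Qed.

(** Pascal's rule [mbinS]: the additional unit goes either to m - b or to b, as a derivation
    distributes over a product. *)
Lemma binomial_convS N m i F : (forall j, madd m (munit i) j <= N)%N ->
  binomial_conv N (madd m (munit i)) F =
  binomial_conv N m (fun a b => F a (madd b (munit i))) +
  binomial_conv N m (fun a => F (madd a (munit i))).
Proof.
move=> mN; have miN : (m i < N)%N by have := mN i; rewrite !ffunE eqxx addn1.
rewrite /binomial_conv; under eq_bigr do rewrite mbinS natrD mulrDl.
rewrite big_split /=; congr (_ + _).
  apply: eq_bigr => b _; have [->|] := eqVneq (mbin m (mval b)) 0%N.
    by rewrite !mul0r.
  rewrite -lt0n mbin_gt0 => /forallP bm; congr (_ * F _ _).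
  by apply/ffunP => j; have := bm j; rewrite !ffunE => bj; rewrite addnBAC.
(* In the second sum of Pascal's rule only b with b i > 0 count; they are written as a + 1_i, and
   [up], [dn] carry out this substitution inside the box. *)
pose up (b : mbox n N) : mbox n N := [ffun j => inord (b j + (j == i))].
pose dn (b : mbox n N) : mbox n N := [ffun j => inord (b j - (j == i))].
rewrite [LHS](bigID (fun b : mbox n N => 0 < b i)%N) /= [X in _ + X]big1 ?addr0; last first.
  by move=> b /negbTE bi; rewrite ffunE bi mul0r.
have upE (b : mbox n N) : (b i < N)%N -> mval (up b) = madd (mval b) (munit i).
  move=> bi; apply/ffunP => j; rewrite !ffunE inordK //.
  by case: eqP => [->|_]; rewrite ?addn1 ?addn0.
have dnE (b : mbox n N) j : dn b j = (b j - (j == i))%N :> nat.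
  by rewrite ffunE inordK // ltnS (leq_trans (leq_subr _ _)) // -ltnS.
rewrite [LHS](reindex_onto up dn) /=; last first.
  move=> b bi; apply/ffunP => j; apply/val_inj; rewrite ffunE dnE subnK.
    by rewrite inord_val.
  by case: eqP => // ->.
rewrite [RHS](bigID (fun b : mbox n N => b i < N)%N) /= [X in _ = _ + X]big1 ?addr0; last first.
  move=> b bi; suff -> : mbin m (mval b) = 0%N by rewrite mul0r.
  apply/eqP; rewrite -leqn0 leqNgt mbin_gt0; apply/forallP => /(_ i).
  by rewrite ffunE => /leq_ltn_trans /(_ miN); rewrite (negbTE bi).
symmetry; apply: eq_big => [b|b bi].
  apply/idP/idP => [bi|/andP[]].
    have := congr1 (fun c : mindex n => c i) (upE b bi); rewrite !ffunE eqxx addn1.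
    move=> ->; apply/eqP/ffunP => j; apply/val_inj; rewrite !ffunE /=.
    rewrite (inordK (m := b j + _)) ?addnK ?inord_val //.
    by case: eqP => [->|_]; rewrite ?addn1 ?addn0.
  rewrite ffunE => ub0 /eqP dub.
  (* If b i = N, then N + 1 is out of range and [inord] falls back to 0, contradicting 0 < up b
     i. *)
  rewrite ltn_neqAle -ltnS ltn_ord andbT; apply/eqP => bN.
  have := congr1 (fun c : mbox n N => val (c i)) dub; rewrite !ffunE eqxx /= bN.
  move: ub0; rewrite eqxx bN addn1.
  by rewrite /inord /insubd insubF ?ltnn.
rewrite (upE b bi) -[X in (X > 0)%N]/((madd (mval b) (munit i)) i).
have -> : ((madd (mval b) (munit i)) i > 0)%N by rewrite !ffunE eqxx addn1.
have -> : msub (madd (mval b) (munit i)) (munit i) = mval b.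
  by apply/ffunP => j; rewrite !ffunE addnK.
congr (_ * F _ _).
by apply/ffunP => j; rewrite !ffunE subnDr.
Qed.

End BinomialConvolution.

(** * The algebraic bracket and its behaviour on symbols *)

Section BracketAlgebra.
Variables (R : realType) (n : nat).
Local Notation jet := (jet R n).
Implicit Types (x y z s : jet) (c : R) (q : nat) (k : 'I_n) (m : mindex n).

(** On the jet of a vector field this gives the jet, one order lower, of the field differentiated
    along d_i. For a symbol S, the family of all [formal_deriv i S] is delta S. *)
Definition formal_deriv (i : 'I_n) x : jet := fun k m => x k (madd m (munit i)).

Lemma jet_sumE (I : Type) (r : seq I) (P : pred I) (F : I -> jet) k m :
  (\sum_(i <- r | P i) F i) k m = \sum_(i <- r | P i) F i k m.
Proof. by elim/big_ind2: _ => // x1 x2 y1 y2 <- <-. Qed.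

Lemma formal_derivC i j x : formal_deriv i (formal_deriv j x) =
  formal_deriv j (formal_deriv i x).
Proof. by apply/funext => k; apply/funext => m; rewrite /formal_deriv maddAC. Qed.

Lemma formal_deriv_symbol q i s : is_symbol q.+1 s -> is_symbol q (formal_deriv i s).
Proof. by move=> ss k m mq; rewrite /formal_deriv ss // mdeg_maddU eqSS. Qed.

Lemma symbol_jet q s : is_symbol q s -> is_jet q s.
Proof. by move=> ss k m mq; rewrite ss // neq_ltn mq orbT. Qed.

Lemma alg_bracketE q N x y k m : (mdeg m <= q)%N -> (forall i, m i <= N)%N ->
  alg_bracket q x y k m = binomial_conv N m (fun a b =>
    \sum_l (x l a * y k (madd b (munit l)) - y l a * x k (madd b (munit l)))).
Proof.
move=> mq mN; rewrite /alg_bracket mq; apply: binomial_conv_widen mN => i.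
exact: leq_trans (mdeg_ge m i) mq.
Qed.

Lemma alg_bracket_jet q x y : is_jet q (alg_bracket q x y).
Proof. by move=> k m mq; rewrite /alg_bracket leqNgt mq. Qed.

Lemma alg_bracketDl q x y z : alg_bracket q (x + y) z = alg_bracket q x z + alg_bracket q y z.
Proof.
apply/funext => k; apply/funext => m; rewrite /alg_bracket.
have -> (f g : jet) : (f + g) k m = f k m + g k m by [].
case: ifP => _; last by rewrite addr0.
rewrite -big_split; apply: eq_bigr => b _ /=; rewrite -mulrDr -big_split /=.
congr (_ * _); apply: eq_bigr => l _.
have D (f g : jet) k' m' : (f + g) k' m' = f k' m' + g k' m' by [].
by rewrite !D mulrDl mulrDr opprD addrACA.
Qed.

Lemma alg_bracketZl q c x y : alg_bracket q (c *: x) y = c *: alg_bracket q x y.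
Proof.
apply/funext => k; apply/funext => m; rewrite /alg_bracket.
have S (f : jet) k' m' : (c *: f) k' m' = c * f k' m' by [].
rewrite S; case: ifP => _; last by rewrite mulr0.
rewrite mulr_sumr; apply: eq_bigr => b _; rewrite mulrCA; congr (_ * _).
rewrite mulr_sumr; apply: eq_bigr => l _.
by rewrite !S; ring.
Qed.

Lemma alg_bracketC q x y : alg_bracket q x y = - alg_bracket q y x.
Proof.
apply/funext => k; apply/funext => m; rewrite /alg_bracket.
have -> (f : jet) : (- f) k m = - f k m by [].
case: ifP => _; last by rewrite oppr0.
rewrite -sumrN; apply: eq_bigr => b _; rewrite -mulrN -sumrN.
by congr (_ * _); apply: eq_bigr => l _; rewrite opprB.
Qed.

Lemma alg_bracketDr q x y z : alg_bracket q x (y + z) = alg_bracket q x y + alg_bracket q x z.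
Proof. by rewrite alg_bracketC alg_bracketDl opprD -!(alg_bracketC q x). Qed.

Lemma alg_bracketZr q c x y : alg_bracket q x (c *: y) = c *: alg_bracket q x y.
Proof. by rewrite alg_bracketC alg_bracketZl -scalerN -alg_bracketC. Qed.

(** In a bracket of order q, entries of s of degree q+1 occur only when all derivatives fall on s
    and |m| = q. What remains is the contraction of delta s with the vector underlying x. *)
Lemma alg_bracket_symbol q x s : is_symbol q.+1 s ->
  alg_bracket q x s = \sum_l x l mzero *: formal_deriv l s.
Proof.
move=> ss; apply/funext => k; apply/funext => m; rewrite jet_sumE.
have [mq|mq] := leqP (mdeg m) q; last first.
  rewrite alg_bracket_jet // big1 // => l _.
  rewrite -[LHS]/(x l mzero * s k (madd m (munit l))) ss ?mulr0 //.
  by rewrite mdeg_maddU eqSS gtn_eqF.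
rewrite (@alg_bracketE q q) // => [|i]; last exact: leq_trans (mdeg_ge m i) mq.
rewrite binomial_conv0 => [|a am a0].
  apply: eq_bigr => l _; rewrite [s l mzero]ss ?mul0r ?subr0 //.
  by rewrite mdeg_mzero.
rewrite big1 // => l _; rewrite [s l a]ss; last first.
  by rewrite ltn_eqF // ltnS (leq_trans (mdeg_le am)).
rewrite mul0r subr0 ss ?mulr0 // mdeg_maddU eqSS (mdeg_msub am) ltn_eqF //.
apply: leq_trans mq; rewrite ltn_subrL.
have a_gt0 : (0 < mdeg a)%N by rewrite lt0n; apply: contraNneq a0 => /mdeg0 ->.
by rewrite a_gt0 (leq_trans a_gt0) // mdeg_le.
Qed.

(** The formal derivative is a derivation of the bracket, by Pascal's rule in the form
    [binomial_convS]. *)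
Lemma alg_bracket_deriv q x y j k m : (mdeg m <= q)%N ->
  alg_bracket q.+1 x y k (madd m (munit j)) =
  alg_bracket q (formal_deriv j x) y k m + alg_bracket q x (formal_deriv j y) k m.
Proof.
move=> mq.
have mjN i : (madd m (munit j) i <= q.+1)%N.
  by apply: leq_trans (mdeg_ge _ i) _; rewrite mdeg_maddU ltnS.
have mN i : (m i <= q.+1)%N by apply: leq_trans (mdeg_ge m i) (leqW mq).
rewrite (@alg_bracketE _ q.+1) ?mdeg_maddU // binomial_convS //.
rewrite !(@alg_bracketE q q.+1) // -!binomial_convD.
apply: eq_binomial_conv => a _; rewrite -!big_split; apply: eq_bigr => l _ /=.
rewrite /formal_deriv !(maddAC _ (munit l)).
by ring.
Qed.

(** For s in S_{q+1} T^* (x) T this is the linear action of the first-order part of x: in degree q+1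
    the symbol meets only the components x^l_i. Lower degrees are cut off so that the result is
    again a symbol. *)
Definition top_bracket q x s : jet := fun k m =>
  if mdeg m == q.+1 then alg_bracket q.+1 x s k m else 0.

Lemma top_bracket_symbol q x s : is_symbol q.+1 (top_bracket q x s).
Proof. by move=> k m /negbTE mq; rewrite /top_bracket mq. Qed.

(* The bracket of x with the q-jet of d_j S: the formal derivative d_j is a   *)
(* derivation of the bracket, and only the leading part of {x, S} survives    *)
(* as an element of delta(S_{q+1} T^* (x) T).                                 *)
Lemma alg_bracket_formal_deriv q x s j : is_symbol q.+1 s ->
  alg_bracket q x (formal_deriv j s) = formal_deriv j (top_bracket q x s)
    + \sum_i x i mzero *: formal_deriv i (formal_deriv j s)
    - \sum_l x l (munit j) *: formal_deriv l s.
Proof.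
move=> ss; apply/funext => k; apply/funext => m.
have -> (f g h : jet) : (f + g - h) k m = f k m + g k m - h k m by [].
have -> : (\sum_l x l (munit j) *: formal_deriv l s) k m =
    alg_bracket q (formal_deriv j x) s k m.
  rewrite alg_bracket_symbol //; congr ((\sum_(l <- _) _) k m).
  by apply/funext => l; rewrite /formal_deriv add0m.
have [mq|mq] := leqP (mdeg m) q; last first.
  rewrite !alg_bracket_jet // subr0 jet_sumE big1 ?addr0 => [|i _].
    by rewrite /formal_deriv top_bracket_symbol // mdeg_maddU eqSS gtn_eqF.
  rewrite -[LHS]/(x i mzero * s k (madd (madd m (munit i)) (munit j))) ss ?mulr0 //.
  by rewrite !mdeg_maddU gtn_eqF // ltnS ltnW.
apply/eqP; rewrite eq_sym subr_eq eq_sym addrC -alg_bracket_deriv //; apply/eqP.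
rewrite [formal_deriv j (top_bracket _ _ _) k m]/formal_deriv /top_bracket mdeg_maddU eqSS.
(* For |m| = q the derivative of {x, S} is read off its leading part; for |m| < q it has order at
   most q, where [alg_bracket_symbol] computes {x, S}. *)
case: eqP => [mq'|/eqP mq'].
  rewrite jet_sumE big1 ?addr0 // => i _.
  rewrite -[LHS]/(x i mzero * s k (madd (madd m (munit i)) (munit j))) ss ?mulr0 //.
  by rewrite !mdeg_maddU mq' gtn_eqF.
rewrite add0r; have mq2 : (mdeg m < q)%N by rewrite ltn_neqAle mq' mq.
have mN i : (madd m (munit j) i <= q)%N.
  by apply: leq_trans (mdeg_ge _ i) _; rewrite mdeg_maddU.
rewrite (@alg_bracketE _ q) ?mdeg_maddU // -(@alg_bracketE q) ?mdeg_maddU //.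
rewrite alg_bracket_symbol // !jet_sumE; apply: eq_bigr => i _.
by rewrite -[LHS]/(x i mzero * s k (madd (madd m (munit j)) (munit i))) maddAC.
Qed.

Lemma alg_bracket0E x y l : alg_bracket 0 (jproj 1 x) (jproj 1 y) l mzero =
  \sum_i (x i mzero * y l (munit i) - y i mzero * x l (munit i)).
Proof.
rewrite (@alg_bracketE 0 0) ?mdeg_mzero // => [|i]; last by rewrite ffunE.
rewrite binomial_conv0 => [|a am]; last first.
  have := mdeg_le am; rewrite mdeg_mzero leqn0 => /eqP/mdeg0 ->.
  by rewrite eqxx.
by apply: eq_bigr => i _; rewrite /jproj add0m mdeg_mzero mdeg_unit.
Qed.

End BracketAlgebra.

(** * Linear operations, projections and sections of jets *)

Section JetCoordinates.
Variables (R : realType) (n : nat).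
Local Notation pt := 'rV[R]_n.
Local Notation jet := (jet R n).
Implicit Types (x y : jet) (c : R) (k : 'I_n) (m : mindex n).

Lemma jetDE x y k m : (x + y) k m = x k m + y k m. Proof. by []. Qed.
Lemma jetNE x k m : (- x) k m = - x k m. Proof. by []. Qed.
Lemma jetZE c x k m : (c *: x) k m = c * x k m. Proof. by []. Qed.
Lemma jet0E k m : (0 : jet) k m = 0. Proof. by []. Qed.

Lemma jetP x y : (forall k m, x k m = y k m) -> x = y.
Proof. by move=> xy; apply/funext => k; apply/funext => m. Qed.

Lemma formal_derivD i x y : formal_deriv i (x + y) = formal_deriv i x + formal_deriv i y.
Proof. by []. Qed.
Lemma formal_derivN i x : formal_deriv i (- x) = - formal_deriv i x.
Proof. by []. Qed.
Lemma formal_derivZ i c x : formal_deriv i (c *: x) = c *: formal_deriv i x.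
Proof. by []. Qed.
Lemma formal_deriv_sum i (I : Type) (r : seq I) (F : I -> jet) :
  formal_deriv i (\sum_(j <- r) F j) = \sum_(j <- r) formal_deriv i (F j).
Proof. by apply: jetP => k m; rewrite /formal_deriv !jet_sumE. Qed.

Lemma jprojD p x y : jproj p (x + y) = jproj p x + jproj p y.
Proof. by apply: jetP => k m; rewrite jetDE /jproj; case: ifP; rewrite ?addr0. Qed.

Lemma jprojN p x : jproj p (- x) = - jproj p x.
Proof. by apply: jetP => k m; rewrite jetNE /jproj; case: ifP; rewrite ?oppr0. Qed.

Lemma jprojZ p c x : jproj p (c *: x) = c *: jproj p x.
Proof. by apply: jetP => k m; rewrite jetZE /jproj; case: ifP; rewrite ?mulr0. Qed.

Lemma jproj_sum p (I : Type) (r : seq I) (F : I -> jet) :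
  jproj p (\sum_(j <- r) F j) = \sum_(j <- r) jproj p (F j).
Proof.
apply: jetP => k m; rewrite /jproj !jet_sumE; case: ifP => // _.
by rewrite big1.
Qed.

Lemma jproj_id p x : is_jet p x -> jproj p x = x.
Proof.
by move=> jx; apply: jetP => k m; rewrite /jproj; case: leqP => // /jx.
Qed.

Lemma jproj_symbol p x : is_symbol p.+1 x -> jproj p x = 0.
Proof.
move=> sx; apply: jetP => k m; rewrite /jproj; case: leqP => // mp.
by rewrite sx // ltn_eqF.
Qed.

Lemma symbol_jproj0 p x : is_jet p.+1 x -> jproj p x = 0 -> is_symbol p.+1 x.
Proof.
move=> jx x0 k m; rewrite neq_ltn => /orP[mp|/jx -> //].
by have := congr1 (fun f : jet => f k m) x0; rewrite /jproj -ltnS mp.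
Qed.

Lemma jproj_jet p x : is_jet p (jproj p x).
Proof. by move=> k m mp; rewrite /jproj leqNgt mp. Qed.

Lemma jetS p x : is_jet p x -> is_jet p.+1 x.
Proof. by move=> jx k m mp; rewrite jx // ltnW. Qed.

Lemma is_jetD p x y : is_jet p x -> is_jet p y -> is_jet p (x + y).
Proof. by move=> jx jy k m mp; rewrite jetDE jx // jy // addr0. Qed.

Lemma is_jetZ p c x : is_jet p x -> is_jet p (c *: x).
Proof. by move=> jx k m mp; rewrite jetZE jx // mulr0. Qed.

Lemma is_jet_sum p (I : Type) (r : seq I) (F : I -> jet) :
  (forall i, is_jet p (F i)) -> is_jet p (\sum_(i <- r) F i).
Proof. by move=> jF k m mp; rewrite jet_sumE big1 // => i _; rewrite jF. Qed.

Lemma is_symbolD p x y : is_symbol p x -> is_symbol p y -> is_symbol p (x + y).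
Proof. by move=> jx jy k m mp; rewrite jetDE jx // jy // addr0. Qed.

Lemma is_symbolZ p c x : is_symbol p x -> is_symbol p (c *: x).
Proof. by move=> jx k m mp; rewrite jetZE jx // mulr0. Qed.

Lemma is_symbol_sum p (I : Type) (r : seq I) (F : I -> jet) :
  (forall i, is_symbol p (F i)) -> is_symbol p (\sum_(i <- r) F i).
Proof. by move=> jF k m mp; rewrite jet_sumE big1 // => i _; rewrite jF. Qed.

Lemma mval_surj p m : (mdeg m <= p)%N -> exists b : mbox n p, mval b = m.
Proof.
move=> mp; exists [ffun i => inord (m i)]; apply/ffunP => i; rewrite !ffunE inordK //.
by rewrite ltnS (leq_trans (mdeg_ge m i)).
Qed.

(** Every multi-index of degree at most p lies in [mbox n p], so jets of order p are governed by
    finitely many coordinates, as the rank arguments require. *)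
Lemma eq_jet p x y : is_jet p x -> is_jet p y ->
  (forall k (b : mbox n p), x k (mval b) = y k (mval b)) -> x = y.
Proof.
move=> jx jy xy; apply: jetP => k m; have [mp|mp] := leqP (mdeg m) p.
  by have [b <-] := mval_surj mp.
by rewrite jx // jy.
Qed.

Lemma jet_section_sub p (V V' : set pt) (xi : pt -> jet) : V' `<=` V ->
  jet_section p V xi -> jet_section p V' xi.
Proof.
move=> VV' [sxi jxi]; split => [k m|y /VV']; last exact: jxi.
exact: smoothS VV' (sxi k m).
Qed.

Lemma jet_sectionD p V (xi eta : pt -> jet) : open V ->
  jet_section p V xi -> jet_section p V eta -> jet_section p V (fun z => xi z + eta z).
Proof.
move=> oV [s1 j1] [s2 j2]; split => [k m|y Vy]; first exact: smoothD.
by apply: is_jetD; [exact: j1|exact: j2].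
Qed.

Lemma jet_sectionZ p V c (xi : pt -> jet) : open V ->
  jet_section p V xi -> jet_section p V (fun z => c *: xi z).
Proof.
move=> oV [s1 j1]; split => [k m|y Vy]; first exact: smoothZ.
by apply: is_jetZ; exact: j1.
Qed.

Lemma jet_section_cst p V x : open V -> is_jet p x -> jet_section p V (fun=> x).
Proof. by move=> oV jx; split => // k m; exact: smooth_cst. Qed.

Lemma jet_sectionS p V (xi : pt -> jet) : jet_section p V xi -> jet_section p.+1 V xi.
Proof. by move=> [sx jx]; split => // y /jx; exact: jetS. Qed.

Lemma jet_section_proj p V (xi : pt -> jet) : open V -> jet_section p.+1 V xi ->
  jet_section p V (fun z => jproj p (xi z)).
Proof.
move=> oV [sx jx]; split => [k m|y Vy]; last exact: jproj_jet.
by rewrite /jproj; case: (mdeg m <= p)%N; [exact: sx|exact: smooth_cst].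
Qed.

Lemma jet_section_sum p V (I : Type) (r : seq I) (F : I -> pt -> jet) : open V ->
  (forall i, jet_section p V (F i)) -> jet_section p V (fun z => \sum_(i <- r) F i z).
Proof.
move=> oV jF; split => [k m|y Vy].
  under eq_fun do rewrite jet_sumE.
  by apply: smooth_sum => // i; case: (jF i).
by apply: is_jet_sum => i; case: (jF i) => _; apply.
Qed.

(** The derivative of the components in the chart. For a section of a subbundle its value need not
    lie in the fibre; it does where the section vanishes ([subbundle_partial]). *)
Definition jet_partial (i : 'I_n) (xi : pt -> jet) (z : pt) : jet :=
  fun k m => partial i (fun z => xi z k m) z.

Lemma jet_partial_jet p V (xi : pt -> jet) i (y : pt) : open V -> V y ->
  (forall z, V z -> is_jet p (xi z)) -> is_jet p (jet_partial i xi y).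
Proof.
move=> oV Vy jxi k m mp; rewrite /jet_partial.
rewrite (eq_partial i oV Vy (g := fun=> 0)) ?partial_cst // => z Vz.
by rewrite jxi.
Qed.

End JetCoordinates.

(** * Subbundles of jet bundles *)

Section Subbundles.
Variables (R : realType) (n p : nat) (W : set 'rV[R]_n) (G : 'rV[R]_n -> set (jet R n)).
Hypothesis sub : vector_subbundle p W G.
Local Notation pt := 'rV[R]_n.
Local Notation jet := (jet R n).

Lemma subbundleD y x x' : W y -> G y x -> G y x' -> G y (x + x').
Proof.
move=> /sub[V [d [e [_ Vy _ /(_ y Vy)[_ ->]]]]] [a _ <-] [b _ <-].
exists (fun i => a i + b i) => //; rewrite -big_split.
by apply: eq_bigr => i _; rewrite scalerDl.
Qed.

Lemma subbundleZ y c x : W y -> G y x -> G y (c *: x).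
Proof.
move=> /sub[V [d [e [_ Vy _ /(_ y Vy)[_ ->]]]]] [a _ <-].
exists (fun i => c * a i) => //; rewrite scaler_sumr.
by apply: eq_bigr => i _; rewrite scalerA.
Qed.

Lemma subbundle0 y : W y -> G y 0.
Proof.
move=> /sub[V [d [e [_ Vy _ /(_ y Vy)[_ ->]]]]].
by exists (fun=> 0) => //; rewrite big1 // => i _; rewrite scale0r.
Qed.

Lemma subbundleN y x : W y -> G y x -> G y (- x).
Proof. by move=> Wy Gx; rewrite -scaleN1r; exact: subbundleZ. Qed.

Lemma subbundle_sum y : W y -> forall (I : Type) (r : seq I) (F : I -> jet),
  (forall i, G y (F i)) -> G y (\sum_(i <- r) F i).
Proof.
move=> Wy I r F GF; elim: r => [|i r IH]; rewrite ?big_nil ?big_cons; first exact: subbundle0.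
exact: subbundleD.
Qed.

Lemma subbundle_jet y x : W y -> G y x -> is_jet p x.
Proof.
move=> /sub[V [d [e [_ Vy je /(_ y Vy)[_ ->]]]]] [a _ <-].
by apply: is_jet_sum => i; apply: is_jetZ; case: (je i) => _; apply.
Qed.

(** Keep the coefficients of x in a local frame constant. The neighbourhood is chosen before x, so
    several elements extend over a common set. *)
Lemma subbundle_extend y : W y -> exists V (ext : jet -> pt -> jet),
  [/\ open V, V y & forall x, G y x -> [/\ jet_section p V (ext x),
    forall z, V z -> G z (ext x z) & ext x y = x]].
Proof.
move=> /sub[V [d [e [oV Vy je Ge]]]].
pose a x := xget (fun=> 0) [set a : 'I_d -> R | \sum_i a i *: e i y = x].
exists V, (fun x z => \sum_i a x i *: e i z); split => // x Gx.
split=> [|z Vz|].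
- by apply: jet_section_sum => // i; exact: jet_sectionZ.
- by case: (Ge z Vz) => _ ->; exists (a x).
- have [_ Gy] := Ge y Vy; rewrite Gy in Gx; case: Gx => b _ bx.
  exact: (@xgetPex _ (fun=> 0) [set a : 'I_d -> R | \sum_i a i *: e i y = x] (ex_intro _ b bx)).
Qed.

(* A first order limit: if a section of the bundle vanishes at y, then its    *)
(* difference quotients lie in nearby fibres, and the fibres vary             *)
(* continuously with constant dimension.                                      *)
Lemma subbundle_partial V (rho : pt -> jet) i y : W y -> open V -> V y ->
  (forall k m, smooth V (fun z => rho z k m)) -> (forall z, V z -> G z (rho z)) ->
  rho y = 0 -> G y (jet_partial i rho y).
Proof.
move=> Wy oV Vy srho Grho rho0.
have [V0 [d [e [oV0 V0y je Ge]]]] := sub Wy.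
have jrho z : (V `&` V0) z -> is_jet p (rho z).
  move=> [Vz V0z]; have := Grho z Vz; have [_ ->] := Ge z V0z => -[a _ <-].
  by apply: is_jet_sum => j; apply: is_jetZ; case: (je j) => _; apply.
have oVV0 : open (V `&` V0) by exact: openI.
have path : (fun h : R => h *: ('e_i : pt) + y) @ 0^' --> y.
  suff : (fun h : R => h *: ('e_i : pt) + y) @ 0^' --> (0 : R) *: ('e_i : pt) + y.
    by rewrite scale0r add0r.
  apply: cvgD; last exact: cvg_cst.
  by apply: cvgZr_tmp; exact: nbhs_dnbhs.
have nearV : \forall h \near 0^', (V `&` V0) (h *: ('e_i : pt) + y).
  exact: (path _ (open_nbhs_nbhs (conj oVV0 (conj Vy V0y)))).
have [a Ha] : exists a : 'I_d -> R, forall j : 'I_n * mbox n p,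
    jet_partial i rho y j.1 (mval j.2) = \sum_l a l * e l y j.1 (mval j.2).
  apply: (@span_limit _ R (0^') _ _ _
    (fun h l j => e l (h *: ('e_i : pt) + y) j.1 (mval j.2))
    (fun l j => e l y j.1 (mval j.2))
    (fun h j => h^-1 *: (rho (h *: ('e_i : pt) + y) j.1 (mval j.2)
       - rho y j.1 (mval j.2)))).
  - move=> l j; have c := smooth_continuous ((je l).1 j.1 (mval j.2)) V0y.
    exact: (cvg_comp _ _ path c).
  - by move=> j; exact: (smooth_derivable (i := i) (srho j.1 (mval j.2)) Vy).
  - move=> a a0; have [indep _] := Ge y V0y; apply: indep.
    apply: (@eq_jet _ _ p) => [|//|k b].
      by apply: is_jet_sum => l; apply: is_jetZ; case: (je l) => _; apply.
    rewrite jet_sumE -[RHS](a0 (k, b)); exact: eq_bigr.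
  - apply: filterS nearV => h [Vh V0h]; have := Grho _ Vh.
    have [_ ->] := Ge _ V0h => -[a _ ae]; exists (fun l => h^-1 * a l) => j.
    rewrite rho0 jet0E subr0 -ae jet_sumE scaler_sumr; apply: eq_bigr => l _.
    exact: mulrA.
have [_ ->] := Ge y V0y; exists a => //; apply: (@eq_jet _ _ p) => [||k b].
- by apply: is_jet_sum => l; apply: is_jetZ; case: (je l) => _; apply.
- exact: (jet_partial_jet i oVV0 (conj Vy V0y) jrho).
- by rewrite jet_sumE (Ha (k, b)).
Qed.

End Subbundles.

(** * The prolongation R_{q+1}, its symbol, and the Lie condition *)

Section FirstProlongation.
Variables (R : realType) (n q : nat).
Local Notation pt := 'rV[R]_n.
Local Notation jet := (jet R n).
Local Notation jform := (jform R n).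
Variables (W : set pt) (E : pt -> set jet).
Local Notation P := (prolongation q 1 E).

Lemma mpartial_munit (V : set pt) (f : pt -> R) i y : open V -> smooth V f -> V y ->
  mpartial (munit i) f y = partial i f y.
Proof.
move=> oV sf Vy; rewrite -[munit i]add0m -(mpartial_partial _ _ oV sf Vy).
by rewrite mpartial0.
Qed.

Lemma mdeg_le1 (m : mindex n) : (mdeg m <= 1)%N -> m = mzero \/ exists i, m = munit i.
Proof.
move=> m1; have [/mdeg0|] := eqVneq (mdeg m) 0%N; first by left.
rewrite -lt0n => m0; right.
have [i mi] : exists i, (0 < m i)%N.
  apply/existsP; apply: contraTT m0; rewrite negb_exists => /forallP H.
  by rewrite /mdeg big1 // => i _; have := H i; case: (m i).
exists i; have E1 : m = madd (msub m (munit i)) (munit i).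
  apply/ffunP => j; rewrite !ffunE; case: eqP => [->|]; last by rewrite subn0 addn0.
  by rewrite subnK.
have : mdeg (msub m (munit i)) = 0%N.
  by apply/eqP; rewrite -leqn0 -ltnS -(mdeg_maddU _ i) -E1.
by move/mdeg0 => E2; rewrite E1 E2 add0m.
Qed.

(** A multi-index of degree at most 1 is 0 or a unit, so the jet condition splits into one on the
    value of the section and one on its first derivatives. *)
Lemma prolongation1P y x : P y x <-> is_jet q.+1 x /\
  exists V (eta : pt -> jet), [/\ open V, V y, jet_section q V eta,
    forall z, V z -> E z (eta z) & eta y = jproj q x /\
    forall i k m, (mdeg m <= q)%N ->
      jet_partial i eta y k m = x k (madd m (munit i))].
Proof.
rewrite /prolongation /= addn1; split=> -[jx [V [eta [oV Vy seta Eeta H]]]];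
  split => //; exists V, eta.
  split => //; split => [|i k m mq].
    apply: jetP => k m; rewrite /jproj; case: leqP => mq.
      by have := H k m mzero mq; rewrite mdeg_mzero mpartial0 madd0 => ->.
    by case: seta => _ /(_ y Vy k m mq).
  rewrite -H // ?mdeg_unit //; symmetry.
  exact: (mpartial_munit i oV (seta.1 k m) Vy).
case: H => H0 H1; split => // k m m' mq /mdeg_le1[->|[i ->]].
  by rewrite mpartial0 madd0 H0 /jproj mq.
by rewrite (mpartial_munit i oV (seta.1 k m) Vy); exact: H1.
Qed.

Lemma prolongation1_jproj y x : P y x -> E y (jproj q x).
Proof. by move=> /prolongation1P[_ [V [eta [_ Vy _ /(_ y Vy) + [<- _]]]]]. Qed.

Lemma prolongation1_jet y x : P y x -> is_jet q.+1 x.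
Proof. by move=> /prolongation1P[]. Qed.

Hypothesis subE : vector_subbundle q W E.

Lemma prolongation0 y : W y -> prolongation q 0 E y = E y.
Proof.
move=> Wy; apply/seteqP; split => x; rewrite /prolongation /= addn0.
  move=> [jx [V [eta [oV Vy seta Eeta H]]]]; suff <- : eta y = x by exact: Eeta.
  apply: jetP => k m; have [mq|mq] := leqP (mdeg m) q.
    by have := H k m mzero mq; rewrite mdeg_mzero mpartial0 madd0 => ->.
  by rewrite jx // (seta.2 y Vy).
move=> Ex; split; first exact: (subbundle_jet subE Wy).
have [V [ext [oV Vy /(_ x Ex)[sx Eext extx]]]] := subbundle_extend subE Wy.
exists V, (ext x); split => // k m m' _; rewrite leqn0 => /eqP/mdeg0 ->.
by rewrite mpartial0 madd0 extx.
Qed.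

Hypothesis oW : open W.

(** Take a section eta of R_q witnessing that chi(y) is in R_{q+1}. The q-jet part of chi minus eta
    is a section of R_q vanishing at y, and its derivative there is D chi(y), because the first
    derivatives of eta are the shifts of chi(y). *)
Lemma spencer_prolongation y V (chi : pt -> jet) i : W y -> open V -> V y ->
  jet_section q.+1 V chi -> (forall z, V z -> E z (jproj q (chi z))) ->
  P y (chi y) -> E y (spencer_jet q chi i y).
Proof.
move=> Wy oV Vy schi Echi /prolongation1P[_ [V' [eta [oV' V'y seta Eeta [eta0 eta1]]]]].
pose V2 := V `&` V' `&` W.
have oV2 : open V2 by do 2 apply: openI => //.
have V2y : V2 y by [].
have sub1 : V2 `<=` V by move=> z [[]].
have sub2 : V2 `<=` V' by move=> z [[]].
have s1 := jet_section_proj oV2 (jet_section_sub sub1 schi).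
have s2 := jet_section_sub sub2 seta.
have : E y (jet_partial i (fun z => jproj q (chi z) - eta z) y).
  apply: (subbundle_partial subE i Wy oV2 V2y) => [k m|z [[Vz V'z] Wz]|].
  - exact: (smoothB oV2 (s1.1 k m) (s2.1 k m)).
  - apply: (subbundleD subE Wz); first exact: Echi.
    by apply: (subbundleN subE Wz); exact: Eeta.
  - by rewrite eta0 subrr.
congr (E y _); apply: jetP => k m; rewrite /spencer_jet.
have [mq|mq] := leqP (mdeg m) q.
  rewrite /jet_partial (partialB _ (s1.1 k m) (s2.1 k m) V2y) -/(jet_partial i eta y k m).
  by rewrite eta1 // /jproj mq.
have jr z : V2 z -> is_jet q (jproj q (chi z) - eta z).
  move=> V2z; apply: is_jetD; first exact: jproj_jet.
  by rewrite -scaleN1r; apply: is_jetZ; exact: (s2.2 z V2z).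
by rewrite (jet_partial_jet i oV2 V2y jr).
Qed.

(** This describes g_{q+1} as the symbols s with delta s in T^* (x) R_q. A witnessing section
    vanishes at y, so its derivatives lie in the fibre; conversely a section of R_q vanishing at y
    with prescribed derivatives is constructed. *)
Lemma prolongation_symbol y s : W y -> is_symbol q.+1 s ->
  P y s <-> forall i, E y (formal_deriv i s).
Proof.
move=> Wy ss; have s0 : jproj q s = 0 by exact: jproj_symbol.
split=> [Ps i|Es].
  move: Ps => /prolongation1P[_ [V [eta [oV Vy seta Eeta [eta0 eta1]]]]].
  have : E y (jet_partial i eta y).
    by apply: (subbundle_partial subE i Wy oV Vy seta.1 Eeta); rewrite eta0.
  congr (E y _); apply: jetP => k m; have [mq|mq] := leqP (mdeg m) q; first exact: eta1.
  rewrite (jet_partial_jet i oV Vy seta.2) // /formal_deriv ss // mdeg_maddU eqSS.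
  by rewrite gtn_eqF.
have [V [ext [oV Vy extP]]] := subbundle_extend subE Wy.
have oVW : open (V `&` W) by exact: openI.
have VWy : (V `&` W) y by [].
have subV : V `&` W `<=` V by move=> z [].
(* A first-order Taylor polynomial with coefficients extended inside R_q: it vanishes at y and its
   i-th derivative there is the i-th component of delta s. *)
pose eta (z : pt) : jet := \sum_i (z 0 i - y 0 i) *: ext (formal_deriv i s) z.
have etaE k m z : eta z k m =
    \sum_i (z 0 i - y 0 i) * ext (formal_deriv i s) z k m by rewrite /eta jet_sumE.
have sfE i k m : smooth (V `&` W) (fun z => ext (formal_deriv i s) z k m).
  by have [[se _] _ _] := extP _ (Es i); exact: smoothS (se k m).
have smE i k m : smooth (V `&` W)
    (fun z => (z 0 i - y 0 i) * ext (formal_deriv i s) z k m).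
  by apply: smoothM => //; exact: smooth_coord.
apply/prolongation1P; split; first exact: symbol_jet.
exists (V `&` W), eta; split => //.
- split => [k m|z [Vz Wz]].
    by under eq_fun do rewrite etaE; exact: smooth_sum.
  apply: is_jet_sum => i; apply: is_jetZ.
  by have [[_ +] _ _] := extP _ (Es i); apply.
- move=> z [Vz Wz]; rewrite /eta; apply: (subbundle_sum subE Wz) => i; apply: (subbundleZ subE _ Wz).
  by have [_ + _] := extP _ (Es i); apply.
split; first by rewrite s0 /eta big1 // => i _; rewrite subrr scale0r.
move=> i k m mq; rewrite /jet_partial.
under eq_fun do rewrite etaE.
rewrite (partial_sum _ _ (fun j => smE j k m) VWy) (bigD1 i) //= big1 => [|j ji].
  rewrite (partialM _ (smooth_coord _ _ oVW) (sfE i k m) VWy) subrr mul0r add0r.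
  rewrite /partial (@derive_val _ _ _ _ _ _ _ (is_derive_coord i (y 0 i) y 'e_i)).
  by rewrite mxE !eqxx mulr1 addr0; have [_ _ ->] := extP _ (Es i).
rewrite (partialM _ (smooth_coord _ _ oVW) (sfE j k m) VWy) subrr mul0r add0r.
rewrite /partial (@derive_val _ _ _ _ _ _ _ (is_derive_coord j (y 0 j) y 'e_i)).
by rewrite mxE eqxx (negbTE ji) mulr0.
Qed.

Hypothesis subP : vector_subbundle q.+1 W P.
Hypothesis lieE : local_lie_equations q W E.

(** Extend both elements to sections of R_{q+1}: their differential bracket is in R_q by the Lie
    condition, and the two D terms by which it differs from the algebraic bracket are in R_q by
    [spencer_prolongation]. *)
Lemma prolongation_bracket y xi eta : W y -> P y xi -> P y eta ->
  E y (alg_bracket q xi eta).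
Proof.
move=> Wy Pxi Peta.
have [V [ext [oV Vy extP]]] := subbundle_extend subP Wy.
have [sx Px xy] := extP _ Pxi; have [se Pe ey] := extP _ Peta.
have oVW : open (V `&` W) by exact: openI.
have subV : V `&` W `<=` V by move=> z [].
have Ec x x' : P y x' -> E y (spencer_contract q (ext x) (ext x') y).
  move=> Px'; have [sx' Pex' x'y] := extP _ Px'.
  apply: (subbundle_sum subE Wy) => i; apply: (subbundleZ subE _ Wy).
  apply: (spencer_prolongation i Wy oV Vy sx') => // [z Vz|]; last by rewrite x'y.
  exact/prolongation1_jproj/Pex'.
have := lieE oVW (@subIsetr _ _ _) (jet_section_sub subV sx) (jet_section_sub subV se).
move=> /(_ _ y (conj Vy Wy)) Hd.
have -> : alg_bracket q xi eta = diff_bracket q (ext xi) (ext eta) y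
    + - spencer_contract q (ext xi) (ext eta) y + spencer_contract q (ext eta) (ext xi) y.
  by rewrite /diff_bracket xy ey addrAC subrK addrK.
apply: (subbundleD subE Wy); last exact: Ec.
apply: (subbundleD subE Wy); last by apply: (subbundleN subE Wy); exact: Ec.
by apply: Hd => z [Vz Wz]; split; apply: prolongation1_jproj; [exact: Px|exact: Pe].
Qed.

End FirstProlongation.

(** * The denominator of F_1 as a bundle of constant rank *)

Section JanetDenominator.
Variables (R : realType) (n q : nat).
Local Notation pt := 'rV[R]_n.
Local Notation jet := (jet R n).
Local Notation jform := (jform R n).
Variables (W : set pt) (E : pt -> set jet).
Local Notation P := (prolongation q 1 E).
Hypothesis oW : open W.
Hypothesis subE : vector_subbundle q W E.
Hypothesis subP : vector_subbundle q.+1 W P.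
Hypothesis liftE : forall y x, W y -> E y x -> exists2 x', P y x' & jproj q x' = x.

Local Notation N := #|{: 'I_n * mbox n q.+1}|.

(** Jets of order q+1 as row vectors, so that the matrix theory of ranks applies. The coordinates
    include multi-indices of degree above q+1, where jets vanish. *)
Definition jet_row (x : jet) : 'rV[R]_N :=
  \row_j x (enum_val j).1 (mval (enum_val j).2).

Lemma jet_row_sum (I : finType) (a : I -> R) (x : I -> jet) :
  jet_row (\sum_i a i *: x i) = \sum_i a i *: jet_row (x i).
Proof.
apply/rowP => j; rewrite mxE jet_sumE summxE; apply: eq_bigr => i _.
by rewrite !mxE.
Qed.

Lemma jet_row_inj x y : is_jet q.+1 x -> is_jet q.+1 y -> jet_row x = jet_row y -> x = y.
Proof.
move=> jx jy xy; apply: (eq_jet jx jy) => k b.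
by move/rowP/(_ (enum_rank (k, b))): xy; rewrite !mxE enum_rankK.
Qed.

Lemma jet_row_surj (v : 'rV[R]_N) : (forall j, v 0 j != 0 ->
  (mdeg (mval (enum_val j).2) <= q.+1)%N) -> exists2 x, is_jet q.+1 x & jet_row x = v.
Proof.
move=> v0; pose x : jet := fun k m => if (mdeg m <= q.+1)%N then
  v 0 (enum_rank (k, [ffun i => inord (m i)] : mbox n q.+1)) else 0.
exists x => [k m|]; first by rewrite /x ltnNge => /negbTE ->.
apply/rowP => j; rewrite mxE /x.
have -> : [ffun i => inord (mval (enum_val j).2 i)] = (enum_val j).2 :> mbox n q.+1.
  by apply/ffunP => i; rewrite !ffunE inord_val.
rewrite -surjective_pairing enum_valK; case: ifPn => // H.
by apply/esym/eqP; apply: contraNT H => /v0.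
Qed.

(* The complement D of g_{q+1}(y) in S_{q+1} T^* (x) T stays a complement of  *)
(* R_{q+1} in the inverse image of R_q nearby, by a dimension count: that     *)
(* inverse image has constant dimension rank R_q + dim (S_{q+1} T^* (x) T).   *)
Lemma symbol_complement y : W y -> exists V r (s : 'I_r -> jet),
  [/\ open V, V y, forall j, is_symbol q.+1 (s j),
   forall z, V z -> forall t, is_symbol q.+1 t -> exists (a : 'I_r -> R),
     P z (t - \sum_j a j *: s j) &
   forall a, P y (\sum_j a j *: s j) -> forall j, a j = 0].
Proof.
move=> Wy.
have [V0 [d0 [e0 [oV0 V0y je0 Ee0]]]] := subE Wy.
have [V1 [d1 [e1 [oV1 V1y je1 Pe1]]]] := subP Wy.
pose V := V0 `&` V1 `&` W.
have oV : open V by do 2 apply: openI => //.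
have Vy : V y by [].
pose M0 z : 'M[R]_(d0, N) := \matrix_i jet_row (e0 i z).
pose M1 z : 'M[R]_(d1, N) := \matrix_i jet_row (e1 i z).
(* The coordinate projection onto degree q+1; its row space is S_{q+1} T^* (x) T. *)
pose Sy : 'M[R]_N := diag_mx (\row_j (mdeg (mval (enum_val j).2) == q.+1)%:R).
have mulM0 z (u : 'rV_d0) : u *m M0 z = jet_row (\sum_i u 0 i *: e0 i z).
  by rewrite jet_row_sum mulmx_sum_row; apply: eq_bigr => i _; rewrite rowK.
have mulM1 z (u : 'rV_d1) : u *m M1 z = jet_row (\sum_i u 0 i *: e1 i z).
  by rewrite jet_row_sum mulmx_sum_row; apply: eq_bigr => i _; rewrite rowK.
have E0 z x : V z -> E z x -> (jet_row x <= M0 z)%MS.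
  move=> [[V0z _] _]; have [_ ->] := Ee0 z V0z => -[a _ <-].
  apply/submxP; exists (\row_i a i); rewrite mulM0; congr jet_row.
  by apply: eq_bigr => i _; rewrite mxE.
have E1 z x : V z -> P z x -> (jet_row x <= M1 z)%MS.
  move=> [[_ V1z] _]; have [_ ->] := Pe1 z V1z => -[a _ <-].
  apply/submxP; exists (\row_i a i); rewrite mulM1; congr jet_row.
  by apply: eq_bigr => i _; rewrite mxE.
have Ein z (u : 'rV_d0) : V z -> E z (\sum_i u 0 i *: e0 i z).
  by move=> [[V0z _] _]; have [_ ->] := Ee0 z V0z; exists (fun i => u 0 i).
have Pin z (u : 'rV_d1) : V z -> P z (\sum_i u 0 i *: e1 i z).
  by move=> [[_ V1z] _]; have [_ ->] := Pe1 z V1z; exists (fun i => u 0 i).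
have mulSy (u : 'rV_N) : u *m Sy =
    \row_j (u 0 j * (mdeg (mval (enum_val j).2) == q.+1)%:R).
  by apply/rowP => j; rewrite mul_mx_diag !mxE.
have symS t : is_symbol q.+1 t -> (jet_row t <= Sy)%MS.
  move=> st; apply/submxP; exists (jet_row t); rewrite mulSy.
  apply/rowP => j; rewrite !mxE; case: eqP => [_|/eqP H]; first by rewrite mulr1.
  by rewrite st // mul0r.
have Ssym (v : 'rV_N) : (v <= Sy)%MS -> exists2 t, is_symbol q.+1 t & jet_row t = v.
  move=> /submxP[u ->]; rewrite mulSy.
  have [|x jx xv] := @jet_row_surj (\row_j (u 0 j * (mdeg (mval (enum_val j).2) == q.+1)%:R)).
    move=> j; rewrite mxE; have [->//|_] := eqVneq (mdeg (mval (enum_val j).2)) q.+1.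
    by rewrite mulr0 eqxx.
  exists x => // k m mq; have [mq1|/jx //] := leqP (mdeg m) q.+1.
  have [b bm] := mval_surj mq1; move/rowP/(_ (enum_rank (k, b))): xv.
  by rewrite !mxE enum_rankK /= bm (negbTE mq) mulr0.
have free0 z : V z -> row_free (M0 z).
  move=> [[V0z _] _]; apply: inj_row_free => u; rewrite mulM0 => u0.
  have /(_ (fun i => u 0 i)) H := (Ee0 z V0z).1; apply/rowP => i; rewrite mxE; apply: H.
  apply: jet_row_inj => //; last by rewrite u0; apply/rowP => j; rewrite !mxE.
  by apply: jetS; apply: is_jet_sum => j; apply: is_jetZ; case: (je0 j) => _; apply.
have free1 z : V z -> row_free (M1 z).
  move=> [[_ V1z] _]; apply: inj_row_free => u; rewrite mulM1 => u0.
  have /(_ (fun i => u 0 i)) H := (Pe1 z V1z).1; apply/rowP => i; rewrite mxE; apply: H.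
  apply: jet_row_inj => //; last by rewrite u0; apply/rowP => j; rewrite !mxE.
  by apply: is_jet_sum => j; apply: is_jetZ; case: (je1 j) => _; apply.
have rowD x x' : jet_row (x + x') = jet_row x + jet_row x'.
  by apply/rowP => j; rewrite !mxE.
(* R_{q+1} and R_q, extended by zero, have the same sum with the symbols: R_{q+1} projects into R_q,
   and by [liftE] onto it. *)
have eqMS z : V z -> (M1 z + Sy :=: M0 z + Sy)%MS.
  move=> Vz; have Wz : W z by case: Vz.
  apply/eqmxP/andP; split; rewrite addsmx_sub addsmxSr andbT; apply/row_subP => i.
    rewrite rowK; have Pi : P z (e1 i z).
      have := Pin z (delta_mx 0 i) Vz; rewrite (bigD1 i) //= big1 => [|j ji].
        by rewrite addr0 mxE !eqxx scale1r.
      by rewrite mxE eqxx (negbTE ji) scale0r.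
    rewrite -[e1 i z](subrK (jproj q (e1 i z))) addrC rowD; apply: addmx_sub_adds.
      by apply: E0 => //; exact: prolongation1_jproj.
    apply: symS; apply: symbol_jproj0.
      apply: is_jetD; first exact: prolongation1_jet Pi.
      by rewrite -scaleN1r; apply/is_jetZ/jetS/jproj_jet.
    by rewrite jprojD jprojN (jproj_id (jproj_jet _)) subrr.
  rewrite rowK; have Ei : E z (e0 i z).
    have := Ein z (delta_mx 0 i) Vz; rewrite (bigD1 i) //= big1 => [|j ji].
      by rewrite addr0 mxE !eqxx scale1r.
    by rewrite mxE eqxx (negbTE ji) scale0r.
  have [x Px xE] := liftE Wz Ei.
  rewrite -[e0 i z](subrK x) addrC rowD; apply: addmx_sub_adds; first exact: E1.
  have je : is_jet q (e0 i z) by case: (je0 i) => _; apply; case: Vz => -[].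
  apply: symS; apply: symbol_jproj0.
    apply: is_jetD; first exact: jetS.
    by rewrite -scaleN1r; apply: is_jetZ; exact: prolongation1_jet Px.
  by rewrite jprojD jprojN xE (jproj_id je) subrr.
(* Jets of order q and symbols of order q+1 meet in 0, so this rank does not depend on z. *)
have rank0 z : V z -> \rank (M0 z + Sy) = (d0 + \rank Sy)%N.
  move=> Vz; have := mxrank_sum_cap (M0 z) Sy.
  rewrite (eqP (free0 z Vz)) => <-; suff -> : (M0 z :&: Sy)%MS = 0 by rewrite mxrank0 addn0.
  apply/eqP/rowV0P => v; rewrite sub_capmx => /andP[/submxP[u vu] /Ssym[t st tv]].
  have e0t : \sum_i u 0 i *: e0 i z = t.
    apply: jet_row_inj; last by rewrite tv -mulM0.
      apply: jetS; apply: is_jet_sum => j; apply: is_jetZ; case: (je0 j) => _; apply.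
      by case: Vz => -[].
    exact: symbol_jet.
  have je : is_jet q t.
    rewrite -e0t; apply: is_jet_sum => j; apply: is_jetZ; case: (je0 j) => _; apply.
    by case: Vz => -[].
  rewrite -tv -(jproj_id je) jproj_symbol //.
  by apply/rowP => j; rewrite !mxE.
(* D is a complement of g_{q+1}(y) inside the symbols, and B a basis of it. *)
pose D := (Sy :\: M1 y)%MS; pose B := row_base D.
have DSy : (D <= Sy)%MS by exact: diffmxSl.
have cap0 : (M1 y :&: B)%MS = 0.
  apply/eqP; rewrite -submx0 -(capmx_diff Sy (M1 y)) -/D capmxC.
  by rewrite capmxS // eq_row_base.
have sumD : (M1 y + D :=: M1 y + Sy)%MS.
  apply/eqmxP/andP; split; first by rewrite addsmxS.
  rewrite addsmx_sub addsmxSl /= -(addsmx_diff_cap_eq Sy (M1 y)) addsmx_sub.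
  by rewrite addsmxSr (submx_trans (capmxSr _ _)) ?addsmxSl.
have rankD : (d1 + \rank D = d0 + \rank Sy)%N.
  rewrite -(rank0 y Vy) -(eqMS y Vy) -sumD.
  have := mxrank_sum_cap (M1 y) B; rewrite cap0 mxrank0 addn0 (eqP (free1 y Vy)).
  rewrite (eqP (row_base_free D)) => <-.
  by rewrite (adds_eqmx (eqmx_refl (M1 y)) (eq_row_base D)).
have freeB : row_free (col_mx (M1 y) B).
  rewrite /row_free -addsmxE; have := mxrank_sum_cap (M1 y) B.
  by rewrite cap0 mxrank0 addn0 (eqP (free1 y Vy)) (eqP (row_base_free D)) => ->.
have nearB : \forall z \near y, row_free (col_mx (M1 z) B).
  apply: (@near_row_free _ _ (nbhs y) _ _ _ (fun z => col_mx (M1 z) B)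
    (col_mx (M1 y) B) _ freeB) => i j; rewrite -(splitK i).
  case: (fintype.split i) => k /=.
    rewrite col_mxEu !mxE; under eq_fun do rewrite col_mxEu !mxE.
    exact: (smooth_continuous ((je1 k).1 _ _) V1y).
  by rewrite col_mxEd; under eq_fun do rewrite col_mxEd; exact: cvg_cst.
have [V' [oV' V'y] V'B] : exists2 V', open_nbhs y V' & V' `<=` [set z | row_free (col_mx (M1 z) B)].
  by move: nearB; rewrite /prop_near1 nbhsE => -[V' oV' V'B]; exists V'.
have sE (j : 'I_(\rank D)) : exists t, is_symbol q.+1 t /\ jet_row t = row j B.
  have [|t st tv] := @Ssym (row j B); last by exists t.
  by apply: submx_trans DSy; rewrite (submx_trans (row_sub j B)) // eq_row_base.
have [s sP] := choice sE.
have mulB (u : 'rV_(\rank D)) : u *m B = jet_row (\sum_i u 0 i *: s i).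
  by rewrite jet_row_sum mulmx_sum_row; apply: eq_bigr => i _; rewrite (sP i).2.
have ssum (u : 'I_(\rank D) -> R) : is_symbol q.+1 (\sum_i u i *: s i).
  by apply: is_symbol_sum => i; apply: is_symbolZ; exact: (sP i).1.
exists (V' `&` V), (\rank D), s; split => //.
- exact: openI.
- by move=> j; case: (sP j).
- move=> z [V'z Vz] t st.
  have : (Sy <= M1 z + B)%MS.
    (* Near y the rows of M1 z and B stay independent; by [rankD] both sides have equal rank, so the
       inclusion is an equality. *)
    have le1 : (M1 z + B <= M1 z + Sy)%MS.
      by rewrite addsmxS // (submx_trans _ DSy) // eq_row_base.
    have := mxrank_leqif_sup le1; rewrite (eqMS z Vz) (rank0 z Vz) -rankD.
    have := V'B z V'z; rewrite /= /row_free -addsmxE => /eqP ->.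
    by move=> /leqif_refl => H; apply: submx_trans H; exact: addsmxSr.
  move=> /(submx_trans (symS t st))/sub_addsmxP[[u1 u2] /= tE].
  exists (fun j => u2 0 j).
  suff -> : t - \sum_j u2 0 j *: s j = \sum_i u1 0 i *: e1 i z by exact: Pin.
  apply/eqP; rewrite subr_eq; apply/eqP; apply: jet_row_inj.
  + exact: symbol_jet.
  + apply: is_jetD; last exact: symbol_jet.
    by apply: is_jet_sum => j; apply: is_jetZ; case: (je1 j) => _; apply; case: Vz => -[].
  + by rewrite rowD -mulM1 -mulB.
- move=> a Pa j.
  have /eqP := cap0; rewrite -submx0 => H.
  pose u : 'rV_(\rank D) := \row_j a j.
  have uE : \sum_i u 0 i *: s i = \sum_i a i *: s i.
    by apply: eq_bigr => i _; rewrite mxE.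
  have uB : (u *m B <= M1 y :&: B)%MS.
    by rewrite sub_capmx submxMl andbT mulB uE E1.
  have : u *m B = 0 by apply/eqP; rewrite -submx0 (submx_trans uB).
  rewrite -[RHS](mul0mx _ B) => /(row_free_inj (row_base_free D)) u0.
  by have := congr1 (fun w : 'rV_(\rank D) => w 0 j) u0; rewrite !mxE.
Qed.

Lemma ord1_fun (s : 'I_1 -> 'I_n) : s = fun=> s ord0.
Proof. by apply/funext => j; rewrite ord1. Qed.

Lemma alternating1 (A : jform 1) : Defs.alternating A.
Proof. by move=> s a b; rewrite !ord1 eqxx. Qed.

(* janet_den in degree 1 (and den2 below in degree 2), on the family of the   *)
(* values A(d_i) (resp. A(d_i, d_j)) of a form A.                             *)
Definition den1 (G : set jet) (A : 'I_n -> jet) : Prop := exists B S,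
  [/\ forall i, G (B i), is_symbol q.+1 S & forall i, A i = B i + formal_deriv i S].

Lemma janet_den1P (G : set jet) (A : jform 1) :
  janet_den q 0 G A <-> den1 G (fun i => A (fun=> i)).
Proof.
have dE (S : jform 0) (s : 'I_1 -> 'I_n) f : delta S s = formal_deriv (s ord0) (S f).
  apply: jetP => k m; rewrite /delta big_ord1 expr0 mul1r.
  by rewrite (_ : s \o lift ord0 = f) //; apply/funext => -[].
split=> [[B [S [[_ GB] [_ symS] ->]]]|[B [S [GB symS AE]]]].
  exists (fun i => B (fun=> i)), (S (widen_ord (leq0n n))).
  split => [i|//|i]; [exact: GB|exact: symS|].
  by rewrite -dE.
exists (fun s => B (s ord0)), (fun=> S); split.
- by split; [exact: alternating1|move=> s; exact: GB].
- by split => // s [].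
- apply/funext => s; rewrite {1}(ord1_fun s) AE; congr (_ + _).
  rewrite (dE (fun=> S) s (fun j : 'I_0 => s (widen_ord (leq0n 1) j))) //.
Qed.

(* Same limit argument as subbundle_partial. The frame is dx^i (x) e_a and    *)
(* delta s_j, where e is a frame of R_q and s_j spans a complement of g_{q+1}; *)
(* g_{q+1} itself is not needed since delta g_{q+1} lies in T^* (x) R_q.      *)
Lemma janet_den_partial V (rho : pt -> jform 1) i y : W y -> open V -> V y ->
  (forall j, jet_section q V (fun z => rho z (fun=> j))) ->
  (forall z, V z -> janet_den q 0 (E z) (rho z)) -> (forall s, rho y s = 0) ->
  janet_den q 0 (E y) (fun s => jet_partial i (fun z => rho z s) y).
Proof.
move=> Wy oV Vy srho drho rho0.
have [V0 [d [e [oV0 V0y je Ee]]]] := subE Wy.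
have [V1 [r [s [oV1 V1y ss sspan sindep]]]] := symbol_complement Wy.
have path : (fun h : R => h *: ('e_i : pt) + y) @ 0^' --> y.
  suff : (fun h : R => h *: ('e_i : pt) + y) @ 0^' --> (0 : R) *: ('e_i : pt) + y.
    by rewrite scale0r add0r.
  apply: cvgD; last exact: cvg_cst.
  by apply: cvgZr_tmp; exact: nbhs_dnbhs.
pose V2 := (V `&` V0) `&` (V1 `&` W).
have oV2 : open V2 by apply: openI; exact: openI.
have V2y : V2 y by [].
have nearV : \forall h \near 0^', V2 (h *: ('e_i : pt) + y).
  exact: (path _ (open_nbhs_nbhs (conj oV2 V2y))).
pose frame z (l : ('I_n * 'I_d) + 'I_r) (j : 'I_n * ('I_n * mbox n q)) : R :=
  match l with
  | inl p => (j.1 == p.1)%:R * e p.2 z j.2.1 (mval j.2.2)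
  | inr l => formal_deriv j.1 (s l) j.2.1 (mval j.2.2)
  end.
have frameE z (a : ('I_n * 'I_d) + 'I_r -> R) j : \sum_l a l * frame z l j =
    (\sum_b a (inl (j.1, b)) *: e b z +
     formal_deriv j.1 (\sum_l a (inr l) *: s l)) j.2.1 (mval j.2.2).
  rewrite big_sumType /= jetDE formal_deriv_sum !jet_sumE; congr (_ + _).
  transitivity (\sum_p \sum_b a (inl (p, b)) * ((j.1 == p)%:R *
      e b z j.2.1 (mval j.2.2))).
    by rewrite pair_bigA; apply: eq_bigr => -[p b].
  rewrite (bigD1 j.1) //= [X in _ + X]big1 ?addr0.
    by apply: eq_bigr => b _; rewrite eqxx mul1r.
  move=> p pj; apply: big1 => b _.
  by rewrite eq_sym (negbTE pj) mul0r mulr0.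
have [a Ha] : exists a : ('I_n * 'I_d) + 'I_r -> R, forall j : 'I_n * ('I_n * mbox n q),
    jet_partial i (fun z => rho z (fun=> j.1)) y j.2.1 (mval j.2.2) =
    \sum_l a l * frame y l j.
  apply: (@span_limit _ R (0^') _ _ _ (fun h => frame (h *: ('e_i : pt) + y)) (frame y)
    (fun h j => h^-1 *: (rho (h *: ('e_i : pt) + y) (fun=> j.1) j.2.1 (mval j.2.2)
       - rho y (fun=> j.1) j.2.1 (mval j.2.2)))).
  - move=> [p|l] j; last exact: cvg_cst.
    apply: cvgM; first exact: cvg_cst.
    have c := smooth_continuous ((je p.2).1 j.2.1 (mval j.2.2)) V0y.
    exact: (cvg_comp _ _ path c).
  - move=> j; exact: (smooth_derivable (i := i) ((srho j.1).1 j.2.1 (mval j.2.2)) Vy).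
  - move=> a a0.
    have jE j : \sum_b a (inl (j, b)) *: e b y = - formal_deriv j (\sum_l a (inr l) *: s l).
      apply/eqP; rewrite -addr_eq0; apply/eqP; apply: (@eq_jet _ _ q) => [|//|k b].
        apply: is_jetD.
          by apply: is_jet_sum => l; apply: is_jetZ; case: (je l) => _; apply.
        apply/symbol_jet/formal_deriv_symbol/is_symbol_sum => l.
        exact/is_symbolZ.
      by rewrite -(frameE y a (j, (k, b))) a0.
    (* A vanishing combination puts delta of the s-part into T^* (x) R_q, hence the s-part into
       g_{q+1}(y), which the complement meets only in 0. *)
    have ar0 : forall l, a (inr l) = 0.
      apply: sindep; apply/(prolongation_symbol subE oW Wy).
        by apply: is_symbol_sum => l; exact: is_symbolZ.
      move=> j; rewrite -[formal_deriv _ _]opprK -jE; apply: (subbundleN subE Wy).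
      by have [_ ->] := Ee y V0y; exists (fun b => a (inl (j, b))).
    have s0 : \sum_l a (inr l) *: s l = 0 by rewrite big1 // => l _; rewrite ar0 scale0r.
    move=> [[j b]|l]; last exact: ar0.
    have [indep _] := Ee y V0y; apply: (indep (fun b => a (inl (j, b)))).
    by rewrite jE s0 oppr0.
  - apply: filterS nearV => h; set z := _ + y => -[[Vz V0z] [V1z Wz]].
    have [B [S [EB symS rhoE]]] := (janet_den1P _ _).1 (drho z Vz).
    (* S is split into a combination of the s_l and an element u of g_{q+1}(z); delta u is
       R_q-valued and is absorbed into B. *)
    have [c Pu] := sspan z V1z S symS; set u := _ - _ in Pu.
    have symu : is_symbol q.+1 u.
      apply: is_symbolD => //; rewrite -scaleN1r; apply: is_symbolZ.
      by apply: is_symbol_sum => l; exact: is_symbolZ.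
    have EBu j : exists b : 'I_d -> R, \sum_l b l *: e l z = B j + formal_deriv j u.
      have : E z (B j + formal_deriv j u).
        apply: (subbundleD subE Wz) => //.
        exact: ((prolongation_symbol subE oW Wz symu).1 Pu).
      by have [_ ->] := Ee z V0z => -[b _ <-]; exists b.
    have [b bE] := choice EBu.
    exists (fun l => h^-1 * match l with inl p => b p.1 p.2 | inr l => c l end) => j.
    under eq_bigr do rewrite -mulrA.
    rewrite -mulr_sumr (frameE z (fun l => match l with inl p => b p.1 p.2 | inr l => c l end)).
    rewrite /= bE rho0 jet0E subr0 rhoE -addrA -formal_derivD subrK.
    by [].
apply/janet_den1P; exists (fun j => \sum_b a (inl (j, b)) *: e b y),
  (\sum_l a (inr l) *: s l); split.
- by move=> j; have [_ ->] := Ee y V0y; exists (fun b => a (inl (j, b))).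
- by apply: is_symbol_sum => l; exact: is_symbolZ.
- move=> j; apply: (@eq_jet _ _ q) => [||k b].
  + exact: (jet_partial_jet i oV Vy (srho j).2).
  + apply: is_jetD.
      by apply: is_jet_sum => l; apply: is_jetZ; case: (je l) => _; apply.
    apply/symbol_jet/formal_deriv_symbol/is_symbol_sum => l.
    exact/is_symbolZ.
  + by rewrite (Ha (j, (k, b))) frameE.
Qed.

End JanetDenominator.

(** * Denominators, brackets and torsion on coordinate vectors *)

Section CartanDeformations.
Variables (R : realType) (n q : nat).
Local Notation pt := 'rV[R]_n.
Local Notation jet := (jet R n).
Local Notation jform := (jform R n).
Variables (W : set pt) (E : pt -> set jet).
Local Notation P := (prolongation q 1 E).
Local Notation den1 := (den1 q).
Hypothesis q_gt0 : (0 < q)%N.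
Hypothesis oW : open W.
Hypothesis subE : vector_subbundle q W E.
Hypothesis subP : vector_subbundle q.+1 W P.
Hypothesis liftE : forall y x, W y -> E y x -> exists2 x', P y x' & jproj q x' = x.
Hypothesis lieE : local_lie_equations q W E.

Definition pair_index (i j : 'I_n) : 'I_2 -> 'I_n := fun a => if a == ord0 then i else j.

Lemma pair_indexE (s : 'I_2 -> 'I_n) : s = pair_index (s ord0) (s ord_max).
Proof.
apply/funext => a; rewrite /pair_index; case: eqP => [->//|/eqP a0].
by congr s; apply/val_inj; case: a a0 => -[|[|//]].
Qed.

Definition den2 (G : set jet) (A : 'I_n -> 'I_n -> jet) : Prop := exists B T,
  [/\ forall i j, G (B i j), forall i j, B i j = - B j i,
    forall i, is_symbol q.+1 (T i) &
    forall i j, A i j = B i j + formal_deriv i (T j) - formal_deriv j (T i)].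

Lemma delta1E (T : jform 1) i j :
  delta T (pair_index i j) = formal_deriv i (T (fun=> j)) - formal_deriv j (T (fun=> i)).
Proof.
apply: jetP => k m; rewrite /delta !big_ord_recl big_ord0 addr0 expr0 mul1r.
rewrite expr1 mulN1r jetDE jetNE /formal_deriv.
congr (T _ k _ - T _ k _). apply/funext => a.
rewrite /pair_index /= (_ : lift (lift ord0 ord0 : 'I_2) a = ord0) ?eqxx //.
by apply/val_inj; case: a => -[].
Qed.

Lemma janet_den2P (G : set jet) (A : jform 2) :
  janet_den q 1 G A <-> den2 G (fun i j => A (pair_index i j)).
Proof.
have swap i j : pair_index i j \o tperm ord0 ord_max = pair_index j i.
  rewrite [LHS]pair_indexE; congr pair_index.
    by rewrite /= tpermL.
  by rewrite /= tpermR.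
split=> [[B [S [[altB GB] [_ symS] ->]]]|[B [T [GB altB symT AE]]]].
  exists (fun i j => B (pair_index i j)), (fun i => S (fun=> i)); split.
  - by move=> i j; exact: GB.
  - by move=> i j; rewrite -(altB _ ord0 ord_max) // swap.
  - by move=> i; exact: symS.
  - by move=> i j; rewrite -addrA -delta1E.
exists (fun s => B (s ord0) (s ord_max)), (fun s => T (s ord0)); split.
- split=> [s a b ab|s]; last exact: GB.
  rewrite /= altB; congr (- B (s _) (s _)).
    by case: a b ab => -[|[|//]] ? [[|[|//]]] ? // _; rewrite permE /=; apply/val_inj; rewrite /= ?permE.
  by case: a b ab => -[|[|//]] ? [[|[|//]]] ? // _; rewrite permE /=; apply/val_inj.
- by split; [exact: alternating1|move=> s; exact: symT].
- apply/funext => s; rewrite {1}(pair_indexE s) AE -addrA; congr (_ + _).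
  by rewrite [in RHS](pair_indexE s) delta1E.
Qed.

Section AtPoint.
Variable y : pt.
Hypothesis Wy : W y.

Lemma den1D A A' : den1 (E y) A -> den1 (E y) A' -> den1 (E y) (fun i => A i + A' i).
Proof.
move=> [B [S [EB sS AE]]] [B' [S' [EB' sS' AE']]].
exists (fun i => B i + B' i), (S + S'); split.
- by move=> i; apply: (subbundleD subE Wy).
- exact: is_symbolD.
- by move=> i; rewrite AE AE' formal_derivD addrACA.
Qed.

Lemma den1Z c A : den1 (E y) A -> den1 (E y) (fun i => c *: A i).
Proof.
move=> [B [S [EB sS AE]]].
exists (fun i => c *: B i), (c *: S); split.
- by move=> i; apply: (subbundleZ subE _ Wy).
- exact: is_symbolZ.
- by move=> i; rewrite AE formal_derivZ scalerDr.
Qed.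

Lemma den1_in A : (forall i, E y (A i)) -> den1 (E y) A.
Proof.
by move=> EA; exists A, 0; split => // i; rewrite [formal_deriv _ _]/(0 : jet) addr0.
Qed.

Lemma den1_symbol S : is_symbol q.+1 S -> den1 (E y) (fun i => formal_deriv i S).
Proof.
move=> sS; exists (fun=> 0), S; split => // i; first exact: (subbundle0 subE).
by rewrite add0r.
Qed.

Lemma den1_sum (I : Type) (r : seq I) (A : I -> 'I_n -> jet) :
  (forall l, den1 (E y) (A l)) -> den1 (E y) (fun i => \sum_(l <- r) A l i).
Proof.
move=> dA; elim: r => [|l r IH].
  by under eq_fun do rewrite big_nil; apply: den1_in => i; exact: (subbundle0 subE).
by under eq_fun do rewrite big_cons; exact: den1D.
Qed.

Lemma den2D A A' : den2 (E y) A -> den2 (E y) A' -> den2 (E y) (fun i j => A i j + A' i j).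
Proof.
move=> [B [T [EB aB sT AE]]] [B' [T' [EB' aB' sT' AE']]].
exists (fun i j => B i j + B' i j), (fun i => T i + T' i); split.
- by move=> i j; apply: (subbundleD subE Wy).
- by move=> i j; rewrite aB aB' -opprD.
- by move=> i; exact: is_symbolD.
- move=> i j; rewrite AE AE' !formal_derivD.
  by apply: jetP => k m; rewrite !(jetDE, jetNE); ring.
Qed.

Lemma den2N A : den2 (E y) A -> den2 (E y) (fun i j => - A i j).
Proof.
move=> [B [T [EB aB sT AE]]].
exists (fun i j => - B i j), (fun i => - T i); split.
- by move=> i j; apply: (subbundleN subE Wy).
- by move=> i j; rewrite aB.
- by move=> i; rewrite -scaleN1r; exact: is_symbolZ.
- move=> i j; rewrite AE !formal_derivN.
  by apply: jetP => k m; rewrite !(jetDE, jetNE); ring.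
Qed.

Definition family_over_id (K : 'I_n -> jet) : Prop :=
  forall i k, K i k mzero = (k == i)%:R.

Lemma sum_over_id (K : 'I_n -> jet) i (F : 'I_n -> jet) : family_over_id K ->
  \sum_l K i l mzero *: F l = F i.
Proof.
move=> Kid; rewrite (bigD1 i) //= Kid eqxx scale1r big1 ?addr0 // => l li.
by rewrite Kid (negbTE li) scale0r.
Qed.

(** For a family over the identity this is the l-th component of {chi_1(d_i), chi_1(d_j)}, by
    [alg_bracket0E]. It is linear in K, which the linearization uses. *)
Definition torsion (K : 'I_n -> jet) (i j l : 'I_n) : R :=
  K j l (munit i) - K i l (munit j).

(** Adding delta S changes the first-order entries by S at 1_i + 1_j, which is symmetric in i and j.
    That q >= 1 makes these entries visible in the projections to order q. *)
Lemma torsion_symbol (K K' : 'I_n -> jet) S i j l :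
  (forall i, is_jet q.+1 (K i)) -> (forall i, is_jet q.+1 (K' i)) ->
  (forall i, jproj q (K' i) = jproj q (K i) + formal_deriv i S) ->
  torsion K' i j l = torsion K i j l.
Proof.
move=> jK jK' KS.
have E1 a b : K' a l (munit b) = K a l (munit b) + S l (madd (munit b) (munit a)).
  have := congr1 (fun x : jet => x l (munit b)) (KS a).
  by rewrite jetDE /jproj mdeg_unit q_gt0.
rewrite /torsion !E1.
have -> : madd (munit j) (munit i) = madd (munit i) (munit j).
  by apply/ffunP => b; rewrite !ffunE addnC.
by ring.
Qed.

(** The polarization of [half_bracket1]: the coefficient of t in its value at K + t A
    ([half_bracket_quadratic]). *)
Definition linear_bracket (K A : 'I_n -> jet) (i j : 'I_n) : jet :=
  alg_bracket q (K i) (A j) - alg_bracket q (K j) (A i)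
  - \sum_l torsion A i j l *: jproj q (K l) - \sum_l torsion K i j l *: jproj q (A l).

Definition half_bracket1 (K : 'I_n -> jet) (i j : 'I_n) : jet :=
  alg_bracket q (K i) (K j) - \sum_l torsion K i j l *: jproj q (K l).

(** Antisymmetrize [alg_bracket_formal_deriv]: the second derivatives of S are symmetric and cancel,
    leaving a delta term and the torsion. The scalar c is 1 for families over the identity and 0 for
    families over zero; both are needed. *)
Lemma alg_bracket_family (Q : 'I_n -> jet) S c i j : is_symbol q.+1 S ->
  (forall i k, Q i k mzero = c * (k == i)%:R) ->
  alg_bracket q (Q i) (formal_deriv j S) - alg_bracket q (Q j) (formal_deriv i S) =
  formal_deriv j (top_bracket q (Q i) S) - formal_deriv i (top_bracket q (Q j) S)
  + \sum_l torsion Q i j l *: formal_deriv l S.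
Proof.
move=> sS Qc.
have E1 a b : \sum_l Q a l mzero *: formal_deriv l (formal_deriv b S) =
    c *: formal_deriv a (formal_deriv b S).
  rewrite (bigD1 a) //= Qc eqxx mulr1 big1 ?addr0 // => l la.
  by rewrite Qc (negbTE la) mulr0 scale0r.
have E2 : \sum_l torsion Q i j l *: formal_deriv l S =
    \sum_l Q j l (munit i) *: formal_deriv l S - \sum_l Q i l (munit j) *: formal_deriv l S.
  by rewrite -sumrB; apply: eq_bigr => l _; rewrite scalerBl.
rewrite !alg_bracket_formal_deriv // !E1 E2 (formal_derivC j i).
by apply: jetP => k m; rewrite !(jetDE, jetNE); ring.
Qed.

Lemma alg_bracket_symbol_id (K : 'I_n -> jet) i s : family_over_id K ->
  is_symbol q.+1 s -> alg_bracket q (K i) s = formal_deriv i s.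
Proof. by move=> Kid ss; rewrite alg_bracket_symbol // sum_over_id. Qed.

Lemma alg_bracket_symbol0 (x s : jet) : (forall k, x k mzero = 0) ->
  is_symbol q.+1 s -> alg_bracket q x s = 0.
Proof.
by move=> x0 ss; rewrite alg_bracket_symbol // big1 // => l _; rewrite x0 scale0r.
Qed.

(** * Dependence of the brackets on representatives *)

Section ChangeOfRepresentative.
Variables (K K' : 'I_n -> jet) (S : jet).
Hypothesis PK : forall i, P y (K i).
Hypothesis Kid : family_over_id K.
Hypothesis jK' : forall i, is_jet q.+1 (K' i).
Hypothesis symS : is_symbol q.+1 S.
Hypothesis K'E : forall i, jproj q (K' i) = jproj q (K i) + formal_deriv i S.

Let jetK i : is_jet q.+1 (K i).
Proof. exact: prolongation1_jet (PK i). Qed.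

Let jet_dS i : is_jet q (formal_deriv i S).
Proof. exact/symbol_jet/formal_deriv_symbol. Qed.

Let remainder : exists sigma : 'I_n -> jet, [/\ forall i, is_symbol q.+1 (sigma i),
  forall i k, sigma i k mzero = 0 & forall i, K' i = K i + formal_deriv i S + sigma i].
Proof.
have symr i : is_symbol q.+1 (K' i - K i - formal_deriv i S).
  apply: symbol_jproj0.
    apply: is_jetD; last by rewrite -scaleN1r; apply/is_jetZ/jetS.
    by apply: is_jetD => //; rewrite -scaleN1r; exact: is_jetZ.
  by rewrite !jprojD !jprojN K'E (jproj_id (jet_dS i)) addrAC addrK subrr.
exists (fun i => K' i - K i - formal_deriv i S); split => // [i k|i].
  by apply: (symr i); rewrite mdeg_mzero.
by apply: jetP => k m; rewrite !(jetDE, jetNE); ring.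
Qed.

Let dS0 i k : formal_deriv i S k mzero = 0.
Proof. by apply: symS; rewrite add0m mdeg_unit ltn_eqF. Qed.

(** Expand with K' = K + delta S + sigma. The terms in K alone are in R_q by [prolongation_bracket];
    brackets with sigma add up to delta sigma; those with delta S give a delta term and a torsion
    term, which cancels the change of chi_q in the second summand. *)
Lemma half_bracket_den : den2 (E y) (half_bracket1 K').
Proof.
have [sigma [sym_sigma sigma0 K'sum]] := remainder.
(* The factor 1/2 makes {Q_i, d_j S} - {Q_j, d_i S} contain {d_i S, d_j S} exactly once, so
   [alg_bracket_family] handles the linear and quadratic terms in S together. *)
pose Q i : jet := K i + 2%:R^-1 *: formal_deriv i S.
have Qid i k : Q i k mzero = 1 * (k == i)%:R.
  by rewrite /Q jetDE jetZE dS0 mulr0 addr0 mul1r Kid.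
pose T i : jet := sigma i - top_bracket q (Q i) S.
pose B i j : jet := alg_bracket q (K i) (K j) - \sum_l torsion K i j l *: jproj q (K l).
exists B, T; split.
- move=> i j; apply: (subbundleD subE Wy).
    exact: (prolongation_bracket subE oW subP lieE Wy).
  apply: (subbundleN subE Wy); apply: (subbundle_sum subE Wy) => l.
  by apply: (subbundleZ subE _ Wy); exact: prolongation1_jproj.
- move=> i j; rewrite /B alg_bracketC opprD; congr (_ - _).
  rewrite -sumrN; apply: eq_bigr => l _.
  by rewrite -scaleNr /torsion opprB.
- move=> i; apply: is_symbolD => //; rewrite -scaleN1r.
  exact/is_symbolZ/top_bracket_symbol.
- move=> i j; rewrite /half_bracket1.
  have -> : \sum_l torsion K' i j l *: jproj q (K' l) =
      \sum_l torsion K i j l *: jproj q (K l) + \sum_l torsion K i j l *: formal_deriv l S.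
    rewrite -big_split; apply: eq_bigr => l _ /=.
    by rewrite (torsion_symbol i j l jetK jK' K'E) K'E scalerDr.
  have -> : \sum_l torsion K i j l *: formal_deriv l S =
      \sum_l torsion Q i j l *: formal_deriv l S.
    apply: eq_bigr => l _; congr (_ *: _); rewrite /torsion /Q !jetDE !jetZE /formal_deriv.
    have -> : madd (munit j) (munit i) = madd (munit i) (munit j).
      by apply/ffunP => b; rewrite !ffunE addnC.
    by ring.
  have QS := alg_bracket_family i j symS Qid.
  have -> : \sum_l torsion Q i j l *: formal_deriv l S =
    alg_bracket q (Q i) (formal_deriv j S) - alg_bracket q (Q j) (formal_deriv i S)
    - formal_deriv j (top_bracket q (Q i) S) + formal_deriv i (top_bracket q (Q j) S).
    by rewrite QS; apply: jetP => k m; rewrite !(jetDE, jetNE); ring.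
  rewrite !K'sum !alg_bracketDl !alg_bracketDr !alg_bracketZl.
  rewrite (alg_bracketC _ (sigma i) (K j)) (alg_bracketC _ (sigma i) (formal_deriv j S)).
  rewrite !(alg_bracket_symbol_id _ Kid (sym_sigma _)).
  rewrite !(alg_bracket_symbol0 (dS0 _) (sym_sigma _)).
  rewrite !(alg_bracket_symbol0 (sigma0 _) (sym_sigma _)).
  rewrite (alg_bracketC _ (formal_deriv i S) (K j)).
  rewrite (alg_bracketC _ (formal_deriv j S) (formal_deriv i S)).
  rewrite /T /B !(formal_derivD, formal_derivN).
  by apply: jetP => k m; rewrite !(jetDE, jetNE, jetZE, jet0E); field.
Qed.

(** As A lies over zero, sigma drops out. The bracket of delta S with A is a delta term plus the
    torsion of A contracted with delta S, and the latter cancels the change of the K_l. *)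
Lemma linear_bracket_den (A : 'I_n -> jet) : (forall i k, A i k mzero = 0) ->
  den2 (E y) (fun i j => linear_bracket K' A i j - linear_bracket K A i j).
Proof.
move=> A0; have [sigma [sym_sigma sigma0 K'sum]] := remainder.
exists (fun _ _ => 0), (fun i => - top_bracket q (A i) S); split.
- by move=> _ _; exact: (subbundle0 subE).
- by move=> _ _; rewrite oppr0.
- by move=> i; rewrite -scaleN1r; exact/is_symbolZ/top_bracket_symbol.
- move=> i j; rewrite /linear_bracket.
  have -> : \sum_l torsion A i j l *: jproj q (K' l) =
      \sum_l torsion A i j l *: jproj q (K l) + \sum_l torsion A i j l *: formal_deriv l S.
    by rewrite -big_split; apply: eq_bigr => l _ /=; rewrite K'E scalerDr.
  under [X in _ - _ - _ - X - _]eq_bigr do rewrite (torsion_symbol i j _ jetK jK' K'E).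
  have Ac a k : A a k mzero = 0 * (k == a)%:R by rewrite mul0r A0.
  have -> : \sum_l torsion A i j l *: formal_deriv l S =
    alg_bracket q (A i) (formal_deriv j S) - alg_bracket q (A j) (formal_deriv i S)
    - formal_deriv j (top_bracket q (A i) S) + formal_deriv i (top_bracket q (A j) S).
    rewrite (alg_bracket_family i j symS Ac).
    by apply: jetP => k m; rewrite !(jetDE, jetNE); ring.
  rewrite !K'sum !alg_bracketDl.
  rewrite (alg_bracketC _ (sigma i)) (alg_bracketC _ (sigma j)).
  rewrite !(alg_bracket_symbol0 (A0 _) (sym_sigma _)) (alg_bracketC _ (formal_deriv i S) (A j)).
  rewrite (alg_bracketC _ (formal_deriv j S) (A i)) !formal_derivN.
  by apply: jetP => k m; rewrite !(jetDE, jetNE, jet0E); ring.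
Qed.

End ChangeOfRepresentative.
End AtPoint.

(** * The formal Lie derivative on representatives of classes *)

(** [lie_form] in degree 1. Here xi enters only through its value at y, whereas A must be known near
    y. *)
Definition lie_family (y : pt) (xi : jet) (A : 'I_n -> pt -> jet) (j : 'I_n) : jet :=
  alg_bracket q xi (A j y) + \sum_i xi i mzero *: spencer_jet q (A j) i y
  + \sum_l xi l (munit j) *: jproj q (A l y).

Lemma lie_form1E (xi : pt -> jet) (A : pt -> jform 1) y j :
  lie_form q xi A y (fun=> j) = lie_family y (xi y) (fun l z => A z (fun=> l)) j.
Proof.
rewrite /lie_form big_ord1; congr (_ + _); apply: eq_bigr => l _.
by congr (_ *: jproj q (A y _)); apply/funext => a; rewrite ord1 eqxx.
Qed.

Lemma spencer_jetD V (a b : pt -> jet) i y : V y ->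
  (forall k m, smooth V (fun z => a z k m)) -> (forall k m, smooth V (fun z => b z k m)) ->
  spencer_jet q (fun z => a z + b z) i y = spencer_jet q a i y + spencer_jet q b i y.
Proof.
move=> Vy sa sb; apply: jetP => k m; rewrite jetDE /spencer_jet.
case: ifP => _; last by rewrite addr0.
by rewrite (partialD i (sa k m) (sb k m) Vy) jetDE opprD addrACA.
Qed.

Lemma spencer_jetZ V c (a : pt -> jet) i y : V y ->
  (forall k m, smooth V (fun z => a z k m)) ->
  spencer_jet q (fun z => c *: a z) i y = c *: spencer_jet q a i y.
Proof.
move=> Vy sa; apply: jetP => k m; rewrite jetZE /spencer_jet.
case: ifP => _; last by rewrite mulr0.
by rewrite (partialZ c i (sa k m) Vy) jetZE mulrBr.
Qed.

Lemma spencer_jet_sum V (I : Type) (r : seq I) (a : I -> pt -> jet) i y : open V -> V y ->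
  (forall l k m, smooth V (fun z => a l z k m)) ->
  spencer_jet q (fun z => \sum_(l <- r) a l z) i y = \sum_(l <- r) spencer_jet q (a l) i y.
Proof.
move=> oV Vy sa; elim: r => [|l r IH].
  rewrite big_nil; under eq_fun do rewrite big_nil; apply: jetP => k m.
  by rewrite /spencer_jet partial_cst subrr if_same.
under eq_fun do rewrite big_cons; rewrite big_cons (spencer_jetD i Vy (sa l)) ?IH // => k m.
by under eq_fun do rewrite jet_sumE; exact: smooth_sum.
Qed.

Lemma spencer_jet_symbol (x : jet) i y : is_symbol q x -> spencer_jet q (fun=> x) i y = - formal_deriv i x.
Proof.
move=> sx; apply: jetP => k m; rewrite jetNE /spencer_jet /formal_deriv.
case: leqP => mq; first by rewrite partial_cst sub0r.
by rewrite sx ?oppr0 // mdeg_maddU gtn_eqF // ltnW.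
Qed.

Lemma lie_familyD V y xi (A A' : 'I_n -> pt -> jet) j : V y ->
  (forall l k m, smooth V (fun z => A l z k m)) ->
  (forall l k m, smooth V (fun z => A' l z k m)) ->
  lie_family y xi (fun l z => A l z + A' l z) j = lie_family y xi A j + lie_family y xi A' j.
Proof.
move=> Vy sA sA'; rewrite /lie_family alg_bracketDr.
have -> : \sum_i xi i mzero *: spencer_jet q (fun z => A j z + A' j z) i y =
    \sum_i xi i mzero *: spencer_jet q (A j) i y + \sum_i xi i mzero *: spencer_jet q (A' j) i y.
  rewrite -big_split; apply: eq_bigr => i _.
  by rewrite (spencer_jetD i Vy (sA j) (sA' j)) scalerDr.
have -> : \sum_l xi l (munit j) *: jproj q (A l y + A' l y) =
    \sum_l xi l (munit j) *: jproj q (A l y) + \sum_l xi l (munit j) *: jproj q (A' l y).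
  by rewrite -big_split; apply: eq_bigr => l _; rewrite jprojD scalerDr.
by apply: jetP => k m; rewrite !jetDE; ring.
Qed.

(** Replace xi by a lift xi' in R_{q+1}: all terms are then in R_q. The correction tau = xi' - xi is
    a symbol and contributes delta tau, since K lies over the identity. *)
Lemma lie_family_prolongation y V xi (K : 'I_n -> pt -> jet) : W y -> open V -> V y ->
  is_jet q.+1 xi -> E y (jproj q xi) ->
  (forall l, jet_section q.+1 V (K l)) -> (forall l z, V z -> P z (K l z)) ->
  family_over_id (fun l => K l y) -> den1 (E y) (lie_family y xi K).
Proof.
move=> Wy oV Vy jxi Exi sK PK Kid.
have [xi' Pxi' xi'E] := liftE Wy Exi; pose tau : jet := xi' - xi.
have symtau : is_symbol q.+1 tau.
  apply: symbol_jproj0; last by rewrite jprojD jprojN xi'E subrr.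
  apply: is_jetD; first exact: prolongation1_jet Pxi'.
  by rewrite -scaleN1r; exact: is_jetZ.
exists (fun j => alg_bracket q xi' (K j y) + \sum_i xi i mzero *: spencer_jet q (K j) i y
  + \sum_l xi l (munit j) *: jproj q (K l y)), tau; split => // [j|j].
  apply: (subbundleD subE Wy); [apply: (subbundleD subE Wy)|].
  - exact: (prolongation_bracket subE oW subP lieE Wy Pxi' (PK _ _ Vy)).
  - apply: (subbundle_sum subE Wy) => i; apply: (subbundleZ subE _ Wy).
    apply: (spencer_prolongation subE oW i Wy oV Vy (sK j)) => // [z Vz|].
      exact: (prolongation1_jproj (PK j z Vz)).
    exact: PK.
  - apply: (subbundle_sum subE Wy) => l; apply: (subbundleZ subE _ Wy).
    exact: (prolongation1_jproj (PK l y Vy)).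
rewrite -(alg_bracket_symbol_id j Kid symtau) /lie_family.
have -> : xi' = xi + tau by rewrite addrC subrK.
rewrite alg_bracketDl (alg_bracketC _ tau).
by apply: jetP => k m; rewrite !(jetDE, jetNE); ring.
Qed.

(** The D term and the Leibniz term cancel the two extra terms of [alg_bracket_formal_deriv], so
    what is left is delta of the top bracket. *)
Lemma lie_family_symbol y xi S : W y -> is_symbol q.+1 S ->
  den1 (E y) (lie_family y xi (fun l _ => formal_deriv l S)).
Proof.
move=> Wy symS.
have -> : lie_family y xi (fun l _ => formal_deriv l S) =
    fun j => formal_deriv j (top_bracket q xi S).
  apply/funext => j; rewrite /lie_family alg_bracket_formal_deriv //.
  have sd l : is_symbol q (formal_deriv l S) by exact: formal_deriv_symbol.
  under [X in _ + X + _]eq_bigr do rewrite (spencer_jet_symbol _ _ (sd j)) scalerN.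
  under [X in _ + X]eq_bigr do rewrite (jproj_id (symbol_jet (sd _))).
  by rewrite sumrN addrAC subrK addrK.
exact/(den1_symbol Wy)/top_bracket_symbol.
Qed.

(** At y the A_j are symbols, so {xi, A_j} cancels the shift in D A_j and the Leibniz term is zero.
    There remains the derivative of the projected section along xi, which [janet_den_partial]
    controls. *)
Lemma lie_family_vanishing y V xi (A : 'I_n -> pt -> jet) : W y -> open V -> V y ->
  (forall l, jet_section q.+1 V (A l)) ->
  (forall z, V z -> den1 (E z) (fun l => jproj q (A l z))) ->
  (forall l, jproj q (A l y) = 0) -> den1 (E y) (lie_family y xi A).
Proof.
move=> Wy oV Vy sA dA A0.
have -> : lie_family y xi A =
    fun j => \sum_i xi i mzero *: jet_partial i (fun z => jproj q (A j z)) y.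
  apply/funext => j; rewrite /lie_family.
  have symA : is_symbol q.+1 (A j y) by apply: symbol_jproj0 => //; exact: (sA j).2.
  rewrite (alg_bracket_symbol _ symA) [X in _ + X]big1 ?addr0 => [|l _]; last first.
    by rewrite A0 scaler0.
  rewrite -big_split; apply: eq_bigr => i _ /=; rewrite -scalerDr; congr (_ *: _).
  apply: jetP => k m; rewrite jetDE /spencer_jet /formal_deriv /jet_partial /jproj.
  case: (leqP (mdeg m) q) => mq; first by rewrite addrC subrK.
  by rewrite partial_cst addr0 symA // mdeg_maddU gtn_eqF.
apply: (den1_sum Wy) => i; apply: (den1Z Wy).
apply/(janet_den1P q (E y) (fun s => jet_partial i (fun z => jproj q (A (s ord0) z)) y)).
apply: (janet_den_partial oW subE subP liftE i Wy oV Vy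
  (rho := fun z s => jproj q (A (s ord0) z))) => [j|z Vz|s].
- exact: jet_section_proj.
- by apply/janet_den1P; exact: dA.
- exact: A0.
Qed.

Lemma lie_family_connection y V xi (chi A : 'I_n -> pt -> jet) :
  W y -> open V -> V y -> V `<=` W -> is_jet q.+1 xi -> E y (jproj q xi) ->
  (forall l z, V z -> E z (chi l z)) -> (forall l, jet_section q.+1 V (A l)) ->
  (forall z, V z -> den1 (E z) (fun l => jproj q (A l z) - chi l z)) ->
  family_over_id (fun l => A l y) -> den1 (E y) (lie_family y xi A).
Proof.
move=> Wy oV Vy VW jxi Exi Echi sA dA Aid.
have [B [S [EB symS BS]]] := dA y Vy.
have /choice[K0 K0P] : forall j, exists x, P y x /\ jproj q x = chi j y + B j.
  move=> j; have [|x] := liftE Wy (x := chi j y + B j); last by exists x.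
  by apply: (subbundleD subE Wy) => //; exact: Echi.
have [V1 [ext [oV1 V1y extP]]] := subbundle_extend subP Wy.
pose K j := ext (K0 j); pose V2 := V `&` V1.
have oV2 : open V2 by exact: openI.
have V2y : V2 y by [].
have sub1 : V2 `<=` V by move=> z [].
have sub2 : V2 `<=` V1 by move=> z [].
have sA2 j := jet_section_sub sub1 (sA j).
have sK j : jet_section q.+1 V2 (K j).
  by have [s _ _] := extP _ (K0P j).1; exact: jet_section_sub sub2 s.
have PK j z : V2 z -> P z (K j z).
  by move=> [_ V1z]; have [_ + _] := extP _ (K0P j).1; apply.
have Ky j : K j y = K0 j by have [_ _] := extP _ (K0P j).1.
have dS0 j k : formal_deriv j S k mzero = 0.
  by apply: symS; rewrite add0m mdeg_unit ltn_eqF.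
have jdS j : is_jet q (formal_deriv j S) by exact/symbol_jet/formal_deriv_symbol.
have Kq j : jproj q (K j y) = jproj q (A j y) - formal_deriv j S.
  rewrite Ky (K0P j).2; have := BS j => /eqP; rewrite subr_eq => /eqP ->.
  by apply: jetP => k m; rewrite !(jetDE, jetNE); ring.
have Kid : family_over_id (fun j => K j y).
  move=> j k; have := congr1 (fun x : jet => x k mzero) (Kq j).
  by rewrite jetDE jetNE dS0 subr0 /jproj mdeg_mzero /= Aid.
(* K and S are chosen so that the q-jet part of this remainder is zero at y, while near y it stays
   in the denominator. *)
pose sigma j z : jet := A j z - K j z - formal_deriv j S.
have sdS j : jet_section q.+1 V2 (fun=> formal_deriv j S).
  by apply: jet_section_cst => //; exact: jetS.
have ssig j : jet_section q.+1 V2 (sigma j).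
  have := jet_sectionD oV2 (sA2 j) (jet_sectionD oV2 (jet_sectionZ (-1) oV2 (sK j))
     (jet_sectionZ (-1) oV2 (sdS j))).
  congr (jet_section q.+1 V2 _); apply/funext => z.
  by rewrite /sigma !scaleN1r addrA.
have -> : lie_family y xi A = lie_family y xi (fun j z => (K j z + formal_deriv j S) + sigma j z).
  congr (lie_family y xi _); apply/funext => j; apply/funext => z.
  by apply: jetP => k m; rewrite /sigma !(jetDE, jetNE); ring.
have -> : lie_family y xi (fun j z => (K j z + formal_deriv j S) + sigma j z) =
    fun j => (lie_family y xi K j + lie_family y xi (fun l _ => formal_deriv l S) j)
      + lie_family y xi sigma j.
  apply/funext => j; rewrite (@lie_familyD V2 _ _ (fun l z => K l z + formal_deriv l S)) //.
  - by rewrite (@lie_familyD V2 _ _ K) // => l; [exact: (sK l).1|exact: (sdS l).1].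
  - by move=> l; exact: (jet_sectionD oV2 (sK l) (sdS l)).1.
  - by move=> l; exact: (ssig l).1.
apply: (den1D Wy); first apply: (den1D Wy).
- exact: (lie_family_prolongation Wy oV2 V2y jxi Exi sK PK Kid).
- exact: lie_family_symbol.
- apply: (lie_family_vanishing xi Wy oV2 V2y ssig) => [z V2z|l].
    have Wz : W z by apply: VW; exact: sub1.
    have -> : (fun l => jproj q (sigma l z)) = (fun l => (jproj q (A l z) - chi l z) +
        (chi l z - jproj q (K l z) + formal_deriv l (- S))).
      apply/funext => l; rewrite /sigma !jprojD !jprojN (jproj_id (jdS l)) formal_derivN.
      by apply: jetP => k m; rewrite !(jetDE, jetNE); ring.
    apply: (den1D Wz); first by apply: dA; exact: sub1.
    apply: (den1D Wz).
      apply: den1_in => l; apply: (subbundleD subE Wz); first by apply: Echi; exact: sub1.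
      by apply: (subbundleN subE Wz); apply: prolongation1_jproj; exact: PK.
    by apply: (den1_symbol Wz); rewrite -scaleN1r; exact: is_symbolZ.
  rewrite /sigma !jprojD !jprojN (jproj_id (jdS l)) Kq opprB addrCA subrr addr0.
  by rewrite subrr.
Qed.

Definition spencer_family (A : 'I_n -> pt -> jet) (y : pt) (i j : 'I_n) : jet :=
  spencer_jet q (A j) i y - spencer_jet q (A i) j y.

Lemma spencer1E (A : pt -> jform 1) y i j :
  spencer q A y (pair_index i j) = spencer_family (fun l z => A z (fun=> l)) y i j.
Proof.
rewrite /spencer !big_ord_recl big_ord0 addr0 expr0 scale1r expr1 scaleN1r.
rewrite (_ : pair_index i j \o lift ord0 = fun=> j); last by apply/funext => a.
rewrite (_ : pair_index i j \o lift (lift ord0 ord0) = fun=> i) //; apply/funext => a.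
rewrite /pair_index /= (_ : lift (lift ord0 ord0 : 'I_2) a = ord0) ?eqxx //.
by apply/val_inj; case: a => -[].
Qed.

(** Antisymmetrizing L(K_i) A_j yields the bracket, D A, and the torsion of A contracted with K_l;
    the last is in R_q. The symbols S_i coming from the hypotheses assemble to the one-form whose
    delta appears. *)
Lemma linear_bracket_spencer y (K : 'I_n -> jet) (A : 'I_n -> pt -> jet) : W y ->
  (forall i, P y (K i)) -> family_over_id K ->
  (forall i, den1 (E y) (lie_family y (K i) A)) ->
  den2 (E y) (fun i j => linear_bracket K (fun l => A l y) i j + spencer_family A y i j).
Proof.
move=> Wy PK Kid dL; have [B /choice[S BS]] := choice dL.
have EB i j : E y (B i j) by have [] := BS i.
have symS i : is_symbol q.+1 (S i) by have [] := BS i.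
have LE i j : lie_family y (K i) A j = B i j + formal_deriv j (S i) by have [] := BS i.
exists (fun i j => B i j - B j i
  - \sum_l torsion (fun l => A l y) i j l *: jproj q (K l)), (fun i => - S i); split.
- move=> i j; apply: (subbundleD subE Wy).
    by apply: (subbundleD subE Wy) => //; exact: (subbundleN subE Wy).
  apply: (subbundleN subE Wy); apply: (subbundle_sum subE Wy) => l.
  by apply: (subbundleZ subE _ Wy); exact: prolongation1_jproj.
- move=> i j; rewrite opprD opprB; congr (_ - _).
  by rewrite -sumrN; apply: eq_bigr => l _; rewrite -scaleNr /torsion opprB.
- by move=> i; rewrite -scaleN1r; exact: is_symbolZ.
- move=> i j; rewrite /linear_bracket /spencer_family !formal_derivN.
  have E1 a b : B a b = alg_bracket q (K a) (A b y) + spencer_jet q (A b) a y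
      + \sum_l K a l (munit b) *: jproj q (A l y) - formal_deriv b (S a).
    have := LE a b; rewrite /lie_family (sum_over_id a (fun i => spencer_jet q (A b) i y) Kid) => ->.
    by rewrite addrK.
  have -> : \sum_l torsion K i j l *: jproj q (A l y) =
      \sum_l K j l (munit i) *: jproj q (A l y) - \sum_l K i l (munit j) *: jproj q (A l y).
    by rewrite -sumrB; apply: eq_bigr => l _; rewrite scalerBl.
  rewrite !E1.
  by apply: jetP => k m; rewrite !(jetDE, jetNE); ring.
Qed.

End CartanDeformations.

(** * The linearized bracket as a derivative *)

Section LinearBracket.
Variables (R : realType) (n q : nat).
Local Notation jet := (jet R n).
Local Notation jform := (jform R n).
Implicit Types (chi A : jform 1).

Lemma half_bracketE chi i j : family_over_id (fun l => chi (fun=> l)) ->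
  half_bracket q chi (pair_index i j) = half_bracket1 q (fun l => chi (fun=> l)) i j.
Proof.
move=> id; rewrite /half_bracket /half_bracket1; congr (_ - _).
apply: eq_bigr => l _; congr (_ *: _); rewrite alg_bracket0E sumrB.
have E a b : \sum_r chi (fun=> a) r mzero * b r = b a.
  rewrite (bigD1 a) //= id eqxx mul1r big1 ?addr0 // => r ra.
  by rewrite id (negbTE ra) mul0r.
by rewrite (E i (fun r => chi (fun=> j) l (munit r))) (E j (fun r => chi (fun=> i) l (munit r))).
Qed.

Lemma half_bracket_quadratic (K A : 'I_n -> jet) (t : R) i j :
  half_bracket1 q (fun l => K l + t *: A l) i j =
  half_bracket1 q K i j + t *: linear_bracket q K A i j + (t * t) *: half_bracket1 q A i j.
Proof.
rewrite /half_bracket1 /linear_bracket !alg_bracketDl !alg_bracketDr.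
rewrite !alg_bracketZl !alg_bracketZr (alg_bracketC _ (A i) (K j)).
have -> : \sum_l torsion (fun l => K l + t *: A l) i j l *: jproj q (K l + t *: A l) =
    \sum_l torsion K i j l *: jproj q (K l)
    + t *: (\sum_l torsion A i j l *: jproj q (K l) + \sum_l torsion K i j l *: jproj q (A l))
    + (t * t) *: \sum_l torsion A i j l *: jproj q (A l).
  rewrite -big_split !scaler_sumr -!big_split; apply: eq_bigr => l _ /=.
  rewrite jprojD jprojZ /torsion; apply: jetP => k m.
  by rewrite !(jetDE, jetNE, jetZE); ring.
by apply: jetP => k m; rewrite !(jetDE, jetNE, jetZE); ring.
Qed.

Lemma derive_quadratic (a b c : R) : 'D_1 (fun t : R => a + t * b + t * t * c) 0 = b.
Proof.
have E : (fun h : R => h^-1 *: (((fun t : R => a + t * b + t * t * c) \o shift 0) (h *: 1)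
    - (a + 0 * b + 0 * 0 * c))) @ 0^' --> b.
  have c0 : (fun h : R => b + h * c) @ 0^' --> b + 0 * c.
    apply: cvgD; first exact: cvg_cst.
    by apply: cvgM; [exact: nbhs_dnbhs|exact: cvg_cst].
  rewrite mul0r addr0 in c0; apply: cvg_trans c0; apply: near_eq_cvg; near=> h.
  have h0 : h != 0 by near: h; exact: nbhs_dnbhs_neq.
  rewrite /= addr0 [_%:A]mulr1 /GRing.scale /=; field.
  exact: h0.
exact: (cvg_lim _ E).
Unshelve. all: by end_near. Qed.

(** A lies over zero, so chi + t A stays over the identity and the half bracket is a quadratic
    polynomial in t. *)
Lemma half_bracket_derive chi A i j : family_over_id (fun l => chi (fun=> l)) ->
  (forall s k, A s k mzero = 0) ->
  (fun k m => 'D_1 (fun t : R => half_bracket q (chi + t *: A) (pair_index i j) k m) 0) =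
  linear_bracket q (fun l => chi (fun=> l)) (fun l => A (fun=> l)) i j.
Proof.
move=> id A0; apply: jetP => k m.
have -> : (fun t : R => half_bracket q (chi + t *: A) (pair_index i j) k m) =
    (fun t => half_bracket1 q (fun l => chi (fun=> l)) i j k m
      + t * linear_bracket q (fun l => chi (fun=> l)) (fun l => A (fun=> l)) i j k m
      + t * t * half_bracket1 q (fun l => A (fun=> l)) i j k m).
  apply/funext => t; rewrite half_bracketE.
    by rewrite (half_bracket_quadratic (fun l => chi (fun=> l)) (fun l => A (fun=> l)) t i j).
  move=> a b; rewrite -[LHS]/(chi (fun=> a) b mzero + t * A (fun=> a) b mzero).
  by rewrite id A0 mulr0 addr0.
exact: derive_quadratic.
Qed.

End LinearBracket.

(** * The class of an R_q-connection in charts *)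

Section Charts.
Variables (R : realType) (n q : nat) (X : manifold R n) (Rq : system X) (U : set X).
Local Notation pt := 'rV[R]_n.
Local Notation jet := (jet R n).
Local Notation jform := (jform R n).
Local Notation chart_prol a := (prolongation q 1 (Rq a)).

Lemma chart_image_open a (oU : open U) : open (chart_image a U).
Proof.
have E : chart_image a U = (chart a @` Defs.dom a) `&` (ichart a @^-1` U).
  apply/seteqP; split => [_ [x [Ux dx] <-]|_ [[x dx <-] Ux]].
    by split; [exists x|rewrite /preimage /= chartK].
  by exists x => //; split => //; move: Ux; rewrite /preimage /= chartK.
rewrite E openE => y [dy Uy].
have N1 : nbhs y (chart a @` Defs.dom a).
  by apply: open_nbhs_nbhs; split; [exact: chart_open|].
have N2 : nbhs y (ichart a @^-1` U).
  by apply: (ichart_continuous dy); apply: open_nbhs_nbhs.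
exact: filterI N1 N2.
Qed.

Lemma chart_imageT_open a : open (chart_image a [set: X]).
Proof. by rewrite /chart_image setTI; exact: chart_open. Qed.

Lemma chart_imageS a : chart_image a U `<=` chart_image a [set: X].
Proof. by move=> _ [x [_ dx] <-]; exists x. Qed.

Hypothesis q_gt0 : (0 < q)%N.
Hypothesis sysR : is_system q Rq.
Hypothesis lieR : infinitesimal_lie_equations q Rq.
Hypothesis invR : involutive_system q Rq.
Hypothesis oU : open U.

Let subE a : vector_subbundle q (chart_image a [set: X]) (Rq a).
Proof. exact: sysR.1. Qed.

Let subP a : vector_subbundle q.+1 (chart_image a [set: X]) (chart_prol a).
Proof. by have [/(_ 1%N)] := invR a; rewrite addn1. Qed.

Let liftE a y x : chart_image a [set: X] y -> Rq a y x ->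
  exists2 x', chart_prol a y x' & jproj q x' = x.
Proof.
move=> Wy Ex; have [_ /(_ 0%N y Wy x) H _] := invR a.
by move: H; rewrite (prolongation0 (@subE a) Wy) addn0; apply.
Qed.

Lemma den_affineP a y (A : jform 1) : den_affine q Rq a y A -> exists B S,
  [/\ forall i, Rq a y (B i), forall i k, B i k mzero = 0, is_symbol q.+1 S &
  forall i, A (fun=> i) = B i + formal_deriv i S].
Proof.
move=> /janet_den1P[B [S [EB symS AE]]]; exists B, S; split => // i.
  by have [] := EB i.
by move=> k; have [_ [_ ->]] := EB i.
Qed.

Lemma formal_deriv_symbol0 (S : jet) i k : is_symbol q.+1 S -> formal_deriv i S k mzero = 0.
Proof. by move=> symS; apply: symS; rewrite add0m mdeg_unit ltn_eqF. Qed.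

Variable chi : form_family X 1.
Hypothesis conn : connection q Rq U chi.
Local Notation c := (affine_class q Rq chi).

Let chi_id a y : chart_image a U y -> family_over_id (fun l => chi a y (fun=> l)).
Proof. by move=> Uy i k; have [id _] := conn.2.2 a y Uy; rewrite id. Qed.

Let chi_in a y i : chart_image a U y -> Rq a y (chi a y (fun=> i)).
Proof. by move=> Uy; have [_ [_]] := conn.2.2 a y Uy. Qed.

Lemma affine_class_self a y : chart_image a U y -> c a y (chi a y).
Proof.
move=> Uy; apply/janet_den1P; exists (fun=> 0), 0; split => // i.
  by split; [exact: (subbundle0 (@subE a) (chart_imageS Uy))|].
by rewrite -[LHS]/(chi a y (fun=> i) - chi a y (fun=> i)) subrr addr0.
Qed.

(** A representative differs from chi by some B in R^0_q and some delta S; chi + B is R_q-valued,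
    over the identity, and lifts to K in R_{q+1}. *)
Lemma affine_class_rep a y (A : jform 1) : chart_image a U y -> c a y (fproj q A) ->
  (forall i, is_jet q.+1 (A (fun=> i))) ->
  family_over_id (fun l => A (fun=> l)) /\ exists K S,
  [/\ forall i, chart_prol a y (K i), family_over_id K, is_symbol q.+1 S &
   forall i, jproj q (A (fun=> i)) = jproj q (K i) + formal_deriv i S].
Proof.
move=> Uy /den_affineP[B [S [EB B0 symS AE]]] jA.
have Wy := chart_imageS Uy.
have AE' i : jproj q (A (fun=> i)) = chi a y (fun=> i) + B i + formal_deriv i S.
  have /eqP := AE i; rewrite -[X in X == _]/(jproj q (A (fun=> i)) - chi a y (fun=> i)).
  by rewrite subr_eq => /eqP ->; rewrite addrC addrA.
have /choice[K KP] : forall i, exists x, chart_prol a y x /\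
    jproj q x = chi a y (fun=> i) + B i.
  move=> i; have [|x] := liftE Wy (x := chi a y (fun=> i) + B i); last by exists x.
  by apply: (subbundleD (@subE a) Wy) => //; exact: chi_in.
have id0 (x : jet) k : x k mzero = jproj q x k mzero by rewrite /jproj mdeg_mzero.
split.
  move=> i k; rewrite id0 AE' !jetDE B0 formal_deriv_symbol0 // !addr0.
  exact: (chi_id Uy).
exists K, S; split => // [i|i k|i].
- by have [] := KP i.
- by rewrite id0 (KP i).2 jetDE B0 addr0; exact: (chi_id Uy).
- by rewrite (KP i).2.
Qed.

Lemma affine_class_section : affine_section q Rq U c.
Proof.
split=> [a b x Ux dax dbx|a y Uy].
  exists (chi a (chart a x)); first by apply: affine_class_self; exists x.
  by rewrite -conn.1 //; apply: affine_class_self; exists x.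
exists (chart_image a U), (chi a); split => //.
- exact: chart_image_open.
- exact: conn.2.1.
- by move=> z Uz; split=> //; have [] := conn.2.2 a z Uz.
Qed.

Lemma affine_class_invariant : affine_invariant q Rq U c.
Proof.
move=> a V xi A oV VU sxi Exi [sA cA] y Vy; apply/janet_den1P.
have VW : V `<=` chart_image a [set: X] by move=> z /VU /chart_imageS.
have -> : (fun i => lie_form q xi A y (fun=> i)) =
    lie_family q y (xi y) (fun l z => A z (fun=> l)).
  by apply/funext => i; rewrite lie_form1E.
apply: (lie_family_connection q_gt0 (@chart_imageT_open a) (@subE a) (@subP a) (@liftE a) (@lieR a)
  (VW y Vy) oV Vy VW (chi := fun l z => chi a z (fun=> l))).
- exact: sxi.2.
- exact: Exi.
- by move=> l z Vz; apply: chi_in; exact: VU.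
- by move=> l; exact: sA.1.
- move=> z Vz; have [B [S [EB _ symS AE]]] := den_affineP (cA z Vz).
  by exists B, S; split.
- have [] // := affine_class_rep (VU y Vy) (cA y Vy) _.
  by move=> i; exact: (sA.1 (fun=> i)).2.
Qed.

Lemma affine_class_half_bracket : half_bracket_zero q Rq U c.
Proof.
move=> a y Uy A jA cA; have [Aid [K [S [PK Kid symS AK]]]] := affine_class_rep Uy cA (fun i => jA (fun=> i)).
apply/janet_den2P.
have -> : (fun i j => half_bracket q A (pair_index i j)) =
    half_bracket1 q (fun l => A (fun=> l)).
  by apply/funext => i; apply/funext => j; exact: half_bracketE.
exact: (half_bracket_den q_gt0 (@chart_imageT_open a) (@subE a) (@subP a) (@lieR a) (chart_imageS Uy)
  PK Kid (fun i => jA (fun=> i)) symS AK).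
Qed.

(** * Linearized bracket against Janet operator *)

Section Deformation.
Variable C : class_family X 1.
Hypothesis secC : janet_section q Rq U C.
Hypothesis invC : janet_invariant q Rq U C.

(** Invariance is tested on sections of R_{q+1}; extending x to one gives the condition for a single
    element, as only its value at y matters. *)
Lemma invariant_lie_family a V (A : pt -> jform 1) y (x : jet) : open V -> V y ->
  V `<=` chart_image a U -> lifts_class q C a V A -> chart_prol a y x ->
  den1 q (Rq a y) (lie_family q y x (fun l z => A z (fun=> l))).
Proof.
move=> oV Vy VU [sA CA] Px; have Wy := chart_imageS (VU y Vy).
have [V1 [ext [oV1 V1y /(_ x Px)[sx Pext extx]]]] := subbundle_extend (@subP a) Wy.
have sub1 : V `&` V1 `<=` V by move=> z [].
have sub2 : V `&` V1 `<=` V1 by move=> z [].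
have := @invC a (V `&` V1) (ext x) A (openI oV oV1) (subset_trans sub1 VU)
  (jet_section_sub sub2 sx) (fun z Vz => Pext z (sub2 z Vz)) _ y (conj Vy V1y).
move=> H; have /janet_den1P : den_janet q Rq a y (lie_form q (ext x) A y).
  apply: H; split => [|z [Vz _]]; last exact: CA.
  split=> [s|z _]; last exact: alternating1.
  exact: jet_section_sub sub1 (sA.1 s).
congr (den1 q (Rq a y) _); apply/funext => i.
by rewrite lie_form1E extx.
Qed.

Lemma linear_bracket_zeroP a y (A A' : jform 1) : chart_image a U y ->
  family_over_id (fun l => A (fun=> l)) -> (forall s k, A' s k mzero = 0) ->
  den_janet q Rq a y
    (fun s k m => 'D_1 (fun t : R => half_bracket q (A + t *: A') s k m) 0) <->
  den2 q (Rq a y) (linear_bracket q (fun l => A (fun=> l)) (fun l => A' (fun=> l))).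
Proof.
move=> Uy Aid A'0.
suff <- : (fun i j k m => 'D_1 (fun t : R => half_bracket q (A + t *: A') (pair_index i j) k m) 0)
  = linear_bracket q (fun l => A (fun=> l)) (fun l => A' (fun=> l)) by exact: janet_den2P.
by apply/funext => i; apply/funext => j; exact: half_bracket_derive.
Qed.

Lemma janet_operator_zeroP a (A : pt -> jform 1) y :
  den_janet q Rq a y (spencer q A y) <->
  den2 q (Rq a y) (spencer_family q (fun l z => A z (fun=> l)) y).
Proof.
suff <- : (fun i j => spencer q A y (pair_index i j)) =
  spencer_family q (fun l z => A z (fun=> l)) y by exact: janet_den2P.
by apply/funext => i; apply/funext => j; exact: spencer1E.
Qed.

(** The bracket condition tests only representatives over zero, so a section of R_{q+1} is
    subtracted from the given lift. The class is unchanged, and D of what is subtracted is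
    R_q-valued. *)
Lemma linear_bracket_zero_operator :
  linear_bracket_zero q Rq U c C -> janet_operator_zero q Rq U C.
Proof.
move=> lbC a V A oV VU [sA CA] y Vy; apply/janet_operator_zeroP.
have Uy := VU y Vy; have Wy := chart_imageS Uy.
have /choice[K KP] : forall i, exists x, chart_prol a y x /\ jproj q x = chi a y (fun=> i).
  by move=> i; have [x Px xE] := liftE Wy (chi_in i Uy); exists x.
have PK i : chart_prol a y (K i) by have [] := KP i.
have Kid : family_over_id K.
  move=> i k; rewrite -(chi_id Uy i k) -(KP i).2 /jproj mdeg_mzero.
  by [].
have [V0 [A0 [oV0 V0y _ _ CE]]] := secC.2 a y Uy.
have [V1 [ext [oV1 V1y extP]]] := subbundle_extend (@subP a) Wy.
pose V2 := V `&` (V0 `&` V1).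
have oV2 : open V2 by do 2 apply: openI => //.
have V2y : V2 y by [].
have subV : V2 `<=` V by move=> z [].
have sub1 : V2 `<=` V1 by move=> z [_ []].
have sext l : jet_section q.+1 V2 (ext (K l)).
  by have [s _ _] := extP _ (PK l); exact: jet_section_sub sub1 s.
have Pext l z : V2 z -> chart_prol a z (ext (K l) z).
  by move=> /sub1 V1z; have [_ + _] := extP _ (PK l); apply.
have exty l : ext (K l) y = K l by have [] := extP _ (PK l).
(* The coefficients are frozen at y; since K_l lies over d_l, [corr] agrees with A in order zero at
   y. *)
pose corr s (z : pt) : jet := \sum_l A y s l mzero *: ext (K l) z.
pose A' (z : pt) : jform 1 := fun s => A z s + (-1) *: corr s z.
have scorr s : jet_section q.+1 V2 (corr s).
  by apply: jet_section_sum => // l; exact: jet_sectionZ.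
have sA2 s : jet_section q.+1 V2 (fun z => A z s) by exact: jet_section_sub subV (sA.1 s).
have sA' : jform_section q.+1 V2 A'.
  split=> [s|z _]; last exact: alternating1.
  by apply: jet_sectionD => //; exact: jet_sectionZ.
have lA' : lifts_class q C a V2 A'.
  split=> // z V2z; have Wz : chart_image a [set: X] z by apply/chart_imageS/VU/subV.
  have [_ [V0z _]] := V2z; rewrite (CE z V0z); apply/janet_den1P.
  have := CA z (subV z V2z); rewrite (CE z V0z) => /janet_den1P dA.
  have -> : (fun i => (fproj q (A' z) - A0 z) (fun=> i)) = fun i =>
      (fproj q (A z) - A0 z) (fun=> i) + (-1) *: jproj q (corr (fun=> i) z).
    apply/funext => i; rewrite -[LHS]/(jproj q (A' z (fun=> i)) - A0 z (fun=> i)).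
    by rewrite /A' jprojD jprojZ addrAC.
  apply: (den1D (@subE a) Wz dA); apply: den1_in => i; apply: (subbundleZ (@subE a) _ Wz).
  rewrite /corr jproj_sum; apply: (subbundle_sum (@subE a) Wz) => l; rewrite jprojZ.
  by apply: (subbundleZ (@subE a) _ Wz); apply: prolongation1_jproj; exact: Pext.
have A'0 s k : A' y s k mzero = 0.
  rewrite /A' jetDE jetZE /corr jet_sumE (bigD1 k) //= big1 => [|l lk].
    by rewrite jetZE exty Kid eqxx mulr1 addr0 mulN1r subrr.
  by rewrite jetZE exty Kid eq_sym (negbTE lk) mulr0.
have dsum := linear_bracket_spencer (@subE a) Wy PK Kid
  (fun i => invariant_lie_family oV2 V2y (subset_trans subV VU) lA' (PK i)).
have dlin : den2 q (Rq a y) (linear_bracket q K (fun l => A' y (fun=> l))).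
  apply: ((@linear_bracket_zeroP a y (fun s => K (s ord0)) (A' y) Uy Kid A'0).1 _).
  apply: lbC => //.
  - by move=> s; exact: prolongation1_jet (PK _).
  - by move=> s; split => //; exact: (sA'.1 s).2.
  - have -> : fproj q (fun s : 'I_1 -> 'I_n => K (s ord0)) = chi a y.
      apply/funext => s; rewrite /fproj (KP _).2; congr (chi a y _).
      by rewrite -ord1_fun.
    exact: affine_class_self.
  - exact: lA'.2.
have dspencer : den2 q (Rq a y) (spencer_family q (fun l z => A' z (fun=> l)) y).
  have := den2D (@subE a) Wy dsum (den2N (@subE a) Wy dlin).
  congr (den2 q _ _); apply/funext => i; apply/funext => j.
  by rewrite addrAC subrr add0r.
have Ecorr i s : Rq a y (spencer_jet q (corr s) i y).
  rewrite (spencer_jet_sum _ _ _ oV2 V2y); last first.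
    by move=> l; exact: (jet_sectionZ _ oV2 (sext l)).1.
  apply: (subbundle_sum (@subE a) Wy) => l.
  rewrite (spencer_jetZ _ _ _ V2y (sext l).1); apply: (subbundleZ (@subE a) _ Wy).
  apply: (spencer_prolongation (@subE a) (@chart_imageT_open a) i Wy oV2 V2y (sext l)) => [z V2z|].
    by apply: prolongation1_jproj; exact: Pext.
  exact: Pext.
have dcorr : den2 q (Rq a y) (fun i j => spencer_jet q (corr (fun=> j)) i y
    - spencer_jet q (corr (fun=> i)) j y).
  exists (fun i j => spencer_jet q (corr (fun=> j)) i y - spencer_jet q (corr (fun=> i)) j y),
    (fun=> 0); split => // [i j|i j|i j].
  - apply: (subbundleD (@subE a) Wy); first exact: Ecorr.
    by apply: (subbundleN (@subE a) Wy); exact: Ecorr.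
  - by rewrite opprB.
  - by rewrite [formal_deriv _ _]/(0 : jet) subr0 addr0.
have := den2D (@subE a) Wy dspencer dcorr; congr (den2 q _ _).
apply/funext => i; apply/funext => j; rewrite /spencer_family.
have E b s : spencer_jet q (fun z => A' z s) b y =
    spencer_jet q (fun z => A z s) b y - spencer_jet q (corr s) b y.
  rewrite (spencer_jetD q b V2y (sA2 s).1 (jet_sectionZ _ oV2 (scorr s)).1).
  by rewrite (spencer_jetZ q _ b V2y (scorr s).1) scaleN1r.
by rewrite !E; apply: jetP => k m; rewrite !(jetDE, jetNE); ring.
Qed.

(** The operator acts on sections, so the pointwise representative B is extended to a local lift of
    C. The bracket is obtained for K in R_{q+1} and carried to the given representative of c by
    [linear_bracket_den]. *)
Lemma operator_zero_linear_bracket :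
  janet_operator_zero q Rq U C -> linear_bracket_zero q Rq U c C.
Proof.
move=> opC a y Uy A B jA jB cA CB; have Wy := chart_imageS Uy.
have [Aid [K [S [PK Kid symS AK]]]] := affine_class_rep Uy cA (fun i => jA (fun=> i)).
have B0 s k : B s k mzero = 0 by have [_ ->] := jB s.
apply/(linear_bracket_zeroP Uy Aid B0).
have [V0 [A0 [oV0 V0y V0U sA0 CE]]] := secC.2 a y Uy.
have := CB; rewrite (CE y V0y) => /janet_den1P[D [T [ED symT BE]]].
have [V1 [ext [oV1 V1y extP]]] := subbundle_extend (@subE a) Wy.
have oV2 : open (V0 `&` V1) by exact: openI.
have V2y : (V0 `&` V1) y by [].
have sub0 : V0 `&` V1 `<=` V0 by move=> z [].
have sub1 : V0 `&` V1 `<=` V1 by move=> z [].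
(* This constant makes A'(y) equal to B. Its projection to order q is delta T, so A' stays in the
   class C near y. *)
pose rest s : jet := B s + (-1) *: (A0 y s + D (s ord0)).
pose A' (z : pt) : jform 1 := fun s => A0 z s + (ext (D (s ord0)) z + rest s).
have jrest s : is_jet q.+1 (rest s).
  apply: is_jetD; first by have [] := jB s.
  apply/is_jetZ/jetS/is_jetD; first exact: (sA0.1 s).2.
  exact: (subbundle_jet (@subE a) Wy).
have A'y : A' y = B.
  apply/funext => s; have [_ _ e] := extP _ (ED (s ord0)); rewrite /A' e /rest.
  by apply: jetP => k m; rewrite !(jetDE, jetZE); ring.
have lA' : lifts_class q C a (V0 `&` V1) A'.
  split.
    split=> [s|z _]; last exact: alternating1.
    apply: jet_sectionD => //.
      exact/jet_sectionS/(jet_section_sub sub0 (sA0.1 s)).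
    apply: jet_sectionD => //; last exact: jet_section_cst.
    by have [se _ _] := extP _ (ED (s ord0)); exact/jet_sectionS/(jet_section_sub sub1 se).
  move=> z [V0z V1z]; have Wz : chart_image a [set: X] z by apply/chart_imageS/V0U.
  rewrite (CE z V0z); apply/janet_den1P; exists (fun i => ext (D i) z), T; split => // i.
    by have [_ + _] := extP _ (ED i); apply.
  have [_ /(_ z V1z) Eext _] := extP _ (ED i).
  rewrite -[LHS]/(jproj q (A' z (fun=> i)) - A0 z (fun=> i)) /A' /rest !jprojD jprojZ jprojD.
  rewrite (jproj_id ((sA0.1 _).2 z V0z)) (jproj_id ((sA0.1 _).2 y V0y)).
  rewrite (jproj_id (subbundle_jet (@subE a) Wy (ED i))) (jproj_id (subbundle_jet (@subE a) Wz Eext)).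
  have := BE i; rewrite -[LHS]/(jproj q (B (fun=> i)) - A0 y (fun=> i)) => /eqP.
  rewrite subr_eq => /eqP ->.
  by apply: jetP => k m; rewrite !(jetDE, jetNE, jetZE); ring.
have V2U := subset_trans sub0 V0U.
have dsum := linear_bracket_spencer (@subE a) Wy PK Kid
  (fun i => invariant_lie_family oV2 V2y V2U lA' (PK i)).
have /janet_operator_zeroP dspencer := opC a _ A' oV2 V2U lA' y V2y.
have dK := den2D (@subE a) Wy dsum (den2N (@subE a) Wy dspencer).
have dA := linear_bracket_den q_gt0 (@subE a) Wy PK (fun i => jA (fun=> i)) symS AK
  (A := fun i => B (fun=> i)) (fun i => B0 (fun=> i)).
have := den2D (@subE a) Wy dK dA; congr (den2 q _ _).
apply/funext => i; apply/funext => j; rewrite A'y.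
by apply: jetP => k m; rewrite !(jetDE, jetNE); ring.
Qed.

End Deformation.
End Charts.

Theorem theorem5p46 (R : realType) (n q : nat) (X : manifold R n)
    (Rq : system X) (U : set X) (chi : form_family X 1) :
  (1 <= q)%N ->
  is_system q Rq ->
  infinitesimal_lie_equations q Rq ->
  transitive_system Rq ->
  involutive_system q Rq ->
  open U ->
  connection q Rq U chi ->
  let c := affine_class q Rq chi in
  Cart q Rq U c /\
  infinitesimal_deformations q Rq U c = cocycles q 0 Rq U.
Proof.
move=> q_gt0 sysR lieR _ invR oU conn c; split.
  split; [exact: affine_class_section|exact: affine_class_invariant
    |exact: affine_class_half_bracket].
apply/seteqP; split => C.
  move=> [secC invC lbC]; split=> //.
  exact: linear_bracket_zero_operator lbC.
move=> [[secC invC] opC]; split=> //.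
exact: operator_zero_linear_bracket opC.
Qed.
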